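(* Let $q\in\mathbb{R}$ with $|q|>1$ and let $n\ge 0$. For each $\lambda\in S^1=\{\lambda\in\mathbb{C}:|\lambda|=1\}$ let $\psi^{(2n+1)}_\lambda$ be defined on the Hilbert space with orthonormal basis $\{|k_1,\dots,k_n\rangle : k_i\in\mathbb{Z}_{\ge0}\}$ by $$\psi^{(2n+1)}_\lambda(x_1)|k_1,\dots,k_n\rangle=\lambda\, q^{-(k_1+\dots+k_n)}|k_1,\dots,k_n\rangle,$$ $$\psi^{(2n+1)}_\lambda(x_i)|k_1,\dots,k_n\rangle=(1-q^{-2k_{i-1}})^{1/2}q^{-(k_i+\dots+k_n)}|k_1,\dots,k_{i-1}-1,\dots,k_n\rangle,$$ $$\psi^{(2n+1)}_\lambda(x_i^* )|k_1,\dots,k_n\rangle=(1-q^{-2(k_{i-1}+1)})^{1/2}q^{-(k_i+\dots+k_n)}|k_1,\dots,k_{i-1}+1,\dots,k_n\rangle$$ for $i=2,\dots,n+1$, and $\psi^{(2n+1)}_\lambda(x_1^* )=\psi^{(2n+1)}_\lambda(x_1)^*$. (For $n=0$ the Hilbert space is $\mathbb{C}$ and $\psi^{(1)}_\lambda(x_1)=\lambda$.) Then the irreducible $*$-representations of $A(S^{2n+1}_q)$, up to unitary equivalence, are indexed by the disjoint union of $n+1$ copies of $S^1$. They are the representations $\psi^{(2m+1)}_\lambda$, $0\le m\le n$, $\lambda\in S^1$, where for $m<n$ the representation $\psi^{(2m+1)}_\lambda$ of $A(S^{2m+1}_q)$ is composed with the quotient homomorphism $A(S^{2n+1}_q)\to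 A(S^{2m+1}_q)$.
   Context: For $N\ge0$, the $*$-algebra $A(S^{2N+1}_q)$ is the unital complex $*$-algebra generated by $x_i,x_i^*$ ($i=1,\dots,N+1$) with relations $$x_ix_j=q\,x_jx_i\ (i<j),\qquad x_i^*x_j=q\,x_jx_i^*\ (i\neq j),\qquad [x_i,x_i^*]=(1-q^{-2})s_{i-1},\qquad s_{N+1}=1,$$ where $s_0:=0$ and $s_i:=s_{i-1}+x_i^*x_i$. The quotient homomorphism $A(S^{2N+1}_q)\to A(S^{2N-1}_q)$ sends $x_1\mapsto 0$ and $x_i\mapsto x_{i-1}$ for $i\ge2$. The homomorphism $A(S^{2n+1}_q)\to A(S^{2m+1}_q)$ is the composition of these. Irreducible $*$-representations are unital representations by bounded operators on a separable Hilbert space. *)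

(* Defs.v *)
From HB Require Import structures.
From mathcomp Require Import all_boot all_order all_algebra.
From mathcomp Require Import all_classical all_reals all_analysis.
From mathcomp Require Import complex sesquilinear.
Set Implicit Arguments.
Unset Strict Implicit.
Unset Printing Implicit Defensive.
Import Order.TTheory GRing.Theory Num.Theory Num.Def.
Import numFieldNormedType.Exports.
Local Open Scope classical_set_scope.
Local Open Scope ring_scope.
Local Open Scope complex_scope.
Local Open Scope quotient_scope.

HB.mixin Record isStarAlgebra (C : numClosedFieldType) A
    of GRing.Algebra C A := {
  star : A -> A;
  starK : involutive star;
  starD : {morph star : a b / a + b};
  starM : forall a b, star (a * b) = star b * star a;
  starZ : forall (c : C) a, star (c *: a) = conjC c *: star a
}.

#[short(type="starAlgType")]
HB.structure Definition StarAlgebra (C : numClosedFieldType) :=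
  {A of isStarAlgebra C A & GRing.Algebra C A}.

Section StarTheory.
Variables (C : numClosedFieldType) (A : starAlgType C).

Lemma star1 : star (1 : A) = 1.
Proof. by have := starM (star (1 : A)) 1; rewrite mulr1 starK mulr1 => <-. Qed.

Lemma star0 : star (0 : A) = 0.
Proof. by apply: (addrI (star 0)); rewrite -starD !addr0. Qed.

End StarTheory.

Section Scalars.
Variable C : numClosedFieldType.

Fact regular_starM (a b : C^o) : conjC (a * b) = conjC b * conjC a :> C^o.
Proof. by rewrite rmorphM mulrC. Qed.

HB.instance Definition _ := isStarAlgebra.Build C C^o
  (@conjCK C) (rmorphD conjC) regular_starM (fun c a => rmorphM conjC c a).

End Scalars.

(* The unital *-algebra generated by [X] subject to relations [rel] consists of
   the *-expressions in [X] modulo the least congruence [star_eqv rel]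
   containing [rel] and the axioms of unital complex *-algebras. The scalar
   multiple [c *: t] is the product [EMul (EConst c) t].                      *)
Inductive star_expr (C X : Type) : Type :=
| EVar of X
| EConst of C
| EAdd of star_expr C X & star_expr C X
| EMul of star_expr C X & star_expr C X
| EStar of star_expr C X.
Arguments EVar {C X}.
Arguments EConst {C X}.

HB.instance Definition _ (C X : Type) := gen_eqMixin (star_expr C X).
HB.instance Definition _ (C X : Type) := gen_choiceMixin (star_expr C X).

Section Congruence.
Variables (C : numClosedFieldType) (X : Type).
Local Notation expr := (star_expr C X).
Variable rel : expr -> expr -> Prop.

Inductive star_eqv : expr -> expr -> Prop :=
| SE_rel s t : rel s t -> star_eqv s t
| SE_refl s : star_eqv s s
| SE_sym s t : star_eqv s t -> star_eqv t s
| SE_trans s t u : star_eqv s t -> star_eqv t u -> star_eqv s u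
| SE_add s s' t t' : star_eqv s s' -> star_eqv t t' ->
    star_eqv (EAdd s t) (EAdd s' t')
| SE_mul s s' t t' : star_eqv s s' -> star_eqv t t' ->
    star_eqv (EMul s t) (EMul s' t')
| SE_star s s' : star_eqv s s' -> star_eqv (EStar s) (EStar s')
| SE_addA s t u : star_eqv (EAdd s (EAdd t u)) (EAdd (EAdd s t) u)
| SE_addC s t : star_eqv (EAdd s t) (EAdd t s)
| SE_add0 s : star_eqv (EAdd (EConst 0) s) s
| SE_mulA s t u : star_eqv (EMul s (EMul t u)) (EMul (EMul s t) u)
| SE_mul1 s : star_eqv (EMul (EConst 1) s) s
| SE_mul0 s : star_eqv (EMul (EConst 0) s) (EConst 0)
| SE_mulDl s t u : star_eqv (EMul (EAdd s t) u) (EAdd (EMul s u) (EMul t u))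
| SE_mulDr s t u : star_eqv (EMul s (EAdd t u)) (EAdd (EMul s t) (EMul s u))
| SE_constD c d : star_eqv (EConst (c + d)) (EAdd (EConst c) (EConst d))
| SE_constM c d : star_eqv (EConst (c * d)) (EMul (EConst c) (EConst d))
| SE_constC c s : star_eqv (EMul (EConst c) s) (EMul s (EConst c))
| SE_starK s : star_eqv (EStar (EStar s)) s
| SE_starD s t : star_eqv (EStar (EAdd s t)) (EAdd (EStar s) (EStar t))
| SE_starM s t : star_eqv (EStar (EMul s t)) (EMul (EStar t) (EStar s))
| SE_starC c : star_eqv (EStar (EConst c)) (EConst (conjC c)).

Fixpoint star_eval (B : starAlgType C) (y : X -> B) (t : expr) : B :=
  match t with
  | EVar i => y i
  | EConst c => c%:A
  | EAdd s t => star_eval y s + star_eval y t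
  | EMul s t => star_eval y s * star_eval y t
  | EStar s => star (star_eval y s)
  end.

Lemma star_eval_eqv (B : starAlgType C) (y : X -> B) :
  (forall s t, rel s t -> star_eval y s = star_eval y t) ->
  forall s t, star_eqv s t -> star_eval y s = star_eval y t.
Proof.
move=> yrel s t; elim=> //=; try by move=> *; congruence.
- by move=> *; rewrite addrA.
- by move=> *; rewrite addrC.
- by move=> *; rewrite scale0r add0r.
- by move=> *; rewrite mulrA.
- by move=> *; rewrite scale1r mul1r.
- by move=> *; rewrite scale0r mul0r.
- by move=> *; rewrite mulrDl.
- by move=> *; rewrite mulrDr.
- by move=> *; rewrite scalerDl.
- by move=> *; rewrite -scalerAl mul1r scalerA.
- by move=> *; rewrite -scalerAl -scalerAr mul1r mulr1.
- by move=> *; rewrite starK.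
- by move=> *; rewrite starD.
- by move=> *; rewrite starM.
- by move=> *; rewrite starZ star1.
Qed.

Let eqvb (s t : expr) := `[< star_eqv s t >].

Fact star_eqv_refl : reflexive eqvb.
Proof. by move=> s; apply/asboolP/SE_refl. Qed.

Fact star_eqv_sym : symmetric eqvb.
Proof. by move=> s t; apply/asbool_equiv_eq; split; apply: SE_sym. Qed.

Fact star_eqv_trans : transitive eqvb.
Proof.
by move=> t s u /asboolP st /asboolP tu; apply/asboolP/(SE_trans st tu).
Qed.

Definition star_equiv := EquivRel eqvb star_eqv_refl star_eqv_sym star_eqv_trans.

End Congruence.

(* Generators are numbered from 0: x_1, ..., x_{n+1} are the variables 0, ..., n.
   Since it is a sum over the first [k] generators, [sphere_sum C n k] is s_k,
   and the s_{i-1} of the bracket relation is [sphere_sum C n i] for the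
   0-based [i].                                                               *)
Definition sphere_sum (C : numClosedFieldType) n (k : nat) :
    star_expr C 'I_n.+1 :=
  \big[@EAdd _ _/EConst 0]_(j < n.+1 | (j < k)%N) EMul (EStar (EVar j)) (EVar j).

Inductive sphere_rel (C : numClosedFieldType) (q : C) n :
    star_expr C 'I_n.+1 -> star_expr C 'I_n.+1 -> Prop :=
| SR_comm (i j : 'I_n.+1) : (i < j)%N ->
    sphere_rel q (EMul (EVar i) (EVar j))
                 (EMul (EConst q) (EMul (EVar j) (EVar i)))
| SR_star_comm (i j : 'I_n.+1) : i != j ->
    sphere_rel q (EMul (EStar (EVar i)) (EVar j))
                 (EMul (EConst q) (EMul (EVar j) (EStar (EVar i))))
| SR_bracket (i : 'I_n.+1) :
    sphere_rel q (EAdd (EMul (EVar i) (EStar (EVar i)))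
                    (EMul (EConst (-1)) (EMul (EStar (EVar i)) (EVar i))))
                 (EMul (EConst (1 - q ^- 2)) (sphere_sum C n i))
| SR_sphere : sphere_rel q (sphere_sum C n n.+1) (EConst 1).

(* [qsphere q n] is A(S^{2n+1}_q). *)
Definition qsphere (C : numClosedFieldType) (q : C) n : Type :=
  {eq_quot star_equiv (@sphere_rel C q n)}.

Section QSphere.
Variables (C : numClosedFieldType) (q : C) (n : nat).
Local Notation expr := (star_expr C 'I_n.+1).
Local Notation A := (qsphere q n).
Local Notation eqv := (star_eqv (@sphere_rel C q n)).

HB.instance Definition _ := Choice.on A.
HB.instance Definition _ := EqQuotient.on A.

Definition qsphere_pi (t : expr) : A := \pi_A t.

Lemma qsphere_piE (s t : expr) : qsphere_pi s = qsphere_pi t <-> eqv s t.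
Proof.
split=> [/eqmodP/asboolP//|st]; exact/eqmodP/asboolP.
Qed.

Lemma qsphere_reprK (a : A) : qsphere_pi (repr a) = a.
Proof. exact: reprK. Qed.

Lemma qsphere_repr_eqv (t : expr) : eqv (repr (qsphere_pi t)) t.
Proof. by apply/qsphere_piE; rewrite qsphere_reprK. Qed.

Lemma qsphere_ind (P : A -> Prop) : (forall t, P (qsphere_pi t)) -> forall a, P a.
Proof. by move=> Ppi a; rewrite -(qsphere_reprK a). Qed.

Let add (a b : A) : A := qsphere_pi (EAdd (repr a) (repr b)).
Let mul (a b : A) : A := qsphere_pi (EMul (repr a) (repr b)).
Let adj (a : A) : A := qsphere_pi (EStar (repr a)).
Let cst (c : C) : A := qsphere_pi (EConst c).
Let opp (a : A) : A := mul (cst (- 1)) a.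

Let addE s t : add (qsphere_pi s) (qsphere_pi t) = qsphere_pi (EAdd s t).
Proof. by apply/qsphere_piE/SE_add; exact: qsphere_repr_eqv. Qed.

Let mulE s t : mul (qsphere_pi s) (qsphere_pi t) = qsphere_pi (EMul s t).
Proof. by apply/qsphere_piE/SE_mul; exact: qsphere_repr_eqv. Qed.

Let adjE s : adj (qsphere_pi s) = qsphere_pi (EStar s).
Proof. by apply/qsphere_piE/SE_star; exact: qsphere_repr_eqv. Qed.

Let ops := (addE, mulE, adjE).

Fact qsphere_addA : associative add.
Proof.
elim/qsphere_ind=> s; elim/qsphere_ind=> t; elim/qsphere_ind=> u.
by rewrite !ops; apply/qsphere_piE/SE_addA.
Qed.

Fact qsphere_addC : commutative add.
Proof.
elim/qsphere_ind=> s; elim/qsphere_ind=> t.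
by rewrite !ops; apply/qsphere_piE/SE_addC.
Qed.

Fact qsphere_add0 : left_id (cst 0) add.
Proof. by elim/qsphere_ind=> s; rewrite !ops; apply/qsphere_piE/SE_add0. Qed.

Fact qsphere_mulA : associative mul.
Proof.
elim/qsphere_ind=> s; elim/qsphere_ind=> t; elim/qsphere_ind=> u.
by rewrite !ops; apply/qsphere_piE/SE_mulA.
Qed.

Fact qsphere_mul1 : left_id (cst 1) mul.
Proof. by elim/qsphere_ind=> s; rewrite !ops; apply/qsphere_piE/SE_mul1. Qed.

Let mul_cstC c a : mul (cst c) a = mul a (cst c).
Proof.
by elim/qsphere_ind: a => s; rewrite !ops; apply/qsphere_piE/SE_constC.
Qed.

Fact qsphere_mulr1 : right_id (cst 1) mul.
Proof. by move=> a; rewrite -mul_cstC qsphere_mul1. Qed.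

Fact qsphere_mulDl : left_distributive mul add.
Proof.
elim/qsphere_ind=> s; elim/qsphere_ind=> t; elim/qsphere_ind=> u.
by rewrite !ops; apply/qsphere_piE/SE_mulDl.
Qed.

Fact qsphere_mulDr : right_distributive mul add.
Proof.
elim/qsphere_ind=> s; elim/qsphere_ind=> t; elim/qsphere_ind=> u.
by rewrite !ops; apply/qsphere_piE/SE_mulDr.
Qed.

Let cstD c d : cst (c + d) = add (cst c) (cst d).
Proof. by rewrite !ops; apply/qsphere_piE/SE_constD. Qed.

Let cstM c d : cst (c * d) = mul (cst c) (cst d).
Proof. by rewrite !ops; apply/qsphere_piE/SE_constM. Qed.

Fact qsphere_addN : left_inverse (cst 0) opp add.
Proof.
move=> a; rewrite /opp -[X in add _ X]qsphere_mul1 -qsphere_mulDl -cstD addNr.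
by elim/qsphere_ind: a => s; rewrite !ops; apply/qsphere_piE/SE_mul0.
Qed.

(* The character x_{n+1} |-> 1, x_i |-> 0 for i <= n, shows that 1 <> 0. *)
Let char (i : 'I_n.+1) : C^o := (i == ord_max)%:R.

Let char_rel s t : sphere_rel q s t -> star_eval char s = star_eval char t.
Proof.
have charC i : star (char i) = char i :> C^o by exact: conjC_nat.
have sumE k : star_eval char (sphere_sum C n k) =
    \sum_(j < n.+1 | (j < k)%N) char j :> C^o.
  rewrite /sphere_sum (big_morph (star_eval char) (id1 := 0) (op1 := +%R)) //=.
    by apply: eq_bigr => j _; rewrite charC /char -natrM mulnb andbb.
  by rewrite scale0r.
case=> [i j ij|i j ij|i|] /=; rewrite ?charC ?sumE.
- have /negbTE i0 : i != ord_max.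
    by apply: contraTneq ij => ->; rewrite -leqNgt -ltnS.
  by rewrite /char i0 mul0r !mulr0.
- have [i0|i0] := eqVneq i ord_max; last first.
    by rewrite /char (negbTE i0) mul0r !mulr0.
  by rewrite /char -i0 [j == i]eq_sym (negbTE ij) mul0r !mulr0.
- rewrite scaleN1r mulN1r subrr big1 ?mulr0// => j ji.
  rewrite /char; case: eqP => // j0; move: ji.
  by rewrite j0 ltnNge -ltnS ltn_ord.
- rewrite scale1r (bigD1 ord_max) ?ltn_ord//= big1 ?addr0 ?/char ?eqxx//.
  by move=> j /andP[_ /negbTE ->].
Qed.

Fact qsphere_nontrivial : cst 1 != cst 0.
Proof.
apply/eqP => /qsphere_piE /(star_eval_eqv char_rel) /= /eqP.
by rewrite scale1r scale0r oner_eq0.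
Qed.

HB.instance Definition _ := GRing.isNzRing.Build A
  qsphere_addA qsphere_addC qsphere_add0 qsphere_addN qsphere_mulA
  qsphere_mul1 qsphere_mulr1 qsphere_mulDl qsphere_mulDr qsphere_nontrivial.

Let scale (c : C) (a : A) : A := cst c * a.

Fact qsphere_scaleA c d a : scale c (scale d a) = scale (c * d) a.
Proof. by rewrite /scale mulrA; congr (_ * _); rewrite [RHS]cstM. Qed.

Fact qsphere_scale1 : left_id 1 scale.
Proof. by move=> a; exact: mul1r. Qed.

Fact qsphere_scaleDr : right_distributive scale +%R.
Proof. by move=> c a b; exact: mulrDr. Qed.

Fact qsphere_scaleDl a : {morph scale^~ a : c d / c + d}.
Proof. by move=> c d; rewrite /scale -mulrDl; congr (_ * _); exact: cstD. Qed.

HB.instance Definition _ := GRing.Zmodule_isLmodule.Build C A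
  qsphere_scaleA qsphere_scale1 qsphere_scaleDr qsphere_scaleDl.

Fact qsphere_scaleAl (c : C) (a b : A) : c *: (a * b) = (c *: a) * b.
Proof. exact: mulrA. Qed.

HB.instance Definition _ := GRing.Lmodule_isLalgebra.Build C A qsphere_scaleAl.

Fact qsphere_scaleAr (c : C) (a b : A) : c *: (a * b) = a * (c *: b).
Proof. by rewrite [LHS]mulrA [X in X * _]mul_cstC -[LHS]mulrA. Qed.

HB.instance Definition _ := GRing.Lalgebra_isAlgebra.Build C A qsphere_scaleAr.

Fact qsphere_starK : involutive adj.
Proof. by elim/qsphere_ind=> s; rewrite !ops; apply/qsphere_piE/SE_starK. Qed.

Fact qsphere_starD : {morph adj : a b / a + b}.
Proof.
elim/qsphere_ind=> s; elim/qsphere_ind=> t.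
by rewrite -![_ + _]/(add _ _) !ops; apply/qsphere_piE/SE_starD.
Qed.

Fact qsphere_starM (a b : A) : adj (a * b) = adj b * adj a.
Proof.
elim/qsphere_ind: a => s; elim/qsphere_ind: b => t.
by rewrite -![_ * _]/(mul _ _) !ops; apply/qsphere_piE/SE_starM.
Qed.

Fact qsphere_starZ (c : C) (a : A) : adj (c *: a) = conjC c *: adj a.
Proof.
rewrite [LHS]qsphere_starM [RHS]mul_cstC; congr (_ * _).
by rewrite adjE; apply/qsphere_piE/SE_starC.
Qed.

HB.instance Definition _ := isStarAlgebra.Build C A
  qsphere_starK qsphere_starD qsphere_starM qsphere_starZ.

Definition qsphere_gen (i : 'I_n.+1) : A := qsphere_pi (EVar i).

Lemma qsphere_pi_eval (t : expr) : star_eval qsphere_gen t = qsphere_pi t.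
Proof.
elim: t => [i|c|s IHs t IHt|s IHs t IHt|s IHs] //=.
- exact: (mulr1 (cst c : A)).
- by rewrite IHs IHt; exact: addE.
- by rewrite IHs IHt; exact: mulE.
- by rewrite IHs; exact: adjE.
Qed.

Lemma qsphere_gen_rel s t :
  sphere_rel q s t -> star_eval qsphere_gen s = star_eval qsphere_gen t.
Proof. by move=> st; rewrite !qsphere_pi_eval; apply/qsphere_piE/SE_rel. Qed.

(* The homomorphism sending the i-th generator to [y i]; meaningful when [y]
   satisfies the defining relations (see [qsphere_liftE]). *)
Definition qsphere_lift (B : starAlgType C) (y : 'I_n.+1 -> B) (a : A) : B :=
  star_eval y (repr a).

Section Lift.
Variables (B : starAlgType C) (y : 'I_n.+1 -> B).
Hypothesis yrel : forall s t, sphere_rel q s t -> star_eval y s = star_eval y t.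

Lemma qsphere_liftE t : qsphere_lift y (qsphere_pi t) = star_eval y t.
Proof. exact/(star_eval_eqv yrel)/qsphere_repr_eqv. Qed.

Lemma qsphere_lift_gen i : qsphere_lift y (qsphere_gen i) = y i.
Proof. exact: qsphere_liftE. Qed.

Lemma qsphere_liftD : {morph qsphere_lift y : a b / a + b}.
Proof.
elim/qsphere_ind=> s; elim/qsphere_ind=> t.
by rewrite -[_ + _]/(add _ _) ops !qsphere_liftE.
Qed.

Lemma qsphere_liftM : {morph qsphere_lift y : a b / a * b}.
Proof.
elim/qsphere_ind=> s; elim/qsphere_ind=> t.
by rewrite -[_ * _]/(mul _ _) ops !qsphere_liftE.
Qed.

Lemma qsphere_lift1 : qsphere_lift y 1 = 1.
Proof. by rewrite -[1 in LHS]/(cst 1) qsphere_liftE /= scale1r. Qed.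

Lemma qsphere_liftZ c a : qsphere_lift y (c *: a) = c *: qsphere_lift y a.
Proof.
rewrite -[c *: a]/(cst c * a) qsphere_liftM qsphere_liftE /=.
by rewrite -scalerAl mul1r.
Qed.

Lemma qsphere_lift_star a : qsphere_lift y (star a) = star (qsphere_lift y a).
Proof.
by elim/qsphere_ind: a => s; rewrite -[star _]/(adj _) ops !qsphere_liftE.
Qed.

End Lift.

End QSphere.

Section Projection.
Variables (C : numClosedFieldType) (q : C).

Definition qsphere_proj_gen n (i : 'I_n.+2) : qsphere q n :=
  if unlift ord0 i is Some j then qsphere_gen q j else 0.

Definition qsphere_proj n : qsphere q n.+1 -> qsphere q n :=
  qsphere_lift (@qsphere_proj_gen n).

Lemma qsphere_proj_gen_rel n s t : sphere_rel q s t ->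
  star_eval (@qsphere_proj_gen n) s = star_eval (@qsphere_proj_gen n) t.
Proof.
have y0 : @qsphere_proj_gen n ord0 = 0 by rewrite /qsphere_proj_gen unlift_none.
have yS j : @qsphere_proj_gen n (lift ord0 j) = qsphere_gen q j.
  by rewrite /qsphere_proj_gen liftK.
have sumE m (y : 'I_m.+1 -> qsphere q n) k :
    star_eval y (sphere_sum C m k) =
    \sum_(j < m.+1 | (j < k)%N) star (y j) * y j.
  rewrite /sphere_sum (big_morph (star_eval y) (id1 := 0) (op1 := +%R)) //=.
  by rewrite scale0r.
have sum_proj k : star_eval (@qsphere_proj_gen n) (sphere_sum C n.+1 k.+1) =
    star_eval (@qsphere_gen _ q n) (sphere_sum C n k).
  rewrite !sumE big_mkcond big_ord_recl /= y0 mulr0 add0r [RHS]big_mkcond /=.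
  by apply: eq_bigr => j _; rewrite yS.
have gen := @qsphere_gen_rel _ q n.
case=> [i j|i j|i|] /=.
- case: (unliftP ord0 j) => [j' ->|-> //].
  case: (unliftP ord0 i) => [i' ->|-> _]; last by rewrite !y0 mul0r !mulr0.
  by rewrite !yS => ij; exact: (gen _ _ (SR_comm q (i := i') (j := j') ij)).
- case: (unliftP ord0 j) => [j' ->|-> _]; last by rewrite y0 mul0r !mulr0.
  case: (unliftP ord0 i) => [i' ->|-> _].
    rewrite !yS (inj_eq lift_inj) => ij.
    exact: (gen _ _ (SR_star_comm q ij)).
  by rewrite y0 star0 mul0r !mulr0.
- case: (unliftP ord0 i) => [i' ->|->].
    by rewrite sum_proj !yS; exact: (gen _ _ (SR_bracket q i')).
  by rewrite sumE big_pred0 ?y0 ?mul0r ?mulr0 ?addr0.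
- by rewrite sum_proj; exact: (gen _ _ (SR_sphere q n)).
Qed.

Fixpoint qsphere_iproj d m : qsphere q (d + m) -> qsphere q m :=
  match d with
  | 0 => id
  | d'.+1 => fun a => qsphere_iproj (@qsphere_proj (d' + m) a)
  end.

(* A(S^{2n+1}_q) -> A(S^{2m+1}_q), the composition of the [n - m] successive
   maps [qsphere_proj]; the cast identifies [n] with [(n - m) + m]. *)
Definition qsphere_quot m n (le_mn : (m <= n)%N) (a : qsphere q n) :
    qsphere q m :=
  @qsphere_iproj (n - m) m (eq_rect_r (qsphere q) a (subnK le_mn)).

End Projection.

(* [inner] is linear in its first and conjugate-linear in its second argument.
   Norms take their (nonnegative real) values in [R[i]]. *)
Record hilbertSpace (R : realType) := HilbertSpace {
  hilbert_sort :> completeNormedModType R[i];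
  inner : {dot hilbert_sort for conjC};
  inner_norm : forall u, inner u u = `|u| ^+ 2
}.
Arguments inner {R h}.

Section Hilbert.
Variables (R : realType) (H : hilbertSpace R).

Definition separable : Prop :=
  exists D : set H, countable D /\ dense D.

Definition closed_subspace (W : set H) : Prop :=
  [/\ W 0, (forall (c : R[i]) u v, W u -> W v -> W (c *: u + v)) & closed W].

Definition orthonormal_basis (I : eqType) (e : I -> H) : Prop :=
  (forall i j, inner (e i) (e j) = (i == j)%:R) /\
  dense [set v : H | exists (s : seq I) (c : I -> R[i]),
                       v = \sum_(i <- s) c i *: e i].

End Hilbert.

Section Representations.
Variables (R : realType) (A : starAlgType R[i]).

Record star_rep (H : hilbertSpace R) (pi : A -> H -> H) : Prop := {
  rep_op_linear : forall a, linear (pi a);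
  rep_op_bounded : forall a, exists M : R, forall v, `|pi a v| <= M%:C * `|v|;
  rep_linear : forall (c : R[i]) a b v,
    pi (c *: a + b) v = c *: pi a v + pi b v;
  rep_1 : forall v, pi 1 v = v;
  rep_mul : forall a b v, pi (a * b) v = pi a (pi b v);
  rep_star : forall a u v, inner (pi a u) v = inner u (pi (star a) v)
}.

Record irreducible_star_rep (H : hilbertSpace R) (pi : A -> H -> H) : Prop := {
  irr_rep : star_rep pi;
  irr_separable : separable H;
  irr_nonzero : exists v : H, v != 0;
  irr_subspace : forall W : set H, closed_subspace W ->
    (forall a v, W v -> W (pi a v)) -> W = [set 0] \/ W = setT
}.

Definition unitarily_equivalent (H1 H2 : hilbertSpace R)
    (pi1 : A -> H1 -> H1) (pi2 : A -> H2 -> H2) : Prop :=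
  exists U : {linear H1 -> H2},
    [/\ bijective U, (forall u v, inner (U u) (U v) = inner u v)
      & forall a v, U (pi1 a v) = pi2 a (U v)].

End Representations.

(* Basis vectors |k_1,...,k_m> are indexed by [k : {ffun 'I_m -> nat}], with
   k_{j+1} being [k j]. *)
Definition upd m (k : {ffun 'I_m -> nat}) (j : 'I_m) (a : nat) :
  {ffun 'I_m -> nat} := [ffun l => if l == j then a else k l].

(* The 1-based generator index i in 2..m+1 is [lift ord0 j], so that k_{i-1} is [k j] and
   k_i + ... + k_m is the sum of [k l] over [l > j]. When [k j = 0] the
   coefficient of the lowering operator is zero, so the value of
   [(k j).-1] is immaterial. *)
Record is_psi (R : realType) (q : R) m (lambda : R[i]) (H : hilbertSpace R)
    (e : {ffun 'I_m -> nat} -> H) (pi : qsphere q%:C m -> H -> H) : Prop := {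
  psi_rep : star_rep pi;
  psi_basis : orthonormal_basis e;
  psi_x1 : forall k,
    pi (qsphere_gen q%:C ord0) (e k) =
    (lambda * (q ^- (\sum_(l < m) k l))%:C) *: e k;
  psi_x : forall (j : 'I_m) k,
    pi (qsphere_gen q%:C (lift ord0 j)) (e k) =
    (Num.sqrt (1 - q ^- (2 * k j)) * q ^- (\sum_(l < m | (j < l)%N) k l))%:C
      *: e (upd k j (k j).-1);
  psi_xstar : forall (j : 'I_m) k,
    pi (star (qsphere_gen q%:C (lift ord0 j))) (e k) =
    (Num.sqrt (1 - q ^- (2 * (k j).+1)) * q ^- (\sum_(l < m | (j < l)%N) k l))%:C
      *: e (upd k j (k j).+1)
}.

(* Main.v *)
(** Put [T = x_1^* x_1]. For [j > 1] one has [T x_j = q^2 x_j T], and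
    [1 - T] is the sum of the [x_j^* x_j] over [j > 1]; so [T^k - T^(k+1)]
    decays geometrically and [T^k] converges strongly to the projection onto
    the vacuum space [W] of the vectors killed by all [x_j], [j > 1]. If
    [W = 0], the norms of the [x_1^k v] show that a bound [|x_1|^2 <= c]
    improves to [|x_1|^2 <= q^-2 c], whence [x_1 = 0] and the representation
    factors through the next smaller sphere. Otherwise the vectors
    [x_{n+1}^*^{k_n} ... x_2^*^{k_1} w], [w] in [W], are permuted up to scalars
    by the generators, and those with [k <> 0] are orthogonal to [W]. Hence in
    an irreducible representation the normal operator [x_1] has no reducing
    subspace in [W], and is a scalar [lambda] on [W] by Schur's lemma, for
    which the spectral theorem is replaced by the square root [|B|] of [B^2].
    A unit vector of [W] then generates the basis of [psi_lambda].

    In [psi_lambda] the space [W] is the line of the vacuum vector, and a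
    nonzero invariant subspace contains that vector: lower one of its elements
    to make it non-orthogonal to the vacuum, then apply [T^k]. The number [m]
    is determined by which generators vanish, and [lambda] is the eigenvalue of
    [x_1] on [W]. For the existence of [psi_lambda] the generators are weighted
    shifts on [l^2(N^m)], so the relations are pointwise identities. *)
From HB Require Import structures.
Require Import Defs.
From mathcomp Require Import all_boot all_order all_algebra.
From mathcomp Require Import all_classical all_reals all_analysis.
From mathcomp Require Import complex sesquilinear.
From mathcomp Require Import ring lra.
Set Implicit Arguments.
Unset Strict Implicit.
Unset Printing Implicit Defensive.
Import Order.TTheory GRing.Theory Num.Theory Num.Def.
Import numFieldNormedType.Exports.
Local Open Scope classical_set_scope.
Local Open Scope ring_scope.
Local Open Scope complex_scope.

(** * Hilbert spaces *)

(** In [psi_lambda] the operator [T] is diagonal with eigenvalues [q^-2(k_1+...+k_n)], and each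
    [x_j], [j > 1], lowers [k_1+...+k_n] by one: [T] encodes a number operator, and the limit of its
    powers is a spectral projection obtained without spectral theory. The obstacle is that [W] is
    not stable under the raising operators [x_j^*], so irreducibility has to be carried from [H] to
    [W] before Schur's lemma can be used there. In that lemma the projections of the commutant are
    replaced by signs of quadratic forms: the square root shows that the form of a self-adjoint [B]
    in the commutant has constant sign on [W], and the same for all [B - c] forces [B] to be scalar.
    Adjoints are never constructed: each operator travels with the operator that represents its
    star, and a representation of the sphere amounts to a family of such pairs satisfying the
    relations. *)

Section DotTheory.
Variables (R : realType) (U : lmodType R[i]) (dot : {dot U for conjC}).

Lemma dotC u v : dot u v = conjC (dot v u).
Proof. by rewrite hermC /= expr0 mul1r. Qed.

Lemma dotDl u v w : dot (u + v) w = dot u w + dot v w.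
Proof. exact: linearDl. Qed.

Lemma dotDr u v w : dot u (v + w) = dot u v + dot u w.
Proof. exact: linearDr. Qed.

Lemma dotBl u v w : dot (u - v) w = dot u w - dot v w.
Proof. exact: linearBl. Qed.

Lemma dotBr u v w : dot u (v - w) = dot u v - dot u w.
Proof. exact: linearBr. Qed.

Lemma dotZl c u v : dot (c *: u) v = c * dot u v.
Proof. exact: linearZl_LR. Qed.

Lemma dotZr c u v : dot u (c *: v) = conjC c * dot u v.
Proof. exact: linearZr_LR. Qed.

Lemma dotNl u v : dot (- u) v = - dot u v.
Proof. exact: linearNl. Qed.

Lemma dotNr u v : dot u (- v) = - dot u v.
Proof. exact: linearNr. Qed.

Lemma dot0l u : dot 0 u = 0.
Proof. exact: linear0l. Qed.

Lemma dot0r u : dot u 0 = 0.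
Proof. exact: linear0r. Qed.

Lemma dot_suml I (s : seq I) (P : pred I) (F : I -> U) v :
  dot (\sum_(i <- s | P i) F i) v = \sum_(i <- s | P i) dot (F i) v.
Proof. exact: linear_sumlz. Qed.

Lemma dot_sumr I (s : seq I) (P : pred I) (F : I -> U) v :
  dot v (\sum_(i <- s | P i) F i) = \sum_(i <- s | P i) dot v (F i).
Proof. exact: linear_sumr. Qed.

Lemma dot_CauchySchwarz u v : `|dot u v| ^+ 2 <= dot u u * dot v v.
Proof.
have [->|v0] := eqVneq v 0; first by rewrite !dot0r normr0 expr0n mulr0.
have vv : 0 < dot v v by rewrite dnorm_gt0.
pose a := dot u v / dot v v; pose w := u - a *: v.
have wv : dot w v = 0 by rewrite dotBl dotZl divfK ?subrr// gt_eqF.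
have uE : u = w + a *: v by rewrite subrK.
have -> : dot u v = a * dot v v by rewrite [in LHS]uE dotDl wv add0r dotZl.
have -> : dot u u = dot w w + `|a| ^+ 2 * dot v v.
  by rewrite [in LHS]uE dnormD (dotZr _ w) wv mulr0 rmorph0 !addr0 dnormZ.
rewrite normrM exprMn (ger0_norm (ltW vv)) mulrDl -(mulrA (`|a| ^+ 2)) lerDr.
by rewrite mulr_ge0// dnorm_ge0.
Qed.

End DotTheory.

Section RealNorm.
Variables (R : realType).
Implicit Types (x y : R) (z : R[i]).

Lemma conjC_real x : conjC (x%:C : R[i]) = x%:C.
Proof. by apply/CrealP/complex_realP; exists x. Qed.

Lemma conjCM_real z x : conjC (z * x%:C) = conjC z * x%:C.
Proof. by rewrite rmorphM; congr (_ * _); exact: conjC_real. Qed.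

Lemma ReK_ge0 z : 0 <= z -> (complex.Re z)%:C = z.
Proof. by move=> /ger0_real /RRe_real. Qed.

Lemma normC_real x : `|x%:C : R[i]| = (`|x|)%:C.
Proof. by rewrite normc_def /= expr0n addr0 sqrtr_sqr. Qed.

Lemma gt0c x : ((0 : R[i]) < x%:C) = (0 < x).
Proof. exact: (ltcR 0 x). Qed.

End RealNorm.

Section HilbertBasics.
Variables (R : realType) (H : hilbertSpace R).
Implicit Types (u v w : H) (S W : set H).

(** Norms of [H] take values in [R[i]]; estimates are done in the ordered field [R], hence this real
    copy. *)
Definition nrm u : R := complex.Re `|u|.

Lemma nrmE u : `|u| = (nrm u)%:C.
Proof. by rewrite ReK_ge0. Qed.

Lemma nrm_ge0 u : 0 <= nrm u.
Proof. by rewrite -ler0c -nrmE. Qed.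
Hint Resolve nrm_ge0 : core.

Lemma nrm0 : nrm 0 = 0.
Proof. by rewrite /nrm normr0. Qed.

Lemma nrm0_eq0 u : nrm u = 0 -> u = 0.
Proof. by move=> u0; apply/eqP; rewrite -normr_eq0 nrmE u0. Qed.

Lemma nrm_gt0 u : u != 0 -> 0 < nrm u.
Proof.
by move=> u0; rewrite lt_def nrm_ge0 andbT; apply: contra_neq u0 => /nrm0_eq0.
Qed.

Lemma nrmN u : nrm (- u) = nrm u.
Proof. by rewrite /nrm normrN. Qed.

Lemma nrmD u v : nrm (u + v) <= nrm u + nrm v.
Proof. by rewrite -lecR rmorphD/= -!nrmE ler_normD. Qed.

Lemma nrm_distC u v : nrm (u - v) = nrm (v - u).
Proof. by rewrite -nrmN opprB. Qed.

Lemma nrmB u v : nrm (u - v) <= nrm u + nrm v.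
Proof. by rewrite -(nrmN v) nrmD. Qed.

Lemma nrm_tri v u w : nrm (u - w) <= nrm (u - v) + nrm (v - w).
Proof. by rewrite -[u - w](subrKA v) nrmD. Qed.

Lemma nrmZ c u : nrm (c *: u) = complex.Re `|c| * nrm u.
Proof.
by apply: complexI; rewrite rmorphM -nrmE normrZ nrmE; congr (_ * _).
Qed.

Lemma nrmZr (c : R) u : nrm (c%:C *: u) = `|c| * nrm u.
Proof. by rewrite nrmZ normC_real. Qed.

Lemma inner_nrm u : inner u u = (nrm u ^+ 2)%:C.
Proof. by rewrite inner_norm nrmE rmorphXn. Qed.

Lemma inner_CS u v : `|inner u v| <= (nrm u * nrm v)%:C.
Proof.
rewrite -ler_sqr ?nnegrE ?normr_ge0 ?ler0c ?mulr_ge0//.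
rewrite (le_trans (dot_CauchySchwarz _ _ _))// !inner_nrm -rmorphM -rmorphXn/=.
by rewrite lecR exprMn.
Qed.

Lemma inner_eq0 u : (forall v, inner u v = 0) -> u = 0.
Proof. by move=> /(_ u)/eqP; rewrite dnorm_eq0 => /eqP. Qed.

Lemma inner_sep u v : (forall w, inner u w = inner v w) -> u = v.
Proof.
move=> uv; apply/eqP; rewrite -subr_eq0; apply/eqP/inner_eq0 => w.
by rewrite dotBl uv subrr.
Qed.

Lemma inner_sym0 u v : inner u v = 0 -> inner v u = 0.
Proof. by rewrite dotC => /eqP; rewrite conjC_eq0 => /eqP ->; rewrite ?rmorph0. Qed.

Lemma nrm_pythagoras u v : inner u v = 0 ->
  nrm (u + v) ^+ 2 = nrm u ^+ 2 + nrm v ^+ 2.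
Proof.
move=> uv; apply: complexI; rewrite -inner_nrm rmorphD/= -!inner_nrm.
by rewrite dnormD uv rmorph0 !addr0.
Qed.

Lemma small_eq0 (x : R) : 0 <= x -> (forall e, 0 < e -> x <= e) -> x = 0.
Proof.
move=> x0 xe; apply/eqP; rewrite eq_le x0 andbT.
by apply/ler_addgt0Pr => e /xe; rewrite add0r.
Qed.

(** Dividing by [M + 1] covers the case [M = 0]. *)
Lemma cfactor_small (M e : R) : 0 <= M -> 0 < e ->
  exists2 d, 0 < d & M * d <= e.
Proof.
move=> M0 e0; exists (e / (M + 1)); first by rewrite divr_gt0// ltr_wpDl.
rewrite mulrCA -[leRHS]mulr1 ler_wpM2l ?(ltW e0)//.
by rewrite ler_pdivrMr ?mul1r ?ltr_wpDl// lerDl.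
Qed.

(** Membership in the norm closure of [S], with radii in [R]. *)
Definition approx S v := forall e : R, 0 < e -> exists2 w, S w & nrm (v - w) < e.

Lemma approx_self S v : S v -> approx S v.
Proof. by move=> Sv e e0; exists v; rewrite // subrr nrm0. Qed.

Lemma sub_approx S W v : S `<=` W -> approx S v -> approx W v.
Proof. by move=> SW Sv e /Sv [w /SW]; exists w. Qed.

Lemma approx_approx S v : approx (approx S) v -> approx S v.
Proof.
move=> Sv e e0; have e2 : 0 < e / 2 by rewrite divr_gt0.
have [w /(_ _ e2) [u Su wu] vw] := Sv _ e2; exists u => //.
by rewrite (le_lt_trans (nrm_tri w _ _))// [ltRHS](splitr e) ltrD.
Qed.

Lemma ball_nrm v (e : R) w : ball v e%:C w <-> nrm (v - w) < e.
Proof. by rewrite -ball_normE /= nrmE ltcR. Qed.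

Lemma ltC0P (z : R[i]) : 0 < z -> exists2 e : R, 0 < e & z = e%:C.
Proof.
move=> z0; exists (complex.Re z); last by rewrite ReK_ge0// ltW.
by rewrite -ltcR ReK_ge0// ltW.
Qed.

Lemma closedP W : closed W <-> (forall v, approx W v -> W v).
Proof.
split=> [cW v Wv|cW].
  apply: cW => B /nbhs_ballP [_ /= /ltC0P [e e0 ->] vB].
  by have [w Ww vw] := Wv _ e0; exists w; split=> //; apply: vB; apply/ball_nrm.
move=> v clv; apply: cW => e e0.
have /clv [w [Ww /ball_nrm vw]] : nbhs v (ball v e%:C).
  by apply: nbhsx_ballx; rewrite gt0c.
by exists w.
Qed.

Lemma denseP S : dense S <-> (forall v, approx S v).
Proof.
split=> [dS v e e0|dS O [v Ov] oO].
  have [||w [/interior_subset/ball_nrm vw Sw]] := dS (ball v e%:C)^°.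
  - by exists v; apply: nbhsx_ballx; rewrite gt0c.
  - exact: open_interior.
  - by exists w.
have /nbhs_ballP [_ /= /ltC0P [e e0 ->] vB] := open_nbhs_nbhs (conj oO Ov).
have [w Sw vw] := dS v _ e0; exists w; split=> //.
by apply: vB; apply/ball_nrm.
Qed.

Definition tends (x : nat -> H) l := forall e : R, 0 < e ->
  exists N, forall n, (N <= n)%N -> nrm (x n - l) < e.

Lemma tends_approx S x l : (forall n, S (x n)) -> tends x l -> approx S l.
Proof.
move=> Sx xl e /xl [N xN]; exists (x N) => //.
by rewrite nrm_distC xN.
Qed.

Lemma approx_tends S l : approx S l -> exists2 x, (forall n, S (x n)) & tends x l.
Proof.
move=> Sl.
have /choice [x xP] : forall n : nat, exists w, S w /\ nrm (l - w) < (n.+1%:R : R)^-1.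
  by move=> n; have [|w] := Sl (n.+1%:R)^-1; [rewrite invr_gt0| exists w].
exists x; first by move=> n; case: (xP n).
move=> e e0; have [N _ Ne] := near_infty_natSinv_lt (PosNum e0).
exists N => n Nn; rewrite nrm_distC; case: (xP n) => _ /lt_trans; apply.
exact: Ne.
Qed.

Lemma tendsD x y l m : tends x l -> tends y m ->
  tends (fun n => x n + y n) (l + m).
Proof.
move=> xl ym e e0; have e2 : 0 < e / 2 by rewrite divr_gt0.
have [N xN] := xl _ e2; have [M yM] := ym _ e2.
exists (maxn N M) => n; rewrite geq_max => /andP[/xN xn /yM yn].
by rewrite opprD addrACA (le_lt_trans (nrmD _ _))// (splitr e) ltrD.
Qed.

Lemma tends_cst l : tends (fun=> l) l.
Proof. by move=> e e0; exists 0%N => n _; rewrite subrr nrm0. Qed.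

Lemma tendsZ (c : R[i]) x l : tends x l -> tends (fun n => c *: x n) (c *: l).
Proof.
move=> xl e e0; have c0 : 0 <= complex.Re `|c| by rewrite -ler0c ReK_ge0.
have [d d0 de] := cfactor_small c0 (divr_gt0 e0 (ltr0Sn R 1)).
have [N xN] := xl _ d0; exists N => n /xN xn.
rewrite -scalerBr nrmZ (le_lt_trans (ler_wpM2l c0 (ltW xn)))//.
by rewrite (le_lt_trans de)// ltr_pdivrMr// ltr_pMr// ltr1n.
Qed.

Lemma tends_nrm_le x l (M : R) : tends x l -> (forall n, nrm (x n) <= M) ->
  nrm l <= M.
Proof.
move=> xl xM; apply/ler_addgt0Pr => e /xl [N /(_ N (leqnn N)) xN].
have -> : l = x N - (x N - l) by rewrite opprB addrCA subrr addr0.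
by rewrite (le_trans (nrmB _ _))// lerD// ltW.
Qed.

Lemma tends_unique x l l' : tends x l -> tends x l' -> l = l'.
Proof.
move=> xl xl'; apply/eqP; rewrite -subr_eq0; apply/eqP/nrm0_eq0/small_eq0 => // e e0.
have e2 : 0 < e / 2 by rewrite divr_gt0.
have [N xN] := xl _ e2; have [M xM] := xl' _ e2.
rewrite (le_trans (nrm_tri (x (maxn N M)) _ _))// (splitr e) lerD// ltW//.
  by rewrite nrm_distC xN// leq_maxl.
by rewrite xM// leq_maxr.
Qed.

Lemma tends_shift x l : tends x l -> tends (fun n => x n.+1) l.
Proof. by move=> xl e /xl [N xN]; exists N => n Nn; apply/xN/ltnW. Qed.

Lemma tends_inner_const x l v c : tends x l -> (forall n, inner (x n) v = c) ->
  inner l v = c.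
Proof.
move=> xl xc; apply/eqP; rewrite -subr_eq0 -normr_eq0.
have /complex_realP [r r0] : `|inner l v - c| \is Num.real by [].
rewrite r0; apply/eqP; congr (_%:C); apply: small_eq0.
  by rewrite -ler0c -r0.
move=> e e0; have [d d0 de] := cfactor_small (nrm_ge0 v) e0.
have [N /(_ N (leqnn N)) xN] := xl _ d0.
rewrite -lecR -r0 -(xc N) -dotBl (le_trans (inner_CS _ _))// lecR.
by rewrite (le_trans _ de)// mulrC ler_wpM2l// nrm_distC ltW.
Qed.

Lemma cauchy_tends (x : nat -> H) :
  (forall e : R, 0 < e -> exists N, forall m n, (N <= m)%N -> (N <= n)%N ->
     nrm (x m - x n) < e) -> exists l, tends x l.
Proof.
move=> xC; have /cauchy_cvg : cauchy (x @ \oo).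
  apply/cauchy_exP => _ /ltC0P [e /xC [N xN] ->]; exists (x N).
  by exists N => // n /= Nn; apply/ball_nrm/xN.
move=> /cvg_ex [l xl]; exists l => e e0.
have [N _ xN] := xl _ (nbhsx_ballx l e%:C (etrans (gt0c e) e0)).
exists N => n Nn; rewrite nrm_distC; apply/ball_nrm; exact: xN.
Qed.

(** The second hypothesis makes [b] nondecreasing, hence convergent, and its increments dominate
    those of [x]. *)
Lemma telescope_tends (x : nat -> H) (b : nat -> R) (B : R) :
  (forall n, b n <= B) ->
  (forall n, nrm (x n.+1 - x n) <= b n.+1 - b n) -> exists l, tends x l.
Proof.
move=> bB xb.
have b_nd : nondecreasing_seq b.
  apply/nondecreasing_seqP => n; rewrite -subr_ge0.
  exact: le_trans (xb n).
have bnd n k : nrm (x (n + k)%N - x n) <= b (n + k)%N - b n.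
  elim: k => [|k IH]; first by rewrite addn0 !subrr nrm0.
  rewrite addnS (le_trans (nrm_tri (x (n + k)%N) _ _))//.
  by rewrite (le_trans (lerD (xb _) IH))// subrKA.
have bcvg : cvgn b.
  by apply: nondecreasing_is_cvgn => //; exists B => _ [n _ <-].
have b_le n : b n <= limn b by exact: nondecreasing_cvgn_le.
apply: cauchy_tends => e e0.
have e2 : 0 < e / 2 by rewrite divr_gt0.
have /cvgrPdist_lt /(_ _ e2) [N _ bN] := bcvg.
have xN m : (N <= m)%N -> nrm (x m - x N) < e / 2.
  move=> Nm; rewrite -(subnKC Nm) (le_lt_trans (bnd _ _))//.
  rewrite (le_lt_trans (lerD (b_le _) (lexx _)))//.
  by rewrite (le_lt_trans _ (bN N (leqnn N)))// ler_norm.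
exists N => m n Nm Nn; rewrite (le_lt_trans (nrm_tri (x N) _ _))//.
by rewrite (splitr e) ltrD ?xN// nrm_distC xN.
Qed.

Lemma geometric_tends (x : nat -> H) (c r : R) : 0 <= c -> 0 <= r -> r < 1 ->
  (forall n, nrm (x n.+1 - x n) <= c * r ^+ n) -> exists l, tends x l.
Proof.
move=> c0 r0 r1 xr; have r1' : 0 < 1 - r by rewrite subr_gt0.
(* The dominating sequence consists of the partial sums of the series of the [c * r ^+ n]. *)
apply: (@telescope_tends x (fun n => c / (1 - r) * (1 - r ^+ n)) (c / (1 - r))).
  move=> n; rewrite ler_piMr ?divr_ge0 ?(ltW r1')// lerBlDr lerDl exprn_ge0//.
move=> n; rewrite (le_trans (xr n))// le_eqVlt; apply/orP; left; apply/eqP.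
by rewrite exprS; field; rewrite gt_eqF.
Qed.

Definition bounded_by (M : R) (T : H -> H) := forall v, nrm (T v) <= M * nrm v.

Definition bounded_op T := exists M : R, bounded_by M T.

Lemma bounded_opP T : bounded_op T -> exists2 M : R, 0 <= M & bounded_by M T.
Proof.
move=> [M TM]; exists `|M| => // v.
by rewrite (le_trans (TM v))// ler_wpM2r// ler_norm.
Qed.

Section LinearOp.
Variable T : H -> H.
Hypothesis T_lin : linear T.

Lemma lop0 : T 0 = 0.
Proof. by have := T_lin (-1) 0 0; rewrite scaleN1r oppr0 addr0 scaleN1r addNr. Qed.

Lemma lopD u v : T (u + v) = T u + T v.
Proof. by rewrite -[u]scale1r T_lin !scale1r. Qed.

Lemma lopZ c u : T (c *: u) = c *: T u.
Proof. by rewrite -[c *: u]addr0 T_lin lop0 addr0. Qed.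

Lemma lopN u : T (- u) = - T u.
Proof. by rewrite -scaleN1r lopZ scaleN1r. Qed.

Lemma lopB u v : T (u - v) = T u - T v.
Proof. by rewrite lopD lopN. Qed.

Lemma lop_sum I (s : seq I) (P : pred I) (F : I -> H) :
  T (\sum_(i <- s | P i) F i) = \sum_(i <- s | P i) T (F i).
Proof. exact: (big_morph T lopD lop0). Qed.

Lemma lop_iter k : linear (iter k T).
Proof. by elim: k => // k IH c u v; rewrite !iterS IH T_lin. Qed.

Lemma bounded_tends x l : bounded_op T -> tends x l -> tends (T \o x) (T l).
Proof.
move=> /bounded_opP [M M0 TM] xl e e0.
have [d d0 de] := cfactor_small M0 (divr_gt0 e0 (ltr0Sn R 1)).
have [N xN] := xl _ d0; exists N => n Nn /=.
rewrite -lopB (le_lt_trans (TM _))// (le_lt_trans (ler_wpM2l M0 (ltW (xN n Nn))))//.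
by rewrite (le_lt_trans de)// ltr_pdivrMr// ltr_pMr// ltr1n.
Qed.

Lemma bounded_approx S W v : bounded_op T -> (forall w, S w -> W (T w)) ->
  approx S v -> approx W (T v).
Proof.
move=> Tb SW /approx_tends [x Sx /(bounded_tends Tb)].
by apply: tends_approx => n; apply: SW.
Qed.

End LinearOp.

Definition subspace S := S 0 /\ forall (c : R[i]) u v, S u -> S v -> S (c *: u + v).

Lemma subspaceZ S c u : subspace S -> S u -> S (c *: u).
Proof. by move=> [S0 SS] Su; rewrite -[_ *: _]addr0; apply: SS. Qed.

Lemma subspaceD S u v : subspace S -> S u -> S v -> S (u + v).
Proof. by move=> [S0 SS] Su Sv; rewrite -[u]scale1r; apply: SS. Qed.

Lemma subspace_sum S I (s : seq I) (P : pred I) (F : I -> H) : subspace S ->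
  (forall i, P i -> S (F i)) -> S (\sum_(i <- s | P i) F i).
Proof.
move=> SS SF; elim/big_rec: _ => [|i x Pi Sx]; first by case: SS.
by apply: subspaceD => //; apply: SF.
Qed.

Lemma closed_subspaceE W : closed_subspace W <->
  subspace W /\ forall v, approx W v -> W v.
Proof.
split=> [[W0 Wl /closedP Wc]|[[W0 Wl] /closedP Wc]]; first by split.
by split.
Qed.

Lemma approx_subspace S : subspace S -> closed_subspace (approx S).
Proof.
move=> SS; apply/closed_subspaceE; split; last exact: approx_approx.
split; first by apply: approx_self; case: SS.
move=> c u v Su Sv e e0; have e2 : 0 < e / 2 by rewrite divr_gt0.
have c0 : 0 <= complex.Re `|c| by rewrite -ler0c ReK_ge0.
have [d d0 de] := cfactor_small c0 e2.
have [u' Su' uu'] := Su _ d0; have [v' Sv' vv'] := Sv _ e2.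
exists (c *: u' + v'); first exact: (SS.2).
rewrite opprD addrACA -scalerBr (le_lt_trans (nrmD _ _))// (splitr e) ler_ltD//.
by rewrite nrmZ (le_trans _ de)// ler_wpM2l// ltW.
Qed.

End HilbertBasics.

(** * Representations given by operators *)

Section Words.
Variables (R : realType) (H : hilbertSpace R) (q : R) (n : nat).

(** The data of a representation on the generators alone. [ops_star_rep] and [rep_sphere_ops]
    translate in both directions, so that later arguments deal with operators only. *)
Record sphere_ops (X Xs : 'I_n.+1 -> H -> H) : Prop := {
  so_lin : forall i, linear (X i);
  so_slin : forall i, linear (Xs i);
  so_adj : forall i u v, inner (X i u) v = inner u (Xs i v);
  so_comm : forall (i j : 'I_n.+1) v, (i < j)%N ->
    X i (X j v) = q%:C *: X j (X i v);
  so_scomm : forall (i j : 'I_n.+1) v, i != j ->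
    Xs i (X j v) = q%:C *: X j (Xs i v);
  so_bracket : forall i v, X i (Xs i v) - Xs i (X i v) =
    (1 - q ^- 2)%:C *: \sum_(j < n.+1 | (j < i)%N) Xs j (X j v);
  so_sum : forall v, \sum_(j < n.+1) Xs j (X j v) = v
}.

Section Eval.
Variables X Xs : 'I_n.+1 -> H -> H.

(** The second component is the adjoint of the first, which makes [EStar] a swap. *)
Fixpoint op_eval (t : star_expr R[i] 'I_n.+1) : (H -> H) * (H -> H) :=
  match t with
  | EVar i => (X i, Xs i)
  | EConst c => (fun v => c *: v, fun v => conjC c *: v)
  | EAdd s t => (fun v => (op_eval s).1 v + (op_eval t).1 v,
                 fun v => (op_eval s).2 v + (op_eval t).2 v)
  | EMul s t => (fun v => (op_eval s).1 ((op_eval t).1 v),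
                 fun v => (op_eval t).2 ((op_eval s).2 v))
  | EStar s => ((op_eval s).2, (op_eval s).1)
  end.

Lemma op_eval_sum k v : (op_eval (sphere_sum R[i] n k)).1 v =
  \sum_(j < n.+1 | (j < k)%N) Xs j (X j v).
Proof.
rewrite /sphere_sum.
rewrite (big_morph (fun t => (op_eval t).1 v) (id1 := 0) (op1 := +%R)) //=.
by rewrite scale0r.
Qed.

Definition ops_rep (a : qsphere q%:C n) : H -> H := (op_eval (repr a)).1.

Hypothesis XP : sphere_ops X Xs.

Lemma so_sadj i u v : inner (Xs i u) v = inner u (X i v).
Proof. by rewrite dotC -(so_adj XP) -dotC. Qed.

(** Pair the sphere relation with [v]. This is what makes all generators contractions. *)
Lemma so_sum_nrm v : \sum_(j < n.+1) nrm (X j v) ^+ 2 = nrm v ^+ 2.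
Proof.
apply: complexI; rewrite -inner_nrm -[X in inner _ X](so_sum XP) dot_sumr.
rewrite rmorph_sum; apply: eq_bigr => j _.
by rewrite -(so_adj XP) inner_nrm.
Qed.

Lemma so_contr i : bounded_by 1 (X i).
Proof.
move=> v; rewrite mul1r -ler_sqr ?nnegrE ?nrm_ge0// -(so_sum_nrm v).
by rewrite (bigD1 i)//= lerDl sumr_ge0// => j _; rewrite sqr_ge0.
Qed.

(** With [X] a contraction, [|X^* v|^2 = <v, X X^* v> <= |v| |X^* v|]. *)
Lemma so_scontr i : bounded_by 1 (Xs i).
Proof.
move=> v; rewrite mul1r; have [->|Xv0] := eqVneq (nrm (Xs i v)) 0.
  exact: nrm_ge0.
have Xv : 0 < nrm (Xs i v) by rewrite lt_def Xv0 nrm_ge0.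
rewrite -(ler_pM2r Xv) -expr2 -lecR -inner_nrm so_sadj.
rewrite (le_trans (real_ler_norm _))//.
  apply/ger0_real; rewrite -so_sadj; exact: dnorm_ge0.
rewrite (le_trans (inner_CS _ _))// lecR ler_wpM2l ?nrm_ge0//.
by rewrite (le_trans (so_contr i _))// mul1r.
Qed.

Lemma op_eval_lin t : linear (op_eval t).1 /\ linear (op_eval t).2.
Proof.
elim: t => [i|c|s [s1 s2] t [t1 t2]|s [s1 s2] t [t1 t2]|s [s1 s2]] /=.
- by split; [exact: so_lin XP i|exact: so_slin XP i].
- by split=> a u v; rewrite scalerDr !scalerA mulrC.
- by split=> a u v; rewrite ?s1 ?t1 ?s2 ?t2 scalerDr addrACA.
- by split=> a u v; rewrite ?t1 ?s1 ?s2 ?t2.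
- by [].
Qed.

Lemma op_eval_bounded t : bounded_op (op_eval t).1 /\ bounded_op (op_eval t).2.
Proof.
elim: t => [i|c|s [/bounded_opP[M M0 s1] /bounded_opP[M' M'0 s2]] t
    [/bounded_opP[N N0 t1] /bounded_opP[N' N'0 t2]]
  |s [/bounded_opP[M M0 s1] /bounded_opP[M' M'0 s2]] t
    [/bounded_opP[N N0 t1] /bounded_opP[N' N'0 t2]]|s [s1 s2]] /=.
- by split; exists 1; [exact: so_contr|exact: so_scontr].
- by split; [exists (complex.Re `|c|)|exists (complex.Re `|conjC c|)] => v;
    rewrite nrmZ.
- split; [exists (M + N)|exists (M' + N')] => v;
    by rewrite (le_trans (nrmD _ _))// mulrDl lerD.
- split; [exists (M * N)|exists (N' * M')] => v; rewrite -mulrA.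
    by rewrite (le_trans (s1 _))// ler_wpM2l.
  by rewrite (le_trans (t2 _))// ler_wpM2l.
- by [].
Qed.

Lemma op_eval_adj t u v : inner ((op_eval t).1 u) v = inner u ((op_eval t).2 v).
Proof.
elim: t u v => [i|c|s IHs t IHt|s IHs t IHt|s IHs] u v /=.
- exact: so_adj XP i u v.
- by rewrite dotZl dotZr conjCK.
- by rewrite dotDl dotDr IHs IHt.
- by rewrite IHs IHt.
- by rewrite dotC -IHs -dotC.
Qed.

Lemma op_eval_eqv s t : star_eqv (@sphere_rel R[i] q%:C n) s t ->
  forall v, (op_eval s).1 v = (op_eval t).1 v.
Proof.
elim=> {s t} /=; try by move=> *; congruence.
- move=> s t; case=> [i j ij|i j ij|i|] v /=.
  + exact: (so_comm XP).
  + exact: (so_scomm XP).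
  + rewrite op_eval_sum scaleN1r (so_bracket XP); congr (_ *: _).
    by rewrite rmorphB rmorph1 fmorphV rmorphXn.
  + rewrite op_eval_sum scale1r -[RHS](so_sum XP).
    by apply: eq_bigl => j; rewrite ltn_ord.
(* The induction hypothesis equates first components only; the second ones agree because adjoints
   are unique. *)
- move=> s s' _ IH v; apply: inner_sep => w.
  by rewrite dotC -op_eval_adj IH op_eval_adj -dotC.
- by move=> *; rewrite addrA.
- by move=> *; rewrite addrC.
- by move=> *; rewrite scale0r add0r.
- by move=> *; rewrite scale1r.
- by move=> *; rewrite !scale0r.
- by move=> s t u v; rewrite (lopD (op_eval_lin s).1).
- by move=> *; rewrite scalerDl.
- by move=> *; rewrite scalerA.
- by move=> c s v; rewrite (lopZ (op_eval_lin s).1).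
- by [].
Qed.

Lemma ops_repE t v : ops_rep (qsphere_pi _ t) v = (op_eval t).1 v.
Proof. exact/op_eval_eqv/qsphere_repr_eqv. Qed.

Lemma ops_rep_gen i v : ops_rep (qsphere_gen q%:C i) v = X i v.
Proof. exact: ops_repE. Qed.

Lemma qsphere_piD (s t : star_expr R[i] 'I_n.+1) :
  qsphere_pi q%:C (EAdd s t) = qsphere_pi _ s + qsphere_pi _ t.
Proof. by rewrite -!qsphere_pi_eval. Qed.

Lemma qsphere_piM (s t : star_expr R[i] 'I_n.+1) :
  qsphere_pi q%:C (EMul s t) = qsphere_pi _ s * qsphere_pi _ t.
Proof. by rewrite -!qsphere_pi_eval. Qed.

Lemma qsphere_piS (s : star_expr R[i] 'I_n.+1) :
  qsphere_pi q%:C (EStar s) = star (qsphere_pi _ s).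
Proof. by rewrite -!qsphere_pi_eval. Qed.

Lemma qsphere_piC (c : R[i]) :
  qsphere_pi q%:C (EConst c : star_expr R[i] 'I_n.+1) = c%:A.
Proof. by rewrite -!qsphere_pi_eval. Qed.

Lemma ops_rep_sgen i v : ops_rep (star (qsphere_gen q%:C i)) v = Xs i v.
Proof. by rewrite /qsphere_gen -qsphere_piS ops_repE. Qed.

Lemma ops_star_rep : star_rep ops_rep.
Proof.
split.
- by move=> a; exact: (op_eval_lin _).1.
- move=> a; have [M MP] := (op_eval_bounded (repr a)).1.
  by exists M => v; rewrite !nrmE -rmorphM lecR; exact: MP.
- move=> c a b v; elim/qsphere_ind: a => s; elim/qsphere_ind: b => t.
  have -> : c *: qsphere_pi q%:C s + qsphere_pi q%:C t =
      qsphere_pi q%:C (EAdd (EMul (EConst c) s) t).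
    by rewrite qsphere_piD qsphere_piM qsphere_piC -scalerAl mul1r.
  by rewrite !ops_repE.
- by move=> v; rewrite -[1]scale1r -qsphere_piC ops_repE /= scale1r.
- move=> a b v; elim/qsphere_ind: a => s; elim/qsphere_ind: b => t.
  by rewrite -qsphere_piM !ops_repE.
- move=> a u v; elim/qsphere_ind: a => s.
  by rewrite -qsphere_piS !ops_repE op_eval_adj.
Qed.

End Eval.

Lemma qsphere_gen_ind (P : qsphere q%:C n -> Prop) :
  (forall i, P (qsphere_gen q%:C i)) -> (forall c : R[i], P c%:A) ->
  (forall a b, P a -> P b -> P (a + b)) ->
  (forall a b, P a -> P b -> P (a * b)) ->
  (forall a, P a -> P (star a)) -> forall a, P a.
Proof.
move=> Pg Pc PD PM PS; elim/qsphere_ind => t.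
elim: t => [i|c|s IHs t IHt|s IHs t IHt|s IHs].
- exact: Pg.
- by rewrite qsphere_piC.
- by rewrite qsphere_piD; apply: PD.
- by rewrite qsphere_piM; apply: PM.
- by rewrite qsphere_piS; apply: PS.
Qed.

Section OfRep.
Variables (pi : qsphere q%:C n -> H -> H) (piP : star_rep pi).

Lemma repD a b v : pi (a + b) v = pi a v + pi b v.
Proof. by rewrite -[a]scale1r (rep_linear piP) !scale1r. Qed.

Lemma rep0 v : pi 0 v = 0.
Proof. by have := repD 0 0 v; rewrite addr0 -[LHS]addr0 => /addrI. Qed.

Lemma repZ (c : R[i]) a v : pi (c *: a) v = c *: pi a v.
Proof. by rewrite -[c *: a]addr0 (rep_linear piP) rep0 addr0. Qed.

Lemma rep_sum I (s : seq I) (P : pred I) (F : I -> qsphere q%:C n) v :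
  pi (\sum_(i <- s | P i) F i) v = \sum_(i <- s | P i) pi (F i) v.
Proof.
exact: (big_morph (fun a => pi a v) (fun a b => repD a b v) (rep0 v)).
Qed.

Lemma rep_sphere_sum k v :
  pi (star_eval (@qsphere_gen _ q%:C n) (sphere_sum R[i] n k)) v =
  \sum_(j < n.+1 | (j < k)%N)
    pi (star (qsphere_gen q%:C j)) (pi (qsphere_gen q%:C j) v).
Proof.
rewrite /sphere_sum.
rewrite (big_morph (star_eval (@qsphere_gen _ q%:C n)) (id1 := 0) (op1 := +%R)) //=.
  by rewrite rep_sum; apply: eq_bigr => j _; rewrite (rep_mul piP).
by rewrite scale0r.
Qed.

Lemma rep_sphere_ops : sphere_ops (fun i => pi (qsphere_gen q%:C i))
  (fun i => pi (star (qsphere_gen q%:C i))).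
Proof.
have rel s t : sphere_rel q%:C s t -> forall v,
    pi (star_eval (@qsphere_gen _ q%:C n) s) v =
    pi (star_eval (@qsphere_gen _ q%:C n) t) v.
  by move=> /(@qsphere_gen_rel _ q%:C n) -> v.
split.
- by move=> i; exact: rep_op_linear piP _.
- by move=> i; exact: rep_op_linear piP _.
- by move=> i u v; rewrite (rep_star piP).
- move=> i j v ij; have := rel _ _ (SR_comm q%:C ij) v.
  by rewrite /= -scalerAl mul1r repZ !(rep_mul piP).
- move=> i j v ij; have := rel _ _ (SR_star_comm q%:C ij) v.
  by rewrite /= -scalerAl mul1r repZ !(rep_mul piP).
- move=> i v; have := rel _ _ (SR_bracket q%:C i) v.
  rewrite /= -!scalerAl !mul1r repD !repZ !(rep_mul piP) rep_sphere_sum scaleN1r => ->.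
  by rewrite rmorphB rmorph1 fmorphV rmorphXn.
- move=> v; have := rel _ _ (SR_sphere q%:C n) v.
  rewrite rep_sphere_sum /= repZ (rep_1 piP) scale1r => {2}<-.
  by apply: eq_bigl => j; rewrite ltn_ord.
Qed.

End OfRep.

End Words.

(** * The vacuum space *)

Section Vacuum.
Variables (R : realType) (H : hilbertSpace R) (q : R) (n : nat).
Variables X Xs : 'I_n.+1 -> H -> H.
Hypotheses (hq : 1 < `|q|) (XP : sphere_ops q X Xs).
Implicit Types (u v w : H) (i j : 'I_n.+1).

Lemma q_neq0 : q != 0.
Proof. by rewrite -normr_gt0 (lt_trans ltr01). Qed.

Local Notation r := (q ^- 2).

Lemma r_gt0 : 0 < r.
Proof. by rewrite invr_gt0 exprn_even_gt0// q_neq0. Qed.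

Lemma r_lt1 : r < 1.
Proof.
rewrite invf_lt1 ?exprn_even_gt0 ?q_neq0//.
by rewrite -real_normK ?num_real// expr_gt1// ltW.
Qed.

(** The operator [T] of the overview. *)
Definition rho1 v : H := Xs ord0 (X ord0 v).

(** As a fixed space of [T], the vacuum space visibly contains the limits of the [T^k v]; [vacuumP]
    identifies it with the common kernel of the [x_j], [j > 1]. *)
Definition vacuum v := rho1 v = v.

Lemma rho1_lin : linear rho1.
Proof. by move=> c u v; rewrite /rho1 (so_lin XP) (so_slin XP). Qed.

Lemma X0_normal v : X ord0 (Xs ord0 v) = Xs ord0 (X ord0 v).
Proof.
by apply/eqP; rewrite -subr_eq0 (so_bracket XP) big_pred0 ?scaler0.
Qed.

Lemma scomm_sym i j v : i != j -> X j (Xs i v) = q^-1%:C *: Xs i (X j v).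
Proof.
by move=> ij; rewrite (so_scomm XP _ ij) scalerA -rmorphM mulVf ?q_neq0 ?scale1r.
Qed.

Lemma comm_sym i j v : (i < j)%N -> X j (X i v) = q^-1%:C *: X i (X j v).
Proof.
by move=> ij; rewrite (so_comm XP _ ij) scalerA -rmorphM mulVf ?q_neq0 ?scale1r.
Qed.

Lemma scomm_star i j v : (i < j)%N -> Xs i (Xs j v) = q^-1%:C *: Xs j (Xs i v).
Proof.
move=> ij; apply: inner_sep => w.
rewrite dotZl !(so_sadj XP) (comm_sym _ ij) dotZr conjC_real//.
Qed.

(** Crossing [x_1] and crossing its adjoint cost a factor [q^-1] each. *)
Lemma rho1_comm j v : j != ord0 -> X j (rho1 v) = r%:C *: rho1 (X j v).
Proof.
move=> j0; have j0' : ((ord0 : 'I_n.+1) < j)%N by rewrite lt0n.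
rewrite /rho1 scomm_sym ?(eq_sym ord0)// (comm_sym _ j0') (lopZ (so_slin XP _)).
by rewrite scalerA -rmorphM -invfM.
Qed.

Lemma rho1_X0 v : rho1 (X ord0 v) = X ord0 (rho1 v).
Proof. by rewrite /rho1 -X0_normal. Qed.

Lemma rho1_iter_X0 k v : iter k rho1 (X ord0 v) = X ord0 (iter k rho1 v).
Proof. by elim: k => //= k ->; rewrite rho1_X0. Qed.

Lemma rho1_iter_comm j k v : j != ord0 ->
  X j (iter k rho1 v) = (r ^+ k)%:C *: iter k rho1 (X j v).
Proof.
move=> j0; elim: k => [|k IH]; first by rewrite expr0 scale1r.
rewrite !iterS rho1_comm// IH (lopZ rho1_lin) scalerA -rmorphM.
by rewrite -(exprS r).
Qed.

Lemma rho1_contr : bounded_by 1 rho1.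
Proof.
by move=> v; rewrite (le_trans (so_scontr XP _ _))// mul1r; exact: so_contr XP _ _.
Qed.

Lemma rho1_iter_contr k v : nrm (iter k rho1 v) <= nrm v.
Proof.
by elim: k => //= k; apply: le_trans; rewrite (le_trans (rho1_contr _))// mul1r.
Qed.

Lemma rho1_sym u v : inner (rho1 u) v = inner u (rho1 v).
Proof. by rewrite (so_sadj XP) (so_adj XP). Qed.

Lemma rho1_compl v : v - rho1 v = \sum_(j < n.+1 | j != ord0) Xs j (X j v).
Proof.
by rewrite -[X in X - _](so_sum XP) (bigD1 ord0)//= addrAC subrr add0r.
Qed.

Lemma nrm_sum I (s : seq I) (P : pred I) (F : I -> H) :
  nrm (\sum_(i <- s | P i) F i) <= \sum_(i <- s | P i) nrm (F i).
Proof.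
elim/big_rec2: _ => [|i y x Pi xy]; first by rewrite nrm0.
by rewrite (le_trans (nrmD _ _))// lerD2l.
Qed.

(* The increment [(1 - T) T^k v] is the sum of the [x_j^* x_j T^k v] over
   [j > 1], and [x_j T^k = q^-2k T^k x_j]. *)
Lemma rho1_cvg v : exists2 w, tends (fun k => iter k rho1 v) w & vacuum w.
Proof.
have [|||k|w vw] := @geometric_tends R H (fun k => iter k rho1 v)
    (nrm v *+ n.+1) r.
- by rewrite mulrn_wge0// nrm_ge0.
- exact: ltW r_gt0.
- exact: r_lt1.
- rewrite nrm_distC iterS rho1_compl (le_trans (nrm_sum _ _ _))//.
  rewrite mulrnAl -[X in _ *+ X]card_ord -sumr_const big_mkcond /=.
  rewrite ler_sum// => j _; case: ifP => j0; last first.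
    by rewrite mulr_ge0 ?nrm_ge0// exprn_ge0// ltW// r_gt0.
  rewrite (le_trans (so_scontr XP _ _))// mul1r rho1_iter_comm// nrmZr.
  rewrite ger0_norm ?exprn_ge0 ?(ltW r_gt0)// mulrC ler_wpM2r//.
    by rewrite exprn_ge0 ?(ltW r_gt0).
  by rewrite (le_trans (rho1_iter_contr _ _))// -[leRHS]mul1r; exact: so_contr XP _ _.
exists w => //; apply: tends_unique (tends_shift vw).
by apply: bounded_tends => //; [exact: rho1_lin|exists 1; exact: rho1_contr].
Qed.

(** [T] is symmetric and fixes [u], so all [T^k v] have the same inner product with [u]: the limit
    is the orthogonal projection of [v] onto the vacuum space. *)
Lemma rho1_lim_inner v w u : tends (fun k => iter k rho1 v) w -> vacuum u ->
  inner w u = inner v u.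
Proof.
move=> vw uu; apply: (tends_inner_const vw); elim=> //= k <-.
by rewrite rho1_sym uu.
Qed.

(** If [T w = w], then [|x_1 w| = |w|], and [so_sum_nrm] leaves nothing for the other
    [|x_j w|^2]. *)
Lemma vacuumP w : vacuum w <-> forall j, j != ord0 -> X j w = 0.
Proof.
split=> [ww j j0|w0]; last first.
  apply/esym/eqP; rewrite -subr_eq0 rho1_compl big1// => j j0.
  by rewrite w0// (lop0 (so_slin XP _)).
have : nrm (X ord0 w) ^+ 2 = nrm w ^+ 2.
  by apply: complexI; rewrite -!inner_nrm (so_adj XP) -/(rho1 w) ww.
rewrite -(so_sum_nrm XP w) (bigD1 ord0)//= => /eqP.
rewrite -subr_eq0 opprD addNKr oppr_eq0 psumr_eq0; last first.
  by move=> k _; rewrite sqr_ge0.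
move=> /allP /(_ j); rewrite mem_index_enum j0 => /(_ isT) /eqP /eqP.
by rewrite sqrf_eq0 => /eqP /nrm0_eq0.
Qed.

Lemma vacuum_subspace : closed_subspace [set w | vacuum w].
Proof.
apply/closed_subspaceE; split.
  split; first exact: lop0 rho1_lin.
  by move=> c u v uu vv; rewrite /= /vacuum rho1_lin uu vv.
move=> v /approx_tends [x xx xv] /=.
apply: tends_unique (xv).
have -> : x = rho1 \o x by apply/funext => k /=; rewrite xx.
by apply: bounded_tends xv; [exact: rho1_lin|exists 1; exact: rho1_contr].
Qed.

Lemma X0_vacuum w : vacuum w -> vacuum (X ord0 w).
Proof. by rewrite /vacuum rho1_X0 => ->. Qed.

Lemma Xs0_vacuum w : vacuum w -> vacuum (Xs ord0 w).
Proof. by rewrite /vacuum /rho1 X0_normal -/(rho1 w) => ->. Qed.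

Lemma X0_iter_comm j k v : j != ord0 ->
  X j (iter k (X ord0) v) = (q^-1 ^+ k)%:C *: iter k (X ord0) (X j v).
Proof.
move=> j0; have j0' : ((ord0 : 'I_n.+1) < j)%N by rewrite lt0n.
elim: k => [|k IH]; first by rewrite expr0 scale1r.
rewrite !iterS (comm_sym _ j0') IH (lopZ (so_lin XP _)) scalerA -rmorphM.
by rewrite -(exprS q^-1).
Qed.

(** Since [x_1] is normal, [<T^k v, v>] is [|x_1^k v|^2]; by Cauchy-Schwarz the decay of [T^k v]
    passes to [x_1^k v]. *)
Lemma nrm_iter_X0 k v : nrm (iter k (X ord0) v) ^+ 2 <= nrm (iter k rho1 v) * nrm v.
Proof.
suff E : inner (iter k rho1 v) v = (nrm (iter k (X ord0) v) ^+ 2)%:C.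
  have := inner_CS (iter k rho1 v) v.
  by rewrite E normC_real lecR ger0_norm ?sqr_ge0.
elim: k v => [|k IH] v; first by rewrite inner_nrm.
rewrite iterS iterSr -IH rho1_sym [in X in inner _ X]/rho1 -(so_adj XP).
by rewrite rho1_iter_X0.
Qed.

(* The norms [a_k = |x_1^k v|^2] tend to 0, and their increments, which are the
   sums of the [|x_j x_1^k v|^2 = q^-2k |x_1^k x_j v|^2] over [j > 1], shrink
   by the factor [q^-2 c] in each step. *)
Lemma X0_bound_improve (c : R) : (forall w, vacuum w -> w = 0) -> 0 <= c ->
  (forall v, nrm (X ord0 v) ^+ 2 <= c * nrm v ^+ 2) ->
  forall v, nrm (X ord0 v) ^+ 2 <= r * c * nrm v ^+ 2.
Proof.
move=> vac0 c0 X0c v; pose a k := nrm (iter k (X ord0) v) ^+ 2.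
pose s k := \sum_(j < n.+1 | j != ord0) nrm (iter k (X ord0) (X j v)) ^+ 2.
have aE k : a k - a k.+1 = r ^+ k * s k.
  rewrite /a -(so_sum_nrm XP (iter k (X ord0) v)) (bigD1 ord0)//= addrAC subrr add0r.
  rewrite mulr_sumr; apply: eq_bigr => j j0; rewrite X0_iter_comm// nrmZr exprMn.
  by congr (_ * _); rewrite real_normK ?num_real// -!exprVn -!exprM mulnC.
have sS k : s k.+1 <= c * s k.
  by rewrite mulr_sumr ler_sum// => j _; exact: X0c.
have aS k : a k.+1 - a k.+2 <= r * c * (a k - a k.+1).
  rewrite !aE (exprS r) mulrACA ler_wpM2l// mulr_ge0 ?exprn_ge0 ?(ltW r_gt0)//.
(* The increments are summed over [k < N]. As [a N.+1] tends to 0 and [a N] is nonnegative, the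
   limit is [a 1 <= r * c * a 0], which is the claim. *)
have aN N : a 1 - a N.+1 <= r * c * (a 0 - a N).
  elim: N => [|N IH]; first by rewrite !subrr mulr0.
  rewrite -[leLHS](subrKA (a N.+1)) (le_trans (lerD IH (aS N)))//.
  by rewrite -mulrDr subrKA.
have [w vw /vac0 w0] := rho1_cvg v.
have rc0 : 0 <= r * c by rewrite mulr_ge0// ltW// r_gt0.
apply/ler_addgt0Pr => e e0.
have [d d0 de] := cfactor_small (nrm_ge0 v) e0.
have [N /(_ N.+1 (leqnSn N))] := vw _ d0; rewrite w0 subr0 => Nd.
have aNe : a N.+1 <= e.
  rewrite (le_trans (nrm_iter_X0 _ _))// (le_trans _ de)// mulrC.
  by rewrite ler_wpM2l ?nrm_ge0 ?ltW.
rewrite -[leLHS]/(a 1) -lerBlDr (le_trans (lerB (lexx _) aNe))//.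
rewrite (le_trans (aN N))// ler_wpM2l// lerBlDr lerDl sqr_ge0//.
Qed.

Lemma vacuum_exists : (exists v, X ord0 v <> 0) -> exists2 w, vacuum w & w != 0.
Proof.
move=> [v Xv]; apply: contrapT => vac.
have vac0 w : vacuum w -> w = 0.
  move=> ww; apply/eqP; rewrite -[_ == _]negbK; apply/negP => w0.
  by apply: vac; exists w.
apply: Xv; apply: nrm0_eq0; apply/eqP; rewrite -sqrf_eq0; apply/eqP.
(* The contraction bound [c = 1] is improved [k] times. *)
have rk k : nrm (X ord0 v) ^+ 2 <= r ^+ k * nrm v ^+ 2.
  elim: k v => [|k IH] v.
    rewrite expr0 mul1r ler_sqr ?nnegrE ?nrm_ge0// -[leRHS]mul1r.
    exact: so_contr XP _ _.
  rewrite (exprS r); apply: X0_bound_improve => //.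
  by rewrite exprn_ge0 ?(ltW r_gt0).
apply: small_eq0 => [|e e0]; first by rewrite sqr_ge0.
have [d d0 de] := cfactor_small (sqr_ge0 (nrm v)) e0.
have r1 : `|r| < 1 by rewrite ger0_norm ?(ltW r_gt0) ?r_lt1.
have /cvgrPdist_lt /(_ _ d0) [N _ /(_ N (leqnn N))] := cvg_expr r1.
rewrite /= sub0r normrN ger0_norm ?exprn_ge0 ?(ltW r_gt0)// => rN.
rewrite (le_trans (rk N))// (le_trans _ de)// mulrC ler_wpM2l ?sqr_ge0 ?ltW//.
Qed.

End Vacuum.

(** * Square roots of positive operators *)

Section AbsoluteValue.
Variables (R : realType) (H : hilbertSpace R).
Implicit Types (S T G X : H -> H) (u v w : H).

(* Polynomials without constant term in [X] with nonnegative coefficients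
   summing to [c]: such an operator has norm at most [c] when [X] is a
   contraction. *)
Inductive cone X : R -> (H -> H) -> Prop :=
| cone0 : cone X 0 (fun=> 0)
| coneX : cone X 1 X
| coneD c d S T : cone X c S -> cone X d T -> cone X (c + d) (fun v => S v + T v)
| coneM c d S T : cone X c S -> cone X d T -> cone X (c * d) (fun v => S (T v))
| coneZ a c S : 0 <= a -> cone X c S -> cone X (a * c) (fun v => a%:C *: S v).

Lemma cone_eq X c d S T : c = d -> S =1 T -> cone X c S -> cone X d T.
Proof. by move=> -> /funext ->. Qed.

(* [1 - sqrt_iter X k] converges to the square root of [1 - X]. *)
Fixpoint sqrt_iter X k : H -> H :=
  if k is k'.+1 then
    fun v => (2^-1)%:C *: (X v + sqrt_iter X k' (sqrt_iter X k' v))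
  else fun=> 0.

(** The same iteration for the scalar [X = 1]: the sum of the coefficients of the polynomial
    [sqrt_iter X k]. It is nondecreasing and at most 1, and its increments bound those of the
    operator iteration in norm. *)
Fixpoint sqrt_weight k : R :=
  if k is k'.+1 then 2^-1 * (1 + sqrt_weight k' * sqrt_weight k') else 0.

Lemma sqrt_weight_bound k : 0 <= sqrt_weight k <= 1.
Proof.
elim: k => [|k /andP[t0 t1]] /=; first by rewrite lexx ler01.
rewrite mulr_ge0 ?addr_ge0 ?mulr_ge0 ?invr_ge0//= ler_pdivrMl// mulr1.
by rewrite -[leRHS]/(1 + 1) lerD2l mulr_ile1.
Qed.

Section Cone.
Variable X : H -> H.
Hypotheses (Xlin : linear X) (Xcontr : bounded_by 1 X).

Lemma cone_lin c S : cone X c S -> linear S.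
Proof.
elim=> {c S} //=.
- by move=> c u v; rewrite scaler0 addr0.
- by move=> c d S T _ Sl _ Tl a u v; rewrite Sl Tl scalerDr addrACA.
- by move=> c d S T _ Sl _ Tl a u v; rewrite Tl Sl.
- by move=> a c S _ _ Sl b u v; rewrite Sl scalerDr !scalerA mulrC.
Qed.

Lemma cone_bound c S : cone X c S -> 0 <= c /\ bounded_by c S.
Proof.
elim=> {c S} //=.
- by split=> // v; rewrite nrm0 mul0r.
- move=> c d S T _ [c0 Sc] _ [d0 Td]; split=> [|v]; first exact: addr_ge0.
  by rewrite (le_trans (nrmD _ _))// mulrDl lerD.
- move=> c d S T _ [c0 Sc] _ [d0 Td]; split=> [|v]; first exact: mulr_ge0.
  by rewrite (le_trans (Sc _))// -mulrA ler_wpM2l.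
- move=> a c S a0 _ [c0 Sc]; split=> [|v]; first exact: mulr_ge0.
  by rewrite nrmZr ger0_norm// -mulrA ler_wpM2l.
Qed.

Lemma cone_comm c S G : linear G -> (forall v, G (X v) = X (G v)) ->
  cone X c S -> forall v, G (S v) = S (G v).
Proof.
move=> Gl GX; elim=> {c S} //=.
- by move=> v; rewrite (lop0 Gl).
- by move=> c d S T _ GS _ GT v; rewrite (lopD Gl) GS GT.
- by move=> c d S T _ GS _ GT v; rewrite GS GT.
- by move=> a c S _ _ GS v; rewrite (lopZ Gl) GS.
Qed.

Lemma cone_commute c d S T : cone X c S -> cone X d T ->
  forall v, S (T v) = T (S v).
Proof.
move=> Sc Td; apply: cone_comm Td; first exact: cone_lin Sc.
by move=> v; rewrite -(cone_comm Xlin _ Sc).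
Qed.

Lemma sqrt_iter_cone k : cone X (sqrt_weight k) (sqrt_iter X k).
Proof.
elim: k => [|k IH] /=; first exact: cone0.
apply: coneZ; first by rewrite invr_ge0.
by apply: coneD; [exact: coneX|exact: coneM].
Qed.

(** Polynomials in [X] commute, so [Y_{k+2} - Y_{k+1}] is half of [(Y_{k+1} + Y_k)(Y_{k+1} - Y_k)]
    and inherits nonnegative coefficients. *)
Lemma sqrt_iter_incr k : cone X (sqrt_weight k.+1 - sqrt_weight k)
  (fun v => sqrt_iter X k.+1 v - sqrt_iter X k v).
Proof.
have h2 : (0 : R) <= 2^-1 by rewrite invr_ge0 ler0n.
elim: k => [|k IH].
  have := coneZ h2 (coneX X).
  by apply: cone_eq => [|v] /=; rewrite ?mul0r ?addr0 ?subr0.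
have Yk := sqrt_iter_cone k; have Yk1 := sqrt_iter_cone k.+1.
have := coneZ h2 (coneM (coneD Yk1 Yk) IH).
apply: cone_eq => [|v].
  have tE j : sqrt_weight j.+1 = 2^-1 * (1 + sqrt_weight j * sqrt_weight j) by [].
  by rewrite (tE k.+1) [X in _ = _ - X](tE k); ring.
have YE j : sqrt_iter X j.+1 v =
    (2^-1)%:C *: (X v + sqrt_iter X j (sqrt_iter X j v)) by [].
rewrite (YE k.+1) [Z in _ = _ - Z](YE k).
rewrite -scalerBr; congr (_ *: _).
rewrite (lopB (cone_lin Yk1)) (lopB (cone_lin Yk)) (cone_commute Yk Yk1).
by rewrite subrKA opprD addrACA subrr add0r.
Qed.

Lemma sqrt_iter_cvg v : exists l, tends (fun k => sqrt_iter X k v) l.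
Proof.
apply: (@telescope_tends _ _ _ (fun k => sqrt_weight k * nrm v) (nrm v)).
  move=> k; have /andP[_ t1] := sqrt_weight_bound k.
  by rewrite ler_piMl// nrm_ge0.
by move=> k; have [_] := cone_bound (sqrt_iter_incr k); rewrite -mulrBl; apply.
Qed.

End Cone.

(** With [X = 1 - B^2], the limit [Y] of the iteration satisfies [2 Y = X + Y^2], that is
    [(1 - Y)^2 = B^2], and [Z = 1 - Y] plays the role of [|B|]. It is positive because [Y] is a
    contraction; commutation and invariance pass from polynomials in [B^2] to the limit. *)
Lemma abs_op (B : H -> H) : linear B -> bounded_by 1 B ->
  (forall u v, inner (B u) v = inner u (B v)) ->
  exists Z : H -> H, [/\ linear Z /\ bounded_op Z,
    (forall v, 0 <= complex.Re (inner (Z v) v)),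
    (forall v, Z (Z v) = B (B v)),
    (forall G, linear G -> bounded_op G -> (forall v, G (B v) = B (G v)) ->
      forall v, G (Z v) = Z (G v))
    & forall W, closed_subspace W -> (forall w, W w -> W (B w)) ->
      forall w, W w -> W (Z w)].
Proof.
move=> Blin Bcontr Bsym; pose X v := v - B (B v).
have Xlin : linear X.
  by move=> c u v; rewrite /X !Blin scalerBr opprD addrACA.
have BB v : inner v (B (B v)) = (nrm (B v) ^+ 2)%:C by rewrite -Bsym inner_nrm.
have Xcontr : bounded_by 1 X.
  move=> v; rewrite mul1r -ler_sqr ?nnegrE ?nrm_ge0// -lecR -inner_nrm /X.
  rewrite dnormB BB conjC_real !inner_nrm -!rmorphD -rmorphB/= lecR.
  have b0 := sqr_ge0 (nrm (B v)).
  suff : nrm (B (B v)) ^+ 2 <= nrm (B v) ^+ 2 by lra.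
  by rewrite ler_sqr ?nnegrE ?nrm_ge0// (le_trans (Bcontr _))// mul1r.
have [Y Ylim] := choice (sqrt_iter_cvg Xlin Xcontr).
have it_bd k v : nrm (sqrt_iter X k v) <= nrm v.
  have [_ bd] := cone_bound Xcontr (sqrt_iter_cone X k).
  have /andP[_ t1] := sqrt_weight_bound k.
  by rewrite (le_trans (bd v))// ler_piMl// nrm_ge0.
have it_lin k := cone_lin Xlin (sqrt_iter_cone X k).
have Ylin : linear Y.
  move=> c u v; apply: tends_unique (Ylim _) _.
  have := tendsD (tendsZ c (Ylim u)) (Ylim v).
  by under [X in tends X _]funext => k do rewrite -it_lin.
have Ybd : bounded_by 1 Y.
  by move=> v; rewrite mul1r; apply: tends_nrm_le (Ylim v) _ => k.
have Yfix v : Y v = (2^-1)%:C *: (X v + Y (Y v)).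
  apply: tends_unique (tends_shift (Ylim v)) _; rewrite /=.
  apply: tendsZ; apply: tendsD; first exact: tends_cst.
  (* [Y_k (Y_k v)] is compared with [Y (Y v)] through [Y_k (Y v)]; the [Y_k] being contractions, the
     first difference is at most [|Y_k v - Y v|]. *)
  move=> e e0; have e2 : 0 < e / 2 by rewrite divr_gt0.
  have [N YN] := Ylim v _ e2; have [M YM] := Ylim (Y v) _ e2.
  exists (maxn N M) => k; rewrite geq_max => /andP[/YN Nk /YM Mk].
  rewrite (le_lt_trans (nrm_tri (sqrt_iter X k (Y v)) _ _))// (splitr e) ltrD//.
  by rewrite -(lopB (it_lin k)) (le_lt_trans (it_bd _ _)).
have Ycomm G : linear G -> bounded_op G -> (forall v, G (B v) = B (G v)) ->
    forall v, G (Y v) = Y (G v).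
  move=> Gl Gb GB v; apply: tends_unique (Ylim _).
  have := bounded_tends Gl Gb (Ylim v).
  congr tends; apply/funext => k /=.
  apply: (cone_comm Gl _ (sqrt_iter_cone X k)) => w.
  by rewrite /X (lopB Gl) !GB.
exists (fun v => v - Y v); split.
- split; first by move=> c u v; rewrite Ylin scalerBr opprD addrACA.
  exists 2 => v; rewrite (le_trans (nrmB _ _))// mulr_natl mulr2n lerD2l.
  by rewrite -[leRHS]mul1r.
- move=> v; rewrite dotBl inner_nrm raddfB/= subr_ge0.
  have := le_trans (normc_ge_Re (inner (Y v) v)) (inner_CS (Y v) v).
  rewrite lecR => /(le_trans (ler_norm _)) /le_trans; apply.
  by rewrite expr2 ler_wpM2r ?nrm_ge0// -[leRHS]mul1r.
- move=> v; have Y2 : Y v + Y v = X v + Y (Y v).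
    rewrite -mulr2n -scaler_nat [X in _ *: X]Yfix scalerA.
    by rewrite -(rmorph_nat (real_complex R)) -rmorphM mulfV ?pnatr_eq0// scale1r.
  have -> : B (B v) = v - X v by rewrite /X opprB addrCA subrr addr0.
  have -> : X v = Y v + Y v - Y (Y v) by rewrite Y2 addrK.
  by rewrite (lopB Ylin) !opprB opprD !addrA; congr (_ - _); exact: addrAC.
- by move=> G Gl Gb GB v; rewrite (lopB Gl) Ycomm.
- move=> W Wc WB w Ww; have /closed_subspaceE [[W0 Wl] Wcl] := Wc.
  suff WY : W (Y w) by rewrite -scaleN1r addrC; apply: (Wl).
  apply: Wcl; apply: tends_approx (Ylim w) => k.
  elim: k w Ww => [|k IH] w Ww //=; rewrite -[_ *: _]addr0; apply: (Wl) => //.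
  rewrite -[X w]scale1r; apply: (Wl); last by do 2!apply: (IH).
  by rewrite /X -scaleN1r addrC; apply: (Wl) => //; do 2!apply: (WB).
Qed.

End AbsoluteValue.

(** * Schur's lemma for self-adjoint and normal operators *)

Section Schur.
Variables (R : realType) (H : hilbertSpace R).
Implicit Types (u v w : H) (G B : H -> H).
Variables (W : set H) (Fam : (H -> H) -> Prop).
Hypotheses (Wc : closed_subspace W).
Hypothesis FamP : forall G, Fam G ->
  [/\ linear G, bounded_op G & forall w, W w -> W (G w)].
Hypothesis W_irr : forall V, closed_subspace V -> V `<=` W ->
  (forall G, Fam G -> forall v, V v -> V (G v)) ->
  (forall v, V v -> v = 0) \/ W `<=` V.

Definition sym_op B :=
  [/\ linear B, bounded_op B, (forall u v, inner (B u) v = inner u (B v)),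
    (forall w, W w -> W (B w))
    & forall G, Fam G -> forall v, G (B v) = B (G v)].

(* The space [V] where [|B|] and [B] agree is invariant, hence 0 or [W]; since
   [|B| + B] maps [W] into [V], in the first case [|B| = - B] on [W]. *)
Lemma sym_op_contr_sign B : sym_op B -> bounded_by 1 B ->
  (forall w, W w -> 0 <= complex.Re (inner (B w) w)) \/
  (forall w, W w -> complex.Re (inner (B w) w) <= 0).
Proof.
move=> [Bl Bb Bs BW BG] B1.
have [Z [[Zl Zb] Zpos ZZ ZG ZW]] := abs_op Bl B1 Bs.
have ZB v : Z (B v) = B (Z v) by rewrite (ZG B).
have /closed_subspaceE [[W0 Wl] Wcl] := Wc.
have [] := @W_irr [set v | W v /\ Z v = B v].
- apply/closed_subspaceE; split.
    split; first by rewrite /= (lop0 Zl) (lop0 Bl).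
    by move=> c u v /= [Wu Zu] [Wv Zv]; split; [exact: Wl|rewrite Zl Bl Zu Zv].
  move=> v Vv; split; first by apply: Wcl; apply: sub_approx Vv => u [].
  have [x xV xv] := approx_tends Vv.
  have := bounded_tends Bl Bb xv.
  have -> : B \o x = Z \o x by apply/funext => k /=; case: (xV k).
  exact: tends_unique (bounded_tends Zl Zb xv).
- by move=> u [].
- move=> G FG v [Wv Zv]; have [Gl Gb GW] := FamP FG.
  split; first exact: GW.
  by rewrite -(ZG G) ?Zv ?BG// => u; rewrite BG.
- move=> V0; right=> w Ww.
  suff /V0/eqP : W (Z w + B w) /\ Z (Z w + B w) = B (Z w + B w).
    rewrite addrC addr_eq0 => /eqP ->.
    by rewrite dotNl raddfN oppr_le0 Zpos.
  split; last by rewrite (lopD Zl) (lopD Bl) ZZ ZB addrC.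
  by have := Wl 1 _ _ (ZW _ Wc BW _ Ww) (BW _ Ww); rewrite scale1r.
- by move=> WV; left=> w /WV [Ww <-].
Qed.

Lemma sym_op_sign B : sym_op B ->
  (forall w, W w -> 0 <= complex.Re (inner (B w) w)) \/
  (forall w, W w -> complex.Re (inner (B w) w) <= 0).
Proof.
move=> [Bl /bounded_opP [M M0 BM] Bs BW BG].
have /closed_subspaceE [[W0 Wl] Wcl] := Wc.
(* Rescaling by [(M + 1)^-1] gives a contraction and keeps the sign of the form; [M + 1] is positive
   even for [M = 0]. *)
have M1 : 0 < M + 1 by rewrite ltr_wpDl.
pose s := (M + 1)^-1; have s0 : 0 < s by rewrite invr_gt0.
have sE v : complex.Re (inner (s%:C *: B v) v) = s * complex.Re (inner (B v) v).
  by rewrite dotZl; case: (inner _ _) => a b /=; rewrite mul0r subr0.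
have [||P|P] := @sym_op_contr_sign (fun v => s%:C *: B v).
- split.
  + by move=> c u v; rewrite Bl scalerDr !scalerA mulrC.
  + by exists (s * M) => v; rewrite nrmZr gtr0_norm// -mulrA ler_wpM2l ?(ltW s0).
  + by move=> u v; rewrite dotZl dotZr conjC_real Bs.
  + by move=> w Ww; rewrite -[_ *: _]addr0; apply: (Wl) => //; exact: BW.
  + by move=> G FG v; have [Gl _ _] := FamP FG; rewrite (lopZ Gl) BG.
- move=> v; rewrite nrmZr gtr0_norm// mulrC ler_pdivrMr// mul1r mulrC.
  by rewrite (le_trans (BM v))// ler_wpM2r ?nrm_ge0// lerDl ler01.
- by left=> w /P; rewrite sE pmulr_rge0.
- by right=> w /P; rewrite sE pmulr_rle0.
Qed.

(** At [w + B w] the two cross terms of the form add up to [2 |B w|^2]. *)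
Lemma sym_op_quad0 B : sym_op B ->
  (forall w, W w -> complex.Re (inner (B w) w) = 0) -> forall w, W w -> B w = 0.
Proof.
move=> [Bl Bb Bs BW BG] B0 w Ww.
have /closed_subspaceE [[W0 Wl] Wcl] := Wc.
have WB : W (B w) by exact: BW.
have Ws : W (w + B w) by have := Wl 1 _ _ Ww WB; rewrite scale1r.
apply: nrm0_eq0; apply/eqP; rewrite -sqrf_eq0; apply/eqP.
have := B0 _ Ws; rewrite (lopD Bl) !dotDl !dotDr !raddfD/= !B0// (Bs (B w) w).
rewrite inner_nrm /= => E; lra.
Qed.

Lemma sym_op_shift B (c : R) : sym_op B -> sym_op (fun v => B v - c%:C *: v).
Proof.
move=> [Bl Bb Bs BW BG]; have /closed_subspaceE [[W0 Wl] Wcl] := Wc.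
split.
- by move=> a u v; rewrite Bl scalerDr scalerBr !scalerA opprD addrACA mulrC.
- have [M M0 BM] := bounded_opP Bb; exists (M + `|c|) => v.
  by rewrite (le_trans (nrmB _ _))// nrmZr mulrDl lerD.
- by move=> u v; rewrite dotBl dotBr dotZl dotZr conjC_real Bs.
- move=> w Ww; rewrite -scaleNr addrC; apply: (Wl) => //; exact: BW.
- by move=> G FG v; have [Gl _ _] := FamP FG; rewrite (lopB Gl) (lopZ Gl) BG.
Qed.

(** The scalar is the largest lower bound [c] of the form of [B] relative to [|v|^2]. For [d > 0]
    the form of [B - (c + d)] cannot be nonnegative, hence it is nonpositive by [sym_op_sign]; so
    [c] is an upper bound too and [B - c] has zero form on [W]. *)
Lemma sym_op_scalar B : sym_op B -> exists c : R, forall w, W w -> B w = c%:C *: w.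
Proof.
move=> SB; have [[w [Ww w0]]|noW] := pselect (exists w, W w /\ w <> 0); last first.
  exists 0 => w Ww; have -> : w = 0.
    by apply: contrapT => w0; apply: noW; exists w.
  by have [Bl _ _ _ _] := SB; rewrite (lop0 Bl) scaler0.
have shE c v : complex.Re (inner (B v - c%:C *: v) v) =
    complex.Re (inner (B v) v) - c * nrm v ^+ 2.
  by rewrite dotBl dotZl inner_nrm -rmorphM raddfB.
pose S := [set c : R | forall v, W v -> c * nrm v ^+ 2 <= complex.Re (inner (B v) v)].
have w2 : 0 < nrm w ^+ 2 by rewrite exprn_gt0// nrm_gt0//; apply/eqP.
have [_ /bounded_opP [M M0 BM] _ _ _] := SB.
have Bq v : `|complex.Re (inner (B v) v)| <= M * nrm v ^+ 2.
  rewrite -lecR (le_trans (normc_ge_Re _))// (le_trans (inner_CS _ _))// lecR.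
  by rewrite expr2 mulrA ler_wpM2r ?nrm_ge0.
have supS : has_sup S.
  split.
    exists (- M) => v Wv; have := Bq v; rewrite ler_norml => /andP[+ _].
    by rewrite mulNr.
  exists M => c /(_ _ Ww) cw; rewrite -(ler_pM2r w2) (le_trans cw)//.
  by rewrite (le_trans (ler_norm _)).
have lowS v : W v -> sup S * nrm v ^+ 2 <= complex.Re (inner (B v) v).
  move=> Wv; apply/ler_addgt0Pr => e e0.
  have [d d0 de] := cfactor_small (sqr_ge0 (nrm v)) e0.
  have [c Sc cd] := sup_adherent d0 supS.
  have := Sc _ Wv; rewrite -(lerD2r e); apply: le_trans.
  rewrite (le_trans _ (lerD (lexx _) de))// [sup S * _]mulrC [c * _]mulrC -mulrDr.
  by rewrite ler_wpM2l ?sqr_ge0// -lerBlDr ltW.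
have upS v : W v -> complex.Re (inner (B v) v) <= sup S * nrm v ^+ 2.
  move=> Wv; apply/ler_addgt0Pr => e e0.
  have [d d0 de] := cfactor_small (sqr_ge0 (nrm v)) e0.
  have [P|P] := sym_op_sign (sym_op_shift (sup S + d) SB).
    have : S (sup S + d) by move=> u /P; rewrite shE subr_ge0.
    by move=> /(sup_upper_bound supS); rewrite gerDl leNgt d0.
  have := P _ Wv; rewrite shE subr_le0 => /le_trans; apply.
  by rewrite mulrDl lerD2l mulrC.
exists (sup S) => v Wv; apply/eqP; rewrite -subr_eq0; apply/eqP.
apply: (sym_op_quad0 (sym_op_shift (sup S) SB)) => // u Wu.
by rewrite shE; apply/eqP; rewrite subr_eq0 eq_le upS ?lowS.
Qed.

Lemma normal_scalar (N Ns : H -> H) : Fam = [set N; Ns] ->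
  (forall u v, inner (N u) v = inner u (Ns v)) ->
  (forall v, N (Ns v) = Ns (N v)) ->
  exists c : R[i], forall w, W w -> N w = c *: w.
Proof.
move=> FE Nadj Nn.
have [Nl [MN NM] NW] : [/\ linear N, bounded_op N & forall w, W w -> W (N w)].
  by apply: FamP; rewrite FE; left.
have [Nsl [MNs NsM] NsW] :
    [/\ linear Ns, bounded_op Ns & forall w, W w -> W (Ns w)].
  by apply: FamP; rewrite FE; right.
have Nsadj u v : inner (Ns u) v = inner u (N v) by rewrite dotC -Nadj -dotC.
have /closed_subspaceE [WS Wcl] := Wc.
have [|a aP] := @sym_op_scalar (fun v => N v + Ns v).
  split.
  - by move=> c u v; rewrite Nl Nsl scalerDr addrACA.
  - by exists (MN + MNs) => v; rewrite (le_trans (nrmD _ _))// mulrDl lerD.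
  - by move=> u v; rewrite dotDl dotDr Nadj Nsadj addrC.
  - by move=> w Ww; apply: subspaceD => //; [exact: NW|exact: NsW].
  - by rewrite FE => G [->|->] v; rewrite ?(lopD Nl) ?(lopD Nsl) Nn.
have [im im2 imJ] : exists2 im : R[i], im * im = -1 & conjC im = - im.
  by exists 'i; [rewrite -expr2 sqrCi|rewrite conjCi].
have [|b bP] := @sym_op_scalar (fun v => im *: (N v - Ns v)).
  split.
  - move=> c u v; rewrite Nl Nsl opprD addrACA -scalerBr scalerDr.
    by rewrite !scalerA mulrC.
  - exists (complex.Re `|im| * (MN + MNs)) => v.
    rewrite nrmZ -mulrA ler_wpM2l//.
      by rewrite -ler0c ReK_ge0.
    by rewrite (le_trans (nrmB _ _))// mulrDl lerD.
  - move=> u v; rewrite dotZl dotZr dotBl dotBr Nadj Nsadj.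
    by rewrite imJ mulNr -mulrN opprB.
  - move=> w Ww; apply: subspaceZ => //; rewrite -scaleN1r; apply: subspaceD => //.
      exact: NW.
    by apply: subspaceZ => //; exact: NsW.
  - rewrite FE => G [->|->] v.
      by rewrite (lopZ Nl) (lopB Nl) Nn.
    by rewrite (lopZ Nsl) (lopB Nsl) Nn.
exists (2%:R^-1 * (a%:C - im * b%:C)) => w Ww.
have -> : N w = 2%:R^-1 *: (N w + Ns w - im *: (im *: (N w - Ns w))).
  rewrite scalerA im2 scaleN1r opprK.
  rewrite addrACA subrr addr0 -mulr2n -(scaler_nat 2 (N w)) scalerA.
  by rewrite mulVf ?scale1r// pnatr_eq0.
by rewrite aP// bP// scalerA -scalerBl scalerA.
Qed.

End Schur.

(** * Fock vectors *)

Section Fock.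
Variables (R : realType) (H : hilbertSpace R) (q : R) (n : nat).
Variables X Xs : 'I_n.+1 -> H -> H.
Hypotheses (hq : 1 < `|q|) (XP : sphere_ops q X Xs).
Implicit Types (u v w : H) (i : 'I_n.+1) (j : nat) (k : nat -> nat).

Local Notation r := (q ^- 2).

Definition updn k (j a l : nat) := if l == j then a else k l.
Arguments updn : simpl never.

(* [fock_to m k v] is [X_m^*^{k_{m-1}} ... X_1^*^{k_0} v], with the generators
   numbered from 0 as [X_0, ..., X_n]. *)
Fixpoint fock_to m k v : H :=
  if m is m'.+1 then iter (k m') (Xs (inord m)) (fock_to m' k v) else v.

Lemma iter_qcomm (G : H -> H) (a : R) i p v : linear G ->
  (forall u, G (Xs i u) = a%:C *: Xs i (G u)) ->
  G (iter p (Xs i) v) = (a ^+ p)%:C *: iter p (Xs i) (G v).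
Proof.
move=> Gl GX; elim: p => [|p IH]; first by rewrite scale1r.
by rewrite !iterS GX IH (lopZ (so_slin XP _)) scalerA -rmorphM -exprS.
Qed.

Lemma fock_to_ext m k k' v : (forall l, (l < m)%N -> k l = k' l) ->
  fock_to m k v = fock_to m k' v.
Proof.
elim: m => //= m IH kk; rewrite kk ?ltnSn// IH// => l lm.
by rewrite kk// ltnW.
Qed.

Lemma fock_to_lin m k : linear (fock_to m k).
Proof.
elim: m => //= m IH c u v; rewrite IH.
exact: lop_iter (so_slin XP _) _ _ _ _.
Qed.

Lemma inord_neq i m : (m < n)%N -> (i < m.+1)%N -> i != inord m.+1 /\
  (i < (inord m.+1 : 'I_n.+1))%N.
Proof. by move=> mn im; rewrite -val_eqE /= inordK// im neq_ltn im. Qed.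

(** Each raising operator crossed by [x_1] costs a factor [q^-1]. *)
Lemma fock_to_X0 m k v : (m <= n)%N ->
  X ord0 (fock_to m k v) =
  (q ^- (\sum_(0 <= l < m) k l))%:C *: fock_to m k (X ord0 v).
Proof.
elim: m => [|m IH] mn; first by rewrite big_nil expr0 invr1 scale1r.
have [i0 _] := @inord_neq ord0 m mn isT.
rewrite /= (@iter_qcomm _ q^-1) ?IH 1?ltnW//; last first.
- by move=> u; rewrite (scomm_sym hq XP)// eq_sym.
- exact: so_lin XP _.
rewrite (lopZ (lop_iter (so_slin XP _) _)) scalerA -rmorphM big_nat_recr//=.
by rewrite exprD invfM exprVn mulrC.
Qed.

Lemma fock_to_Xs0 m k v : (m <= n)%N ->
  Xs ord0 (fock_to m k v) =
  (q ^- (\sum_(0 <= l < m) k l))%:C *: fock_to m k (Xs ord0 v).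
Proof.
elim: m => [|m IH] mn; first by rewrite big_nil expr0 invr1 scale1r.
have [_ i0] := @inord_neq ord0 m mn isT.
rewrite /= (@iter_qcomm _ q^-1) ?IH 1?ltnW//; last first.
- by move=> u; rewrite (scomm_star hq XP).
- exact: so_slin XP _.
rewrite (lopZ (lop_iter (so_slin XP _) _)) scalerA -rmorphM big_nat_recr//=.
by rewrite exprD invfM exprVn mulrC.
Qed.

(** Up to powers of [q], [x_i] crosses all the factors, whose indices are at most [m], and reaches
    the vacuum vector. *)
Lemma fock_to_kill m k v i : vacuum X Xs v -> (m < i)%N ->
  X i (fock_to m k v) = 0.
Proof.
move=> /(vacuumP XP) v0; elim: m => [|m IH] mi /=.
  by rewrite v0// -val_eqE -lt0n.
have mn : (m < n)%N by rewrite -ltnS (ltn_trans mi)// ltn_ord.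
have im : inord m.+1 != i.
  by rewrite -val_eqE /= inordK// neq_ltn mi.
rewrite (@iter_qcomm _ q^-1) ?IH 1?ltnW//.
- by rewrite (lop0 (lop_iter (so_slin XP _) _)) scaler0.
- exact: so_lin XP _.
- by move=> u; rewrite (scomm_sym hq XP).
Qed.

(** The action of the element [s_k] of the bracket relation, for [k = s]. *)
Definition partial_sum (s : nat) v : H := \sum_(l < n.+1 | (l < s)%N) Xs l (X l v).

Lemma partial_sum_lin s : linear (partial_sum s).
Proof.
move=> c u v; rewrite /partial_sum scaler_sumr -big_split; apply: eq_bigr => l _ /=.
by rewrite (so_lin XP) (so_slin XP).
Qed.

Lemma partial_sum_comm i u : partial_sum i (Xs i u) = r%:C *: Xs i (partial_sum i u).
Proof.
rewrite (lop_sum (so_slin XP _)) scaler_sumr; apply: eq_bigr => l li.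
rewrite (scomm_sym hq XP) -?val_eqE ?gtn_eqF//.
by rewrite (lopZ (so_slin XP _)) (scomm_star hq XP)// scalerA -rmorphM -invfM.
Qed.

(** The terms missing from the full sum, which is the identity, vanish by [fock_to_kill]. *)
Lemma partial_sum_fock m k v : (m < n)%N -> vacuum X Xs v ->
  partial_sum m.+1 (fock_to m k v) = fock_to m k v.
Proof.
move=> mn vv; rewrite -[RHS](so_sum XP) /partial_sum big_mkcond /=.
apply: eq_bigr => l _; case: ltnP => // ml.
by rewrite fock_to_kill// (lop0 (so_slin XP _)).
Qed.

(** The bracket relation exchanges [x] with one raising operator at the price of [(1 - r) s], where
    [s] crosses the other [p] factors with [r ^+ p] and then acts as 1; finally [(1 - r ^+ p) + (1 -
    r) r ^+ p = 1 - r ^+ p.+1]. *)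
Lemma fock_to_lower_top m k v p : (m < n)%N -> vacuum X Xs v ->
  X (inord m.+1) (iter p (Xs (inord m.+1)) (fock_to m k v)) =
  (1 - r ^+ p)%:C *: iter p.-1 (Xs (inord m.+1)) (fock_to m k v).
Proof.
move=> mn vv; set g := fock_to m k v; set i : 'I_n.+1 := inord m.+1.
have iE : i = m.+1 :> nat by rewrite inordK.
elim: p => [|p IH].
  by rewrite expr0 subrr scale0r /= fock_to_kill// iE.
rewrite iterS -[LHS](subrK (Xs i (X i (iter p (Xs i) g)))) (so_bracket XP).
rewrite -/(partial_sum i _) (iter_qcomm _ _ (partial_sum_lin i) (partial_sum_comm i)).
rewrite iE partial_sum_fock// IH (lopZ (so_slin XP _)) scalerA -rmorphM.
(* For [p = 0] the numbers of factors differ, but the coefficient is 0. *)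
have -> : (1 - r ^+ p)%:C *: Xs i (iter p.-1 (Xs i) g) =
    (1 - r ^+ p)%:C *: iter p (Xs i) g.
  by case: p {IH} => [|p //]; rewrite expr0 subrr !scale0r.
rewrite -scalerDl -rmorphD; congr (_%:C *: _).
by rewrite (exprS r); ring.
Qed.

Lemma updn_lt k j a l : (l < j)%N -> updn k j a l = k l.
Proof. by rewrite /updn; case: ltngtP. Qed.

Lemma updn_gt k j a l : (j < l)%N -> updn k j a l = k l.
Proof. by rewrite /updn; case: ltngtP. Qed.

Lemma updn_eq k j a : updn k j a j = a.
Proof. by rewrite /updn eqxx. Qed.

Lemma fock_to_step_out (G : H -> H) (a : R) m k v : linear G -> (m < n)%N ->
  (forall u, G (Xs (inord m.+1) u) = a%:C *: Xs (inord m.+1) (G u)) ->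
  G (fock_to m.+1 k v) =
    (a ^+ k m)%:C *: iter (k m) (Xs (inord m.+1)) (G (fock_to m k v)).
Proof. by move=> Gl mn; exact: iter_qcomm. Qed.

(** The factors to the left of the powers of [Xs (inord j.+1)] are crossed at [q^-1] each, which
    gives the tail exponent; then [fock_to_lower_top] applies. *)
Lemma fock_to_lower m j k v : (j < m)%N -> (m <= n)%N -> vacuum X Xs v ->
  X (inord j.+1) (fock_to m k v) =
  ((1 - r ^+ k j) * q ^- (\sum_(j.+1 <= l < m) k l))%:C *:
    fock_to m (updn k j (k j).-1) v.
Proof.
move=> + + vv; elim: m => // m IH jm mn.
move: jm; rewrite ltnS leq_eqVlt => /orP[/eqP ->|jm].
  rewrite big_geq// expr0 invr1 mulr1 /= updn_eq fock_to_lower_top//.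
  by rewrite (@fock_to_ext m (updn k m (k m).-1) k)// => l; exact: updn_lt.
have ij : (inord m.+1 : 'I_n.+1) != inord j.+1.
  by rewrite -val_eqE /= !inordK ?ltnS ?(ltn_trans jm)// eqSS gtn_eqF.
rewrite (@fock_to_step_out _ q^-1)//; first last.
- by move=> u; rewrite (scomm_sym hq XP).
- exact: so_lin XP _.
rewrite IH// ?(ltnW mn)// (lopZ (lop_iter (so_slin XP _) _)) scalerA -rmorphM.
rewrite /= (updn_gt _ _ jm) big_nat_recr//=; congr (_%:C *: _).
by set t := 1 - _; rewrite exprD invfM exprVn; ring.
Qed.

Lemma fock_to_raise m j k v : (j < m)%N -> (m <= n)%N ->
  Xs (inord j.+1) (fock_to m k v) =
  (q ^- (\sum_(j.+1 <= l < m) k l))%:C *: fock_to m (updn k j (k j).+1) v.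
Proof.
elim: m => // m IH jm mn.
move: jm; rewrite ltnS leq_eqVlt => /orP[/eqP ->|jm].
  rewrite big_geq// expr0 invr1 scale1r /= updn_eq iterS.
  by rewrite (@fock_to_ext m (updn k m (k m).+1) k)// => l; exact: updn_lt.
have ij : ((inord j.+1 : 'I_n.+1) < (inord m.+1 : 'I_n.+1))%N.
  have jn := ltn_trans jm mn.
  by rewrite !inordK ?ltnS.
rewrite (@fock_to_step_out _ q^-1)//; first last.
- by move=> u; rewrite (scomm_star hq XP).
- exact: so_slin XP _.
rewrite IH// ?(ltnW mn)// (lopZ (lop_iter (so_slin XP _) _)) scalerA -rmorphM.
rewrite /= (updn_gt _ _ jm) big_nat_recr//=; congr (_%:C *: _).
by rewrite exprD invfM exprVn mulrC.
Qed.

End Fock.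

(** * Irreducibility and the vacuum space *)

Section Span.
Variables (R : realType) (H : hilbertSpace R).
Implicit Types (D S : set H) (u v : H).

Inductive span_of D : H -> Prop :=
| span_of_nil : span_of D 0
| span_of_cons (c : R[i]) d u : D d -> span_of D u -> span_of D (c *: d + u).

Lemma span_of_gen D d : D d -> span_of D d.
Proof.
by move=> Dd; rewrite -[d]scale1r -[_ *: _]addr0; apply/span_of_cons/span_of_nil.
Qed.

Lemma span_of_subspace D : subspace (span_of D).
Proof.
split; first exact: span_of_nil.
move=> c u v Du Dv; elim: Du => [|b d {}u Dd _ IH]; first by rewrite scaler0 add0r.
by rewrite scalerDr scalerA -addrA; exact: span_of_cons.
Qed.

Lemma span_of_min D S : subspace S -> D `<=` S -> span_of D `<=` S.
Proof.
move=> [S0 SS] DS u; elim=> {u} // c d u Dd _ Su; apply: (SS) => //; exact: DS.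
Qed.

Lemma span_of_map D S T u : linear T -> subspace S ->
  (forall d, D d -> S (T d)) -> span_of D u -> S (T u).
Proof.
move=> Tl [S0 SS] DT; elim=> {u} [|c d u Dd _ Su]; first by rewrite (lop0 Tl).
by rewrite Tl; apply: (SS) => //; exact: DT.
Qed.

(** A coefficient function cannot give one index two coefficients, so the induction keeps [s] free
    of duplicates and [c] zero outside [s], and adds a new term to the coefficient at [j]. *)
Lemma span_of_range (I : eqType) (e : I -> H) u : span_of (range e) u ->
  exists (s : seq I) (c : I -> R[i]), u = \sum_(i <- s) c i *: e i.
Proof.
suff : span_of (range e) u -> exists (s : seq I) (c : I -> R[i]),
    [/\ uniq s, forall i, i \notin s -> c i = 0 & u = \sum_(i <- s) c i *: e i].
  by move=> P /P [s [c [_ _ ->]]]; exists s, c.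
elim=> {u} [|a _ u [j _ <-] _ [s [c [us c0 ->]]]].
  by exists [::], (fun=> 0); split; rewrite ?big_nil.
pose s' := if j \in s then s else j :: s.
exists s', (fun i => c i + (i == j)%:R * a).
have us' : uniq s' by rewrite /s'; case: ifPn => //= ->.
have js' : j \in s' by rewrite /s'; case: ifPn => // _; rewrite mem_head.
split=> //.
  move=> i; rewrite /s'; have [->|ij] := eqVneq i j.
    by case: ifPn => [->|_] //; rewrite mem_head.
  by rewrite mul0r addr0; case: ifPn => _; rewrite ?inE ?(negPf ij) => /c0.
rewrite [RHS](eq_bigr (fun i => c i *: e i + ((i == j)%:R * a) *: e i)); last first.
  by move=> i _; rewrite scalerDl.
rewrite big_split /= addrC; congr (_ + _).
  rewrite (bigD1_seq j)//= eqxx mul1r big1 ?addr0// => i /negPf ->.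
  by rewrite mul0r scale0r.
by rewrite /s'; case: ifPn => // js; rewrite big_cons c0// scale0r add0r.
Qed.

End Span.

Section RepInvariant.
Variables (R : realType) (H : hilbertSpace R) (q : R) (n : nat).
Variables (pi : qsphere q%:C n -> H -> H) (piP : star_rep pi).

(** Invariance under [a] and [star a] is proved jointly, which makes the star case of the induction
    a swap. *)
Lemma rep_invariant (S : set H) : subspace S ->
  (forall i v, S v -> S (pi (qsphere_gen q%:C i) v)) ->
  (forall i v, S v -> S (pi (star (qsphere_gen q%:C i)) v)) ->
  forall a v, S v -> S (pi a v).
Proof.
move=> SS SX SXs a.
suff [] : (forall v, S v -> S (pi a v)) /\ (forall v, S v -> S (pi (star a) v)).
  by [].
elim/qsphere_gen_ind: a => [i|c|a b [a1 a2] [b1 b2]|a b [a1 a2] [b1 b2]|a [a1 a2]].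
- by split=> v; [exact: SX|exact: SXs].
- split=> v Sv; rewrite ?starZ ?star1 (repZ piP) (rep_1 piP); exact: subspaceZ.
- split=> v Sv; rewrite ?starD (repD piP);
    apply: subspaceD => //; by [exact: a1|exact: b1|exact: a2|exact: b2].
- split=> v Sv; rewrite ?starM (rep_mul piP).
    exact/a1/b1.
  exact/b2/a2.
- by split=> v; rewrite ?starK; [exact: a2|exact: a1].
Qed.

End RepInvariant.

Section VacuumLine.
Variables (R : realType) (H : hilbertSpace R) (q : R) (n : nat).
Variables X Xs : 'I_n.+1 -> H -> H.
Hypotheses (hq : 1 < `|q|) (XP : sphere_ops q X Xs).
Hypothesis X_irr : forall S : set H, closed_subspace S ->
  (forall i v, S v -> S (X i v)) -> (forall i v, S v -> S (Xs i v)) ->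
  S = [set 0] \/ S = setT.

Lemma X_bounded i : bounded_op (X i).
Proof. by exists 1; exact: so_contr XP i. Qed.

Lemma Xs_bounded i : bounded_op (Xs i).
Proof. by exists 1; exact: so_scontr XP i. Qed.

Lemma gen_cases (P : 'I_n.+1 -> Prop) : P ord0 ->
  (forall j, (j < n)%N -> P (inord j.+1)) -> forall i, P i.
Proof.
move=> P0 Pj i; case: (unliftP ord0 i) => [j ->|-> //].
have -> : lift ord0 j = inord j.+1 by apply: val_inj; rewrite /= inordK// ltnS.
exact: Pj.
Qed.

(** Bounded operators carry invariance to the closure, so the closed span of [D] is a nonzero
    invariant subspace, hence everything. *)
Lemma approx_span_invariant (D : set H) :
  (forall i d, D d -> span_of D (X i d)) ->
  (forall i d, D d -> span_of D (Xs i d)) ->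
  (exists2 d, D d & d != 0) -> forall v, approx (span_of D) v.
Proof.
move=> DX DXs [d Dd d0].
have Sc := approx_subspace (span_of_subspace D).
have [||E v|->//] := X_irr Sc.
- move=> i v; apply: bounded_approx; [exact: so_lin XP i|exact: X_bounded|].
  by move=> w; apply: span_of_map (span_of_subspace _) (DX i); exact: so_lin XP i.
- move=> i v; apply: bounded_approx; [exact: so_slin XP i|exact: Xs_bounded|].
  by move=> w; apply: span_of_map (span_of_subspace _) (DXs i); exact: so_slin XP i.
have : approx (span_of D) d by apply/approx_self/span_of_gen.
by rewrite E /= => dd; rewrite dd eqxx in d0.
Qed.

Lemma fock_to0 m v : fock_to Xs m (fun=> 0) v = v.
Proof. by elim: m. Qed.

(** If a raising operator is present, the outermost one moves across the inner product and kills
    [w]. *)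
Lemma fock_to_vacuum_part m k v : (m <= n)%N ->
  fock_to Xs m k v = v \/
  forall w, vacuum X Xs w -> inner w (fock_to Xs m k v) = 0.
Proof.
elim: m => [|m IH] mn /=; first by left.
case km : (k m) => [|p] /=; first exact: IH (ltnW mn).
right=> w /(vacuumP XP) w0; rewrite -(so_adj XP) w0 ?dot0l//.
by rewrite -val_eqE /= inordK.
Qed.

(* The vectors [fock_to n k v], [v] in [V], span a dense subspace; as those with
   [k <> 0] are orthogonal to the vacuum space, dropping them brings an
   approximation of a vacuum vector into [V] and does not make it worse. *)
Lemma vacuum_irr (V : set H) : closed_subspace V -> V `<=` vacuum X Xs ->
  (forall v, V v -> V (X ord0 v)) -> (forall v, V v -> V (Xs ord0 v)) ->
  (forall v, V v -> v = 0) \/ vacuum X Xs `<=` V.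
Proof.
move=> /closed_subspaceE [VS Vcl] VW VX VXs.
have [[v [Vv v0]]|noV] := pselect (exists v, V v /\ v <> 0); last first.
  by left=> v Vv; apply: contrapT => v0; apply: noV; exists v.
right; pose D := [set u | exists k v, V v /\ u = fock_to Xs n k v].
have DW : forall w, approx (span_of D) w.
  apply: approx_span_invariant.
  - apply: gen_cases => [|j jn] _ [k [u [Vu ->]]].
      rewrite (fock_to_X0 hq XP)//; apply: subspaceZ (span_of_subspace _) _.
      by apply: span_of_gen; exists k, (X ord0 u); split => //; exact: VX.
    rewrite (fock_to_lower hq XP _ jn)//; last exact: VW.
    apply: subspaceZ (span_of_subspace _) _; apply: span_of_gen.
    by exists (updn k j (k j).-1), u.
  - apply: gen_cases => [|j jn] _ [k [u [Vu ->]]].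
      rewrite (fock_to_Xs0 hq XP)//; apply: subspaceZ (span_of_subspace _) _.
      by apply: span_of_gen; exists k, (Xs ord0 u); split => //; exact: VXs.
    rewrite (fock_to_raise hq XP _ _ jn)//.
    apply: subspaceZ (span_of_subspace _) _; apply: span_of_gen.
    by exists (updn k j (k j).+1), u.
  - exists v; last exact/eqP.
    exists (fun=> 0), v; split => //; exact/esym/fock_to0.
move=> w ww; apply: Vcl => e e0; have [u Du wu] := DW w _ e0.
have [x Vx [y xyE y0]] : exists2 x, V x & exists2 y, u = x + y &
    forall w, vacuum X Xs w -> inner w y = 0.
  elim: Du => {u wu} [|c _ u [k [z [Vz ->]]] _ [x Vx [y -> y0]]].
    by exists 0; [case: VS|exists 0; rewrite ?addr0// => z _; rewrite dot0r].
  have [->|z0] := @fock_to_vacuum_part n k z (leqnn n).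
    by exists (c *: z + x); [exact: (VS.2)|exists y; rewrite ?addrA].
  exists x => //; exists (c *: fock_to Xs n k z + y); first by rewrite addrCA.
  by move=> t tt; rewrite dotDr dotZr z0// y0// mulr0 addr0.
exists x => //; apply: le_lt_trans wu.
rewrite -ler_sqr ?nnegrE ?nrm_ge0// xyE opprD addrA (@nrm_pythagoras _ _ (w - x)).
  by rewrite lerDl sqr_ge0.
have /closed_subspaceE [[_ Wl] _] := vacuum_subspace XP.
rewrite dotNr y0 ?oppr0//; have := Wl (-1) _ _ (VW _ Vx) ww.
by rewrite scaleN1r addrC.
Qed.

End VacuumLine.

(** * Irreducible representations with [x_1 <> 0] *)

Section VacuumEigen.
Variables (R : realType) (H : hilbertSpace R) (q : R) (n : nat).
Variables X Xs : 'I_n.+1 -> H -> H.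
Hypotheses (hq : 1 < `|q|) (XP : sphere_ops q X Xs).
Hypothesis X_irr : forall S : set H, closed_subspace S ->
  (forall i v, S v -> S (X i v)) -> (forall i v, S v -> S (Xs i v)) ->
  S = [set 0] \/ S = setT.

Lemma vacuum_eigen : exists lambda : R[i], forall w, vacuum X Xs w ->
  X ord0 w = lambda *: w.
Proof.
apply: (@normal_scalar _ _ (vacuum X Xs) [set X ord0; Xs ord0]
  (vacuum_subspace XP) _ _ (X ord0) (Xs ord0)).
- move=> _ [->|->]; split.
  + exact: so_lin XP _.
  + by exists 1; exact: so_contr XP _.
  + by move=> w; exact: (X0_vacuum XP).
  + exact: so_slin XP _.
  + by exists 1; exact: so_scontr XP _.
  + by move=> w; exact: (Xs0_vacuum XP).
- move=> V Vc VW VG; apply: (vacuum_irr hq XP X_irr Vc VW).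
    by apply: VG; left.
  by apply: VG; right.
- by [].
- exact: (so_adj XP).
- exact: (X0_normal XP).
Qed.

End VacuumEigen.

(** * The orthonormal basis generated by a unit vacuum vector *)

Section FockBasis.
Variables (R : realType) (H : hilbertSpace R) (q : R) (n : nat).
Variables X Xs : 'I_n.+1 -> H -> H.
Hypotheses (hq : 1 < `|q|) (XP : sphere_ops q X Xs).
Variables (w : H) (lambda : R[i]).
Hypotheses (w1 : nrm w = 1) (ww : vacuum X Xs w) (Xw : X ord0 w = lambda *: w).
Implicit Types (k : {ffun 'I_n -> nat}) (j : 'I_n).

Local Notation r := (q ^- 2).

Definition coef (p : nat) : R := Num.sqrt (1 - q ^- (2 * p)).

Definition coef_prod (p : nat) : R := \prod_(s < p) coef s.+1.

Definition nat_index k (l : nat) : nat := oapp k 0%N (insub l).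

(** The norm of the unnormalized Fock vector: each raising operator contributes one [coef]. *)
Definition fock_norm k : R := \prod_(j < n) coef_prod (k j).

Definition fock k : H := ((fock_norm k)^-1)%:C *: fock_to Xs n (nat_index k) w.

Lemma rpow_lt1 p : (0 < p)%N -> r ^+ p < 1.
Proof. by move=> p0; rewrite exprn_ilt1 ?(ltW (r_gt0 hq)) ?(r_lt1 hq)// -lt0n. Qed.

Lemma coef_sqr p : coef p ^+ 2 = 1 - r ^+ p.
Proof.
rewrite /coef exprM -exprVn sqr_sqrtr// subr_ge0.
by rewrite exprn_ile1 ?(ltW (r_gt0 hq)) ?(ltW (r_lt1 hq)).
Qed.

Lemma coef0 : coef 0 = 0.
Proof. by apply/eqP; rewrite -sqrf_eq0 coef_sqr expr0 subrr. Qed.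

Lemma coef_gt0 p : (0 < p)%N -> 0 < coef p.
Proof.
by move=> p0; rewrite sqrtr_gt0 exprM -exprVn subr_gt0 rpow_lt1.
Qed.

Lemma coef_prod_gt0 p : 0 < coef_prod p.
Proof. by rewrite prodr_gt0// => s _; exact: coef_gt0. Qed.

Lemma fock_norm_gt0 k : 0 < fock_norm k.
Proof. by rewrite prodr_gt0// => s _; exact: coef_prod_gt0. Qed.

Lemma upd_id k j : upd k j (k j) = k.
Proof. by apply/ffunP => l; rewrite ffunE; case: eqP => [->|]. Qed.

Lemma upd_upd k j a b : upd (upd k j a) j b = upd k j b.
Proof. by apply/ffunP => l; rewrite !ffunE; case: eqP. Qed.

Lemma upd_at k j a : upd k j a j = a.
Proof. by rewrite ffunE eqxx. Qed.

Lemma fock_norm_raise k j :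
  fock_norm (upd k j (k j).+1) = fock_norm k * coef (k j).+1.
Proof.
rewrite /fock_norm (bigD1 j)//= [in RHS](bigD1 j)//= upd_at.
rewrite /coef_prod big_ord_recr /= mulrAC; congr (_ * _).
congr (_ * _); apply: eq_bigr => l lj.
by rewrite ffunE (negPf lj).
Qed.

Lemma nat_index_upd k j a : nat_index (upd k j a) = updn (nat_index k) j a.
Proof.
apply/funext => l; rewrite /nat_index /updn.
case: insubP => [l' _ /= <-|ln] /=; first by rewrite ffunE val_eqE.
by case: eqP => // lj; rewrite lj ltn_ord in ln.
Qed.

Lemma nat_indexE k j : nat_index k j = k j.
Proof. by rewrite /nat_index valK. Qed.

Lemma nat_index_sum k : \sum_(0 <= l < n) nat_index k l = \sum_(l < n) k l.
Proof. by rewrite big_mkord; apply: eq_bigr => l _; rewrite nat_indexE. Qed.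

Lemma nat_index_tail k j :
  \sum_(j.+1 <= l < n) nat_index k l = \sum_(l < n | (j < l)%N) k l.
Proof. by rewrite big_geq_mkord; apply: eq_bigr => l _; rewrite nat_indexE. Qed.

Lemma lift_inord j : lift ord0 j = inord j.+1.
Proof. by apply: val_inj; rewrite /= inordK// ltnS. Qed.

Lemma fock_X0 k : X ord0 (fock k) = (lambda * (q ^- (\sum_(l < n) k l))%:C) *: fock k.
Proof.
rewrite (lopZ (so_lin XP _)) (fock_to_X0 hq XP)// Xw nat_index_sum.
by rewrite (lopZ (fock_to_lin XP _ _)) !scalerA; congr (_ *: _); ring.
Qed.

Lemma fock_Xs0 (mu : R[i]) k : Xs ord0 w = mu *: w ->
  Xs ord0 (fock k) = (mu * (q ^- (\sum_(l < n) k l))%:C) *: fock k.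
Proof.
move=> Xsw; rewrite (lopZ (so_slin XP _)) (fock_to_Xs0 hq XP)// Xsw nat_index_sum.
by rewrite (lopZ (fock_to_lin XP _ _)) !scalerA; congr (_ *: _); ring.
Qed.

Lemma fock_lower k j : X (lift ord0 j) (fock k) =
  (coef (k j) * q ^- (\sum_(l < n | (j < l)%N) k l))%:C *: fock (upd k j (k j).-1).
Proof.
rewrite (lopZ (so_lin XP _)) lift_inord (fock_to_lower hq XP _ (ltn_ord j))//.
rewrite nat_index_tail nat_indexE -nat_index_upd !scalerA -!rmorphM.
case kj : (k j) => [|p] /=.
  by rewrite expr0 subrr coef0 !(mul0r, mulr0).
congr (_%:C *: _).
(* Lowering an unnormalized vector produces [coef p.+1 ^+ 2]; the change of normalization absorbs
   one of the two factors. *)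
have -> : fock_norm k = fock_norm (upd k j p) * coef p.+1.
  have := fock_norm_raise (upd k j p) j.
  by rewrite upd_at upd_upd -kj upd_id.
rewrite -coef_sqr; field.
by rewrite ?expf_neq0 ?(q_neq0 hq)// ?gt_eqF ?coef_gt0 ?fock_norm_gt0.
Qed.

Lemma fock_raise k j : Xs (lift ord0 j) (fock k) =
  (coef (k j).+1 * q ^- (\sum_(l < n | (j < l)%N) k l))%:C *: fock (upd k j (k j).+1).
Proof.
rewrite (lopZ (so_slin XP _)) lift_inord (fock_to_raise hq XP _ _ (ltn_ord j))//.
rewrite nat_index_tail nat_indexE -nat_index_upd !scalerA -!rmorphM.
congr (_%:C *: _); rewrite fock_norm_raise; field.
by rewrite ?expf_neq0 ?(q_neq0 hq)// ?gt_eqF ?coef_gt0 ?fock_norm_gt0.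
Qed.

(** A raising operator of the left vector moves across as a lowering operator on the right one. This
    lowers both occupation numbers at [j], or gives 0 when the right one is already 0 because
    [coef 0 = 0]. *)
Lemma fock_orthonormal k k' : inner (fock k) (fock k') = (k == k')%:R.
Proof.
have step j k1 k2 : (0 < k1 j)%N -> inner (fock k1) (fock k2) =
    (coef (k2 j) / coef (k1 j) *
      q ^- (\sum_(l < n | (j < l)%N) k2 l) * q ^+ (\sum_(l < n | (j < l)%N) k1 l))%:C *
    inner (fock (upd k1 j (k1 j).-1)) (fock (upd k2 j (k2 j).-1)).
  move=> k1j; have := so_sadj XP (lift ord0 j) (fock (upd k1 j (k1 j).-1)) (fock k2).
  rewrite fock_raise fock_lower upd_at prednK// upd_upd upd_id dotZl.
  rewrite [inner _ (_ *: fock _)]dotZr conjC_real.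
  have -> : (\sum_(l < n | (j < l)%N) upd k1 j (k1 j).-1 l =
             \sum_(l < n | (j < l)%N) k1 l)%N.
    by apply: eq_bigr => l jl; rewrite ffunE -val_eqE gtn_eqF.
  set s1 := (\sum_(l < n | _) k1 l)%N; set s2 := (\sum_(l < n | _) k2 l)%N => E.
  have c1 := coef_gt0 k1j.
  have qs : q ^+ s1 != 0 by rewrite expf_neq0 ?(q_neq0 hq).
  have z0 : (coef (k1 j) / q ^+ s1)%:C != 0 :> R[i].
    by rewrite fmorph_eq0 mulf_neq0 ?invr_neq0// gt_eqF.
  apply: (mulfI z0); rewrite E mulrA -rmorphM; congr (_%:C * _).
  by field; rewrite qs expf_neq0 ?(q_neq0 hq)// gt_eqF.
have off j k1 k2 : (0 < k1 j)%N -> k2 j = 0%N -> inner (fock k1) (fock k2) = 0.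
  by move=> k1j k2j; rewrite (step j)// k2j coef0 !mul0r.
(* Induction on a bound of the total occupation number of [k]; for [k = 0] the roles of the two
   vectors are exchanged. *)
move: {2}(\sum_l k l)%N (leqnn (\sum_l k l)) => N.
elim: N k k' => [|N IH] k k'.
  rewrite leqn0 sum_nat_eq0 => /forallP k0.
  have kj j : k j = 0%N by apply/eqP; exact: k0.
  have [<-|kk'] := eqVneq k k'.
    rewrite inner_nrm /fock nrmZr.
    have -> : fock_norm k = 1.
      by rewrite /fock_norm big1// => j _; rewrite kj /coef_prod big_ord0.
    rewrite (@fock_to_ext _ _ _ _ _ (nat_index k) (fun=> 0%N)).
      by rewrite fock_to0 w1 invr1 normr1 mul1r expr1n.
    by move=> l ln; rewrite -[l]/(val (Ordinal ln)) nat_indexE kj.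
  have [j k'j] : exists j, (0 < k' j)%N.
    apply: contrapT => k'0; move/eqP: kk'; apply; apply/ffunP => j; rewrite kj.
    by case: (posnP (k' j)) => [->//|k'j]; case: k'0; exists j.
  by apply/inner_sym0/(off j).
move=> kN.
have [/existsP [j kj]|] := boolP [exists j, (0 < k j)%N]; last first.
  rewrite negb_exists => /forallP k0; apply: IH.
  by rewrite big1// => j _; apply/eqP; rewrite -leqn0 leqNgt.
have [k'j|k'j] := posnP (k' j).
  rewrite (off j)//; case: eqP => // kk'.
  by rewrite kk' k'j in kj.
rewrite (step j)// IH; last first.
  rewrite (bigD1 j)//= upd_at; rewrite (bigD1 j)//= in kN.
  rewrite (eq_bigr k); last by move=> l lj; rewrite ffunE (negPf lj).
  by rewrite -ltnS; apply: leq_trans kN; rewrite -addSn prednK.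
have [->|kk'] := eqVneq k k'.
  rewrite eqxx mulr1 mulfV ?gt_eqF ?coef_gt0// mul1r mulVf//.
  by rewrite expf_neq0 ?(q_neq0 hq).
case: eqP => [E|_]; last by rewrite mulr0.
case/eqP: kk'; apply/ffunP => l; have /ffunP /(_ l) := E; rewrite !ffunE.
by case: eqP => // -> /(congr1 S); rewrite !prednK.
Qed.

End FockBasis.

Lemma irreducible_psi (R : realType) (q : R) (n : nat) (H : hilbertSpace R)
    (rho : qsphere q%:C n -> H -> H) : 1 < `|q| ->
  irreducible_star_rep rho ->
  (exists v, rho (qsphere_gen q%:C ord0) v <> 0) ->
  exists (lambda : R[i]) (e : {ffun 'I_n -> nat} -> H),
    `|lambda| = 1 /\ is_psi lambda e rho.
Proof.
move=> hq [rhoP Hsep [v0 v0N] rho_irr] X0.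
have XP := rep_sphere_ops rhoP.
set X := fun i => _ in XP; set Xs := fun i => _ in XP.
have X_irr (S : set H) : closed_subspace S ->
    (forall i v, S v -> S (X i v)) -> (forall i v, S v -> S (Xs i v)) ->
    S = [set 0] \/ S = setT.
  move=> Sc SX SXs; apply: rho_irr => //.
  by apply: rep_invariant => //; have /closed_subspaceE [] := Sc.
have [lambda lP] := vacuum_eigen hq XP X_irr.
have [w' w'v w'0] := vacuum_exists hq XP X0.
have n0 := nrm_gt0 w'0.
have [w w1 ww] : exists2 w, nrm w = 1 & vacuum X Xs w.
  exists (((nrm w')^-1)%:C *: w').
    by rewrite nrmZr ger0_norm ?invr_ge0 ?(ltW n0)// mulVf ?gt_eqF.
  have /closed_subspaceE [VS _] := vacuum_subspace XP.
  exact: (subspaceZ _ VS w'v).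
have Xw := lP _ ww.
exists lambda, (fock q Xs w); split.
  (* The modulus of [lambda] is 1 because [|x_1 w|^2 = <w, T w> = |w|^2]. *)
  have : inner (X ord0 w) (X ord0 w) = 1.
    by rewrite (so_adj XP) -/(rho1 X Xs w) ww inner_nrm w1 expr1n.
  rewrite Xw dnormZ inner_nrm w1 expr1n mulr1 => /eqP.
  by rewrite sqrp_eq1 ?normr_ge0// => /eqP.
(* Reading [T w = w] as [lambda *: Xs ord0 w = w]. *)
have Xsw : Xs ord0 w = lambda^-1 *: w.
  have l0 : lambda != 0.
    apply/eqP => l0; have := ww; rewrite /vacuum /rho1 Xw l0 scale0r.
    rewrite (lop0 (so_slin XP _)) => w0; have := w1; rewrite -w0 nrm0 => /eqP.
    by rewrite eq_sym oner_eq0.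
  have E : lambda *: Xs ord0 w = w by rewrite -(lopZ (so_slin XP _)) -Xw.
  by rewrite -[in RHS]E scalerA mulVf// scale1r.
split.
- exact: rhoP.
- split; first exact: (fock_orthonormal hq XP w1 ww).
  apply/denseP => v; apply: (@sub_approx _ _ (span_of (range (fock q Xs w)))).
    by move=> u; exact: span_of_range.
  apply: (approx_span_invariant XP X_irr).
  + apply: gen_cases => [|j jn] _ [k _ <-].
      rewrite (fock_X0 hq XP Xw); apply: subspaceZ (span_of_subspace _) _.
      by apply: span_of_gen; exists k.
    rewrite -[j]/(val (Ordinal jn)) -lift_inord (fock_lower hq XP)//.
    apply: subspaceZ (span_of_subspace _) _; apply: span_of_gen.
    exact: imageP.
  + apply: gen_cases => [|j jn] _ [k _ <-].
      rewrite (fock_Xs0 hq XP _ Xsw).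
      apply: subspaceZ (span_of_subspace _) _.
      by apply: span_of_gen; exists k.
    rewrite -[j]/(val (Ordinal jn)) -lift_inord (fock_raise hq XP)//.
    apply: subspaceZ (span_of_subspace _) _; apply: span_of_gen.
    exact: imageP.
  + exists (fock q Xs w [ffun=> 0%N]); first by exists [ffun=> 0%N].
    apply/eqP => f0; have := fock_orthonormal hq XP w1 ww [ffun=> 0%N] [ffun=> 0%N].
    by rewrite f0 dot0l eqxx => /eqP; rewrite eq_sym oner_eq0.
- by move=> k; exact: (fock_X0 hq XP Xw).
- by move=> j k; exact: (fock_lower hq XP).
- by move=> j k; exact: (fock_raise hq XP).
Qed.

(** * Quotient maps and descent *)

Section StarMorphism.
Variable C : numClosedFieldType.

Record star_morphism (A B : starAlgType C) (f : A -> B) : Prop := {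
  smorphD : {morph f : a b / a + b};
  smorphM : {morph f : a b / a * b};
  smorph1 : f 1 = 1;
  smorphZ : forall c a, f (c *: a) = c *: f a;
  smorphS : forall a, f (star a) = star (f a)
}.

Lemma star_morphism_comp (A B D : starAlgType C) (f : A -> B) (g : B -> D) :
  star_morphism f -> star_morphism g -> star_morphism (fun a => g (f a)).
Proof.
move=> [fD fM f1 fZ fS] [gD gM g1 gZ gS].
split=> [a b|a b||c a|a].
- by rewrite fD gD.
- by rewrite fM gM.
- by rewrite f1 g1.
- by rewrite fZ gZ.
- by rewrite fS gS.
Qed.

Lemma smorph0 (A B : starAlgType C) (f : A -> B) : star_morphism f -> f 0 = 0.
Proof. by move=> fP; have := smorphZ fP 0 0; rewrite !scale0r. Qed.

Variable q : C.

Lemma qsphere_proj_morphism n : star_morphism (@qsphere_proj C q n).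
Proof.
have rel := @qsphere_proj_gen_rel C q n.
split.
- exact: (qsphere_liftD (@rel)).
- exact: (qsphere_liftM (@rel)).
- exact: (qsphere_lift1 (@rel)).
- exact: (qsphere_liftZ (@rel)).
- exact: (qsphere_lift_star (@rel)).
Qed.

Lemma qsphere_proj_gen0 n : qsphere_proj (qsphere_gen q (@ord0 n.+1)) = 0.
Proof.
rewrite /qsphere_proj qsphere_lift_gen; last exact: qsphere_proj_gen_rel.
by rewrite /qsphere_proj_gen unlift_none.
Qed.

Lemma qsphere_proj_genS n (j : 'I_n.+1) :
  qsphere_proj (qsphere_gen q (lift ord0 j)) = qsphere_gen q j.
Proof.
rewrite /qsphere_proj qsphere_lift_gen; last exact: qsphere_proj_gen_rel.
by rewrite /qsphere_proj_gen liftK.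
Qed.

Lemma qsphere_iproj_morphism d m : star_morphism (@qsphere_iproj C q d m).
Proof.
elim: d => [|d IH]; first by split.
exact: star_morphism_comp (@qsphere_proj_morphism _) IH.
Qed.

Lemma qsphere_iproj_gen_lt d m (i : 'I_(d + m).+1) : (i < d)%N ->
  qsphere_iproj (qsphere_gen q i) = 0.
Proof.
elim: d i => // d IH i; case: (unliftP ord0 i) => [i' ->|->] id /=.
  by rewrite qsphere_proj_genS IH.
by rewrite qsphere_proj_gen0 (smorph0 (@qsphere_iproj_morphism _ _)).
Qed.

Lemma qsphere_iproj_gen_ge d m (i : 'I_(d + m).+1) (j : 'I_m.+1) :
  i = (d + j)%N :> nat -> qsphere_iproj (qsphere_gen q i) = qsphere_gen q j.
Proof.
elim: d i => [|d IH] i; first by move=> /= ij; congr qsphere_gen; exact: val_inj.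
case: (unliftP ord0 i) => [i' ->|->] //= [ij].
by rewrite qsphere_proj_genS (IH i').
Qed.

Lemma qsphere_quot_morphism m n (le_mn : (m <= n)%N) :
  star_morphism (@qsphere_quot C q m n le_mn).
Proof.
(* Once [n - m] is an arbitrary [d], the equation [d + m = n] can be destructed and the cast
   disappears. *)
rewrite /qsphere_quot; move: (n - m)%N (subnK le_mn) => d e.
by case: n / e le_mn => _; exact: qsphere_iproj_morphism.
Qed.

Lemma qsphere_quot_gen_lt m n (le_mn : (m <= n)%N) (i : 'I_n.+1) :
  (i < n - m)%N -> qsphere_quot le_mn (qsphere_gen q i) = 0.
Proof.
rewrite /qsphere_quot; move: (n - m)%N (subnK le_mn) => d e.
by case: n / e le_mn i => _ i; exact: qsphere_iproj_gen_lt.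
Qed.

Lemma qsphere_quot_gen_ge m n (le_mn : (m <= n)%N) (i : 'I_n.+1) (j : 'I_m.+1) :
  i = (n - m + j)%N :> nat -> qsphere_quot le_mn (qsphere_gen q i) = qsphere_gen q j.
Proof.
rewrite /qsphere_quot; move: (n - m)%N (subnK le_mn) => d e.
by case: n / e le_mn i => _ i; exact: qsphere_iproj_gen_ge.
Qed.

Lemma qsphere_quot_gen_lift m n (le_mn : (m <= n)%N) (j : 'I_m.+1) :
  exists i : 'I_n.+1, qsphere_quot le_mn (qsphere_gen q i) = qsphere_gen q j.
Proof.
have jn : (n - m + j < n.+1)%N.
  by rewrite ltnS -[X in (_ <= X)%N](subnK le_mn) leq_add2l -ltnS.
by exists (Ordinal jn); exact: qsphere_quot_gen_ge.
Qed.

End StarMorphism.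

Section RepPullback.
Variables (R : realType) (H : hilbertSpace R).

Lemma star_rep_comp (A B : starAlgType R[i]) (f : A -> B) (pi : B -> H -> H) :
  star_morphism f -> star_rep pi -> star_rep (fun a => pi (f a)).
Proof.
move=> [fD fM f1 fZ fS] [pl pb pL p1 pM pS].
split=> [a|a|c a b v|v|a b v|a u v].
- exact: pl.
- exact: pb.
- by rewrite fD fZ pL.
- by rewrite f1 p1.
- by rewrite fM pM.
- by rewrite fS pS.
Qed.

Lemma star_rep_ext (q : R) n (pi1 pi2 : qsphere q%:C n -> H -> H) :
  star_rep pi1 -> star_rep pi2 ->
  (forall i v, pi1 (qsphere_gen q%:C i) v = pi2 (qsphere_gen q%:C i) v) ->
  forall a v, pi1 a v = pi2 a v.
Proof.
move=> p1 p2 p12; elim/qsphere_gen_ind => [i|c|a b IHa IHb|a b IHa IHb|a IH] v.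
- exact: p12.
- by rewrite (repZ p1) (repZ p2) (rep_1 p1) (rep_1 p2).
- by rewrite (repD p1) (repD p2) IHa IHb.
- by rewrite (rep_mul p1) (rep_mul p2) IHa IHb.
- apply: inner_sep => w.
  by rewrite (rep_star p1) (rep_star p2) starK IH.
Qed.

End RepPullback.

Section Descent.
Variables (R : realType) (H : hilbertSpace R) (q : R) (n : nat).
Variable (rho : qsphere q%:C n.+1 -> H -> H).
Hypotheses (rho_irr : irreducible_star_rep rho).
Hypothesis (rho0 : forall v, rho (qsphere_gen q%:C ord0) v = 0).

Let X i := rho (qsphere_gen q%:C (lift ord0 i)).
Let Xs i := rho (star (qsphere_gen q%:C (lift ord0 i))).

(** The term of [x_1] drops out of the partial sums, so the relations among the remaining generators
    are those of the smaller sphere. *)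
Lemma descent_ops : @sphere_ops R H q n X Xs.
Proof.
have XP := rep_sphere_ops (irr_rep rho_irr).
have sumE (P : pred 'I_n.+2) v : \sum_(i < n.+2 | P i)
      rho (star (qsphere_gen q%:C i)) (rho (qsphere_gen q%:C i) v) =
    \sum_(i < n.+1 | P (lift ord0 i)) Xs i (X i v).
  rewrite big_mkcond big_ord_recl rho0 (lop0 (so_slin XP _)) if_same /= add0r.
  by rewrite [RHS]big_mkcond.
split.
- by move=> i; exact: (so_lin XP).
- by move=> i; exact: (so_slin XP).
- by move=> i; exact: (so_adj XP).
- by move=> i j v ij; exact: (so_comm XP).
- by move=> i j v ij; apply: (so_scomm XP); rewrite (inj_eq lift_inj).
- by move=> i v; rewrite (so_bracket XP) sumE.
- by move=> v; rewrite -[RHS](so_sum XP) sumE.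
Qed.

(** A subspace invariant under [rho'] is invariant under [rho], which factors through it; so
    irreducibility descends. *)
Lemma descent : exists rho' : qsphere q%:C n -> H -> H,
  irreducible_star_rep rho' /\ forall a v, rho a v = rho' (qsphere_proj a) v.
Proof.
have rhoP := irr_rep rho_irr; have XP := descent_ops.
pose rho' := ops_rep (q := q) X Xs; have rho'P : star_rep rho' := ops_star_rep XP.
have rE a v : rho a v = rho' (qsphere_proj a) v.
  apply: (star_rep_ext (pi2 := fun a => rho' (qsphere_proj a))) => //.
    exact: star_rep_comp (qsphere_proj_morphism _ _) rho'P.
  move=> i w; case: (unliftP ord0 i) => [j ->|->].
    by rewrite qsphere_proj_genS /rho' (ops_rep_gen XP).
  by rewrite qsphere_proj_gen0 (rep0 rho'P) rho0.
exists rho'; split=> //; split=> //.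
- exact: irr_separable rho_irr.
- exact: irr_nonzero rho_irr.
- move=> W Wc Winv; apply: (irr_subspace rho_irr) => // a v Wv.
  by rewrite rE; exact: Winv.
Qed.

End Descent.

Lemma irreducible_classification (R : realType) (q : R) (n : nat)
    (H : hilbertSpace R) (rho : qsphere q%:C n -> H -> H) : 1 < `|q| ->
  irreducible_star_rep rho ->
  exists (m : nat) (le_mn : (m <= n)%N) (lambda : R[i])
    (e : {ffun 'I_m -> nat} -> H) (psi : qsphere q%:C m -> H -> H),
    [/\ `|lambda| = 1, is_psi lambda e psi
      & forall a v, rho a v = psi (qsphere_quot le_mn a) v].
Proof.
move=> hq; elim: n rho => [|n IH] rho rho_irr; last first.
  have [x0|] := pselect (forall v, rho (qsphere_gen q%:C ord0) v = 0).
    have [rho' [/IH [m [le_mn [l [e [psi [l1 psiP psiE]]]]]] rE]] := descent rho_irr x0.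
    exists m, (leqW le_mn), l, e, psi; split=> //.
    apply: star_rep_ext; first exact: irr_rep rho_irr.
      exact: star_rep_comp (qsphere_quot_morphism _ _) (psi_rep psiP).
    move=> i v; rewrite rE psiE; congr (psi _ v).
    case: (unliftP ord0 i) => [j ->|->]; last first.
      rewrite qsphere_proj_gen0 (smorph0 (qsphere_quot_morphism _ _)).
      by rewrite qsphere_quot_gen_lt// subn_gt0 ltnS.
    rewrite qsphere_proj_genS; have [jm|mj] := ltnP j (n - m).
      by rewrite !qsphere_quot_gen_lt// subSn// /lift /= /bump add1n ltnS.
    have jm : (j - (n - m) < m.+1)%N.
      by rewrite ltnS leq_subLR subnK// -ltnS.
    rewrite (@qsphere_quot_gen_ge _ _ _ _ le_mn _ (Ordinal jm)) ?subnKC//.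
    by rewrite (@qsphere_quot_gen_ge _ _ _ _ _ _ (Ordinal jm))//= subSn// addSn subnKC.
  move=> /existsNP [v v0]; have := irreducible_psi hq rho_irr.
  case; first by exists v.
  move=> l [e [l1 psiP]]; exists n.+1, (leqnn _), l, e, rho; split=> //.
  apply: star_rep_ext; first exact: irr_rep rho_irr.
    exact: star_rep_comp (qsphere_quot_morphism _ _) (psi_rep psiP).
  by move=> i w; rewrite (@qsphere_quot_gen_ge _ _ _ _ _ _ i) ?subnn.
(* For [n = 0] the sphere relation is [x_1^* x_1 = 1], so [x_1] cannot vanish on a nonzero space. *)
have [v v0] := irr_nonzero rho_irr.
have := irreducible_psi hq rho_irr; case.
  exists v => x0; have := so_sum (rep_sphere_ops (irr_rep rho_irr)) v.
  rewrite big_ord_recl big_ord0 addr0 x0.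
  rewrite (lop0 (rep_op_linear (irr_rep rho_irr) _)) => /eqP.
  by rewrite eq_sym (negPf v0).
move=> l [e [l1 psiP]]; exists 0%N, (leqnn _), l, e, rho; split=> //.
apply: star_rep_ext; first exact: irr_rep rho_irr.
  exact: star_rep_comp (qsphere_quot_morphism _ _) (psi_rep psiP).
by move=> i w; rewrite (@qsphere_quot_gen_ge _ _ _ _ _ _ i) ?subnn.
Qed.

(** * Irreducibility of [psi] *)

Section Basis.
Variables (R : realType) (H : hilbertSpace R) (I : choiceType) (e : I -> H).
Hypothesis (eB : orthonormal_basis e).

Lemma basis_nrm i : nrm (e i) = 1.
Proof.
apply/eqP; rewrite -sqrp_eq1 ?nrm_ge0//; apply/eqP/complexI.
by rewrite -inner_nrm (eB.1 i i) eqxx.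
Qed.

Lemma basis_approx v : approx (span_of (range e)) v.
Proof.
have /denseP /(_ v) := eB.2; apply: sub_approx => _ [s [c ->]].
apply: subspace_sum => [|i _]; first exact: span_of_subspace.
apply: subspaceZ (span_of_subspace _) _; apply: span_of_gen; exact: imageP.
Qed.

(** The difference [d] is orthogonal to every finite combination [s], so [|d| <= |d - s|], and the
    right side can be made arbitrarily small. *)
Lemma basis_sep u v : (forall i, inner u (e i) = inner v (e i)) -> u = v.
Proof.
move=> uv; apply/eqP; rewrite -subr_eq0; apply/eqP; set d := u - v.
have de i : inner d (e i) = 0 by rewrite dotBl uv subrr.
apply/nrm0_eq0/small_eq0 => [|eps eps0]; first exact: nrm_ge0.
have [s ss ds] := basis_approx d eps0; apply: le_trans (ltW ds).
rewrite -ler_sqr ?nnegrE ?nrm_ge0// (@nrm_pythagoras _ _ d); last first.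
  suff -> : inner d (- s) = - 0 by rewrite oppr0.
  rewrite dotNr; congr (- _); elim: ss {ds} => [|c _ t [i _ <-] _ IH].
    by rewrite dot0r.
  by rewrite dotDr dotZr de mulr0 add0r.
by rewrite lerDl sqr_ge0.
Qed.

End Basis.

Lemma basis_separable (R : realType) (H : hilbertSpace R) (I : countType)
  (e : I -> H) : orthonormal_basis e -> separable H.
Proof.
move=> eB.
(* Rational coefficients on [e i] and on its multiple by the imaginary unit give all Gaussian
   rational combinations, indexed by a countable type of lists. *)
pose b (p : bool * I) := if p.1 then 'i%C *: e p.2 else e p.2.
pose f (s : seq (rat * (bool * I))) : H :=
  \sum_(p <- s) (ratr p.1 : R)%:C *: b p.2.
exists (range f); split; first exact: (sub_countable (card_image_le _ _) (countableP _)).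
have fD u v : approx (range f) u -> approx (range f) v -> approx (range f) (u + v).
  move=> fu fv eps eps0; have e2 : 0 < eps / 2 by rewrite divr_gt0.
  have [_ [s _ <-] us] := fu _ e2; have [_ [t _ <-] vt] := fv _ e2.
  exists (f (s ++ t)); first exact: imageP.
  by rewrite /f big_cat opprD addrACA (le_lt_trans (nrmD _ _))// (splitr eps) ltrD.
have fb (a : R) p : approx (range f) (a%:C *: b p).
  move=> eps eps0; have e2 := divr_gt0 eps0 (ltr0Sn R 1).
  have [d d0 de] := cfactor_small (nrm_ge0 (b p)) e2.
  have [|x] := @rat_in_itvoo R (a - d) (a + d).
    by rewrite ltrBlDr -addrA ltrDl addr_gt0.
  rewrite in_itv /= => /andP[ax xa].
  exists (f [:: (x, p)]); first exact: imageP.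
  rewrite /f big_seq1 -scalerBl -rmorphB nrmZr mulrC.
  apply: (@le_lt_trans _ _ (eps / 2)).
    by rewrite (le_trans _ de)// ler_wpM2l ?nrm_ge0// ltW// ltr_distlC ax.
  by rewrite ltr_pdivrMr// ltr_pMr// ltr1n.
apply/denseP => v; apply/approx_approx.
apply: sub_approx (basis_approx eB v) => w; elim=> [|c _ u [i _ <-] _ IH].
  by apply: approx_self; exists [::]; rewrite // /f big_nil.
apply: (fD) => //; rewrite [c]complexE scalerDl [in X in _ + X]mulrC -scalerA.
by apply: fD; [exact: (fb _ (false, i))|exact: (fb _ (true, i))].
Qed.

Section PsiTheory.
Variables (R : realType) (q : R) (m : nat) (lambda : R[i]) (H : hilbertSpace R).
Variables (e : {ffun 'I_m -> nat} -> H) (pi : qsphere q%:C m -> H -> H).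
Hypotheses (hq : 1 < `|q|) (hl : `|lambda| = 1) (P : is_psi lambda e pi).
Implicit Types (k : {ffun 'I_m -> nat}) (j : 'I_m).

Local Notation r := (q ^- 2).
Local Notation X i := (pi (qsphere_gen q%:C i)).
Local Notation Xs i := (pi (star (qsphere_gen q%:C i))).
Let zero : {ffun 'I_m -> nat} := [ffun=> 0%N].
Let psi_ops := rep_sphere_ops (psi_rep P).
Let eB := psi_basis P.

(** The structure [is_psi] prescribes [x_1] only; the action of its adjoint is read off from matrix
    coefficients. *)
Lemma psi_xstar1 k :
  Xs ord0 (e k) = (conjC lambda * (q ^- (\sum_(l < m) k l))%:C) *: e k.
Proof.
apply: (basis_sep eB) => l; rewrite (so_sadj psi_ops) (psi_x1 P) dotZr dotZl.
rewrite conjCM_real (eB.1 k l); case: eqP => [->//|_].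
by rewrite !mulr0.
Qed.

Lemma psi_rho1 k : rho1 (fun i => X i) (fun i => Xs i) (e k) =
  (r ^+ (\sum_(l < m) k l))%:C *: e k.
Proof.
rewrite /rho1 (psi_x1 P) (lopZ (so_slin psi_ops _)) psi_xstar1 scalerA mulrACA.
rewrite -normCK hl expr1n mul1r -rmorphM; congr (_%:C *: _).
by rewrite -invfM -expr2 -exprM mulnC exprM -exprVn.
Qed.

Let vac := vacuum (fun i => X i) (fun i => Xs i).

Lemma psi_vacuum0 : vac (e zero).
Proof.
rewrite /vac /vacuum psi_rho1 big1 ?expr0 ?scale1r// => l _.
by rewrite ffunE.
Qed.

(** [T] is diagonal, and its eigenvalue at [k] is less than 1 unless [k] is zero. *)
Lemma psi_vacuum u : vac u -> u = inner u (e zero) *: e zero.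
Proof.
move=> uv; apply: (basis_sep eB) => k; rewrite dotZl (eB.1 zero k).
case: eqP => [<-|k0]; first by rewrite mulr1.
have kpos : (0 < \sum_(l < m) k l)%N.
  rewrite lt0n sum_nat_eq0; apply/negP => /forallP k00; apply: k0.
  by apply/ffunP => l; rewrite ffunE; apply/esym/eqP/k00.
have : inner u (e k) = (r ^+ (\sum_(l < m) k l))%:C * inner u (e k).
  by rewrite -[in LHS]uv (rho1_sym psi_ops) psi_rho1 dotZr conjC_real.
set a := r ^+ _ => E; have : (1 - a)%:C * inner u (e k) = 0.
  by rewrite rmorphB mulrBl mul1r -E subrr.
move=> /eqP; rewrite mulf_eq0 fmorph_eq0 subr_eq0 eq_sym.
by rewrite lt_eqF ?(rpow_lt1 hq)//= => /eqP ->; rewrite mulr0.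
Qed.

Lemma ffun_pos_or_zero k : (exists j, (0 < k j)%N) \/ k = zero.
Proof.
have [[j kj]|kN] := pselect (exists j, (0 < k j)%N); first by left; exists j.
right; apply/ffunP => j; rewrite ffunE; apply/eqP; rewrite -leqn0 leqNgt.
by apply/negP => kj; apply: kN; exists j.
Qed.

Lemma raise_coef_neq0 p s : (coef q p.+1 * q ^- s)%:C != 0 :> R[i].
Proof.
rewrite fmorph_eq0 mulf_neq0 ?invr_neq0 ?expf_neq0 ?(q_neq0 hq)//.
by rewrite gt_eqF ?(coef_gt0 hq).
Qed.

Lemma ffun_nat_ind (Q : {ffun 'I_m -> nat} -> Prop) : Q zero ->
  (forall k j, Q k -> Q (upd k j (k j).+1)) -> forall k, Q k.
Proof.
move=> Q0 QS k; move: {2}(\sum_l k l)%N (leqnn (\sum_l k l)) => N.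
elim: N k => [|N IH] k kN; (have [[j kj]|->//] := ffun_pos_or_zero k).
  by rewrite (bigD1 j)//= in kN; case: (k j) kj kN.
have -> : k = upd (upd k j (k j).-1) j (upd k j (k j).-1 j).+1.
  by rewrite upd_at prednK// upd_upd upd_id.
apply/QS/IH; rewrite (bigD1 j)//= upd_at; rewrite (bigD1 j)//= in kN.
rewrite (eq_bigr k); last by move=> l lj; rewrite ffunE (negPf lj).
by rewrite -ltnS; apply: leq_trans kN; rewrite -addSn prednK.
Qed.

Lemma psi_irreducible (W : set H) : closed_subspace W ->
  (forall i v, W v -> W (X i v)) -> (forall i v, W v -> W (Xs i v)) ->
  W = [set 0] \/ W = setT.
Proof.
move=> Wc WX WXs; have /closed_subspaceE [WS Wcl] := Wc.
have [[v [Wv v0]]|noW] := pselect (exists v, W v /\ v <> 0); last first.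
  left; apply/seteqP; split=> [v Wv|_ ->]; last by case: WS.
  by apply: contrapT => v0; apply: noW; exists v.
right; have [k vk] : exists k, inner v (e k) <> 0.
  apply: contrapT => noe; apply: v0; apply: (basis_sep eB) => k.
  by rewrite dot0l; apply: contrapT => vk; apply: noe; exists k.
have [v' Wv' v'0] : exists2 v', W v' & inner v' (e zero) <> 0.
  (* Applying [x_j] lowers the index at which the coefficient is nonzero, since [x_j^*] sends [e k]
     to a nonzero multiple of the raised basis vector. *)
  elim/ffun_nat_ind: k v Wv {v0} vk => [|k j IH] v Wv vk; first by exists v.
  apply: (IH (X (lift ord0 j) v)); first exact: WX.
  rewrite (so_adj psi_ops) (psi_xstar P) dotZr conjC_real.
  by apply/eqP; rewrite mulf_neq0 ?raise_coef_neq0//; apply/eqP.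
have We0 : W (e zero).
  have [w vw wvac] := rho1_cvg hq psi_ops v'.
  have Ww : W w.
    apply: Wcl; apply: tends_approx vw; elim=> [//|p /= IH].
    exact/WXs/WX.
  have w0 : inner w (e zero) != 0.
    by rewrite (rho1_lim_inner psi_ops vw psi_vacuum0); apply/eqP.
  have -> : e zero = (inner w (e zero))^-1 *: w.
    rewrite [in RHS](psi_vacuum wvac) dotZl (eB.1 zero zero) eqxx mulr1.
    by rewrite scalerA mulVf// scale1r.
  exact: subspaceZ.
have We k' : W (e k').
  elim/ffun_nat_ind: k' => // k' j Wk'.
  have := WXs (lift ord0 j) _ Wk'; rewrite (psi_xstar P).
  set c : R[i] := _%:C => /(subspaceZ c^-1 WS).
  by rewrite scalerA mulVf ?scale1r// raise_coef_neq0.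
apply/seteqP; split=> // u _; apply: Wcl.
apply: sub_approx (basis_approx eB u); apply: span_of_min => // _ [k' _ <-].
exact: We.
Qed.

Lemma psi_quot_irreducible n (le_mn : (m <= n)%N) :
  irreducible_star_rep (fun a => pi (qsphere_quot le_mn a)).
Proof.
have quotP := qsphere_quot_morphism q%:C le_mn.
split.
- exact: star_rep_comp quotP (psi_rep P).
- exact: basis_separable eB.
- exists (e zero); apply/eqP => e0; have := basis_nrm eB zero.
  by rewrite e0 nrm0 => /eqP; rewrite eq_sym oner_eq0.
- move=> W Wc Winv; apply: psi_irreducible => // j v Wv.
    by have [i <-] := qsphere_quot_gen_lift q%:C le_mn j; exact: Winv.
  have [i <-] := qsphere_quot_gen_lift q%:C le_mn j.
  by rewrite -(smorphS quotP); exact: Winv.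
Qed.

End PsiTheory.

(** * Equivalence of the representations [psi] *)

Lemma tends_inner_eq (R : realType) (H1 H2 : hilbertSpace R)
    (x : nat -> H1) (y : nat -> H2) (v a : H1) (u b : H2) :
  tends x v -> tends y u -> (forall n, inner (x n) a = inner (y n) b) ->
  inner v a = inner u b.
Proof.
move=> xv yu xy; apply/eqP; rewrite -subr_eq0 -normr_eq0.
have /complex_realP [s s0] : `|inner v a - inner u b| \is Num.real by [].
rewrite s0; apply/eqP; congr (_%:C); apply: small_eq0.
  by rewrite -ler0c -s0.
move=> e e0; have e2 : 0 < e / 2 by rewrite divr_gt0.
have [d d0 de] := cfactor_small (nrm_ge0 a) e2.
have [d' d'0 d'e] := cfactor_small (nrm_ge0 b) e2.
have [N xN] := xv _ d0; have [M yM] := yu _ d'0.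
set n := maxn N M.
have -> : e = e / 2 + e / 2 by rewrite -splitr.
rewrite -lecR -s0.
have -> : inner v a - inner u b = inner (v - x n) a - inner (u - y n) b.
  by rewrite !dotBl xy opprB addrA subrK.
rewrite (le_trans (ler_normB _ _))// rmorphD lerD//.
  rewrite (le_trans (inner_CS _ _))// lecR (le_trans _ de)// mulrC.
  by rewrite ler_wpM2l ?nrm_ge0// nrm_distC ltW// xN// leq_maxl.
rewrite (le_trans (inner_CS _ _))// lecR (le_trans _ d'e)// mulrC.
by rewrite ler_wpM2l ?nrm_ge0// nrm_distC ltW// yM// leq_maxr.
Qed.

(** * Unitaries between spaces with orthonormal bases on the same index type *)

Section Transfer.
Variables (R : realType) (I : choiceType).

Definition lincomb (H : hilbertSpace R) (e : I -> H) (p : seq I * (I -> R[i])) : H :=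
  \sum_(i <- p.1) p.2 i *: e i.

Section OneWay.
Variables (H1 H2 : hilbertSpace R) (e1 : I -> H1) (e2 : I -> H2).
Hypotheses (eB1 : orthonormal_basis e1) (eB2 : orthonormal_basis e2).

Definition matched v u := forall i, inner v (e1 i) = inner u (e2 i).

Lemma inner_lincomb p p' :
  inner (lincomb e1 p) (lincomb e1 p') = inner (lincomb e2 p) (lincomb e2 p').
Proof.
rewrite !dot_suml; apply: eq_bigr => i _; rewrite !dot_sumr; apply: eq_bigr => j _.
by rewrite !dotZl !dotZr (eB1.1 i j) (eB2.1 i j).
Qed.

Lemma inner_lincomb_matched v u p : matched v u ->
  inner (lincomb e1 p) v = inner (lincomb e2 p) u.
Proof.
move=> vu; rewrite !dot_suml; apply: eq_bigr => i _.
by rewrite !dotZl dotC vu -dotC.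
Qed.

Lemma matched_lincomb p : matched (lincomb e1 p) (lincomb e2 p).
Proof.
move=> i; have := inner_lincomb p ([:: i], fun=> 1).
by rewrite {2 4}/lincomb /= !big_seq1 !scale1r.
Qed.

Lemma nrm_lincomb p p' :
  nrm (lincomb e1 p - lincomb e1 p') = nrm (lincomb e2 p - lincomb e2 p').
Proof.
apply/eqP; rewrite -(eqrXn2 (n := 2)) ?nrm_ge0//; apply/eqP/complexI.
rewrite -!inner_nrm.
by rewrite !dotBl !dotBr !inner_lincomb.
Qed.

(** The combinations that approximate [v], written in the basis [e2], are Cauchy because their
    mutual distances are the same. The approximations are part of the conclusion since the
    preservation of inner products is proved along them. *)
Lemma transfer_exists v : exists u, matched v u /\
  exists2 p : nat -> seq I * (I -> R[i]),
    tends (fun n => lincomb e1 (p n)) v & tends (fun n => lincomb e2 (p n)) u.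
Proof.
have /denseP /(_ v) /approx_tends [x xs xv] := eB1.2.
have /choice [p pP] : forall n, exists p, x n = lincomb e1 p.
  by move=> n; have [s [c ->]] := xs n; exists (s, c).
have E : x = fun n => lincomb e1 (p n) by apply/funext.
rewrite {}E in xv.
have [e e0|u yu] := @cauchy_tends _ _ (fun n => lincomb e2 (p n)).
  have [N xN] := xv _ (divr_gt0 e0 (ltr0Sn R 1)); exists N => m n Nm Nn.
  rewrite -nrm_lincomb (le_lt_trans (nrm_tri v _ _))// (splitr e) ltrD ?xN//.
  by rewrite nrm_distC xN.
exists u; split; last by exists p.
by move=> i; apply: tends_inner_eq xv yu _ => n; exact: matched_lincomb.
Qed.

End OneWay.

Variables (H1 H2 : hilbertSpace R) (e1 : I -> H1) (e2 : I -> H2).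
Hypotheses (eB1 : orthonormal_basis e1) (eB2 : orthonormal_basis e2).

(** Vectors with equal coefficients are equal, so linearity and the inverse map are checked on
    coefficients. *)
Lemma basis_unitary : exists U : {linear H1 -> H2},
  [/\ bijective U, forall u v, inner (U u) (U v) = inner u v
    & forall v, matched e1 e2 v (U v)].
Proof.
have [U UP] := choice (transfer_exists eB1 eB2).
have [V VP] := choice (transfer_exists eB2 eB1).
have Ulin : linear U.
  move=> c u v; apply: (basis_sep eB2) => i; have [M _] := UP (c *: u + v).
  by rewrite -M !dotDl !dotZl (UP u).1 (UP v).1.
pose U' := HB.pack_for {linear H1 -> H2} U (GRing.isLinear.Build _ _ _ _ U Ulin).
exists U'; split.
- exists V => [v|u].
    by apply: (basis_sep eB1) => i; rewrite -(VP _).1 -(UP _).1.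
  by apply: (basis_sep eB2) => i; rewrite -(UP _).1 -(VP _).1.
- move=> u v /=; have [_ [p pu pUu]] := UP u.
  apply/esym; apply: tends_inner_eq pu pUu _ => n.
  exact: inner_lincomb_matched (UP v).1.
- by move=> v; exact: (UP v).1.
Qed.

End Transfer.

Section PsiUnique.
Variables (R : realType) (q : R).
Hypothesis hq : 1 < `|q|.

Lemma psi_equivalent m lambda (H1 H2 : hilbertSpace R)
    (e1 : {ffun 'I_m -> nat} -> H1) (e2 : {ffun 'I_m -> nat} -> H2)
    (pi1 : qsphere q%:C m -> H1 -> H1) (pi2 : qsphere q%:C m -> H2 -> H2) :
  `|lambda| = 1 -> is_psi lambda e1 pi1 -> is_psi lambda e2 pi2 ->
  unitarily_equivalent pi1 pi2.
Proof.
move=> hl P1 P2.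
have [U [Ubij Uinner UM]] := basis_unitary (psi_basis P1) (psi_basis P2).
exists U; split=> //.
have [p1 p2] := (psi_rep P1, psi_rep P2).
have s1 a u v : inner (pi1 (star a) u) v = inner u (pi1 a v).
  by rewrite (rep_star p1) starK.
have s2 a u v : inner (pi2 (star a) u) v = inner u (pi2 a v).
  by rewrite (rep_star p2) starK.
elim/qsphere_gen_ind => [i|c|a b IHa IHb|a b IHa IHb|a IH] v.
(* On coefficients, a generator moves to the basis vector as its adjoint, which acts by the same
   scalars on both bases. *)
- apply: (basis_sep (psi_basis P2)) => k.
  rewrite -UM !(rep_star p1) !(rep_star p2).
  case: (unliftP ord0 i) => [j ->|->].
    by rewrite (psi_xstar P1) (psi_xstar P2) !dotZr UM.
  by rewrite (psi_xstar1 P1) (psi_xstar1 P2) !dotZr UM.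
- by rewrite (repZ p1) (repZ p2) (rep_1 p1) (rep_1 p2) linearZ.
- by rewrite (repD p1) (repD p2) linearD IHa IHb.
- by rewrite (rep_mul p1) (rep_mul p2) IHa IHb.
- have [V _ UV] := Ubij; apply: inner_sep => w; rewrite -(UV w).
  by rewrite Uinner s1 s2 -IH Uinner.
Qed.

(** If [m' < m], the generator with index [n - m] dies in the smaller sphere but becomes [x_1] in
    the other, where it multiplies the vacuum by [lambda]. The conditions on [T] are weak enough to
    cover both a unitary and its inverse as a bare function. *)
Lemma psi_dim_le n m m' (le_mn : (m <= n)%N) (le_m'n : (m' <= n)%N)
    lambda lambda' (H H' : hilbertSpace R)
    (e : {ffun 'I_m -> nat} -> H) (e' : {ffun 'I_m' -> nat} -> H')
    (pi : qsphere q%:C m -> H -> H) (pi' : qsphere q%:C m' -> H' -> H')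
    (T : H -> H') : `|lambda| = 1 ->
  is_psi lambda e pi -> is_psi lambda' e' pi' ->
  injective T -> T 0 = 0 ->
  (forall a v, T (pi (qsphere_quot le_mn a) v) = pi' (qsphere_quot le_m'n a) (T v)) ->
  (m <= m')%N.
Proof.
move=> hl P P' Tinj T0 Tpi; rewrite leqNgt; apply/negP => mm'.
have nm : (n - m < n.+1)%N by rewrite ltnS leq_subr.
have := Tpi (qsphere_gen q%:C (Ordinal nm)) (e [ffun=> 0%N]).
rewrite (@qsphere_quot_gen_lt _ _ _ _ le_m'n) ?ltn_sub2l ?(leq_trans mm')//.
rewrite (rep0 (psi_rep P')) -T0 => /Tinj.
rewrite (@qsphere_quot_gen_ge _ _ _ _ _ _ ord0) ?addn0// (psi_x1 P) big1; last first.
  by move=> l _; rewrite ffunE.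
rewrite expr0 invr1 mulr1 => /(congr1 (@nrm R H)).
by rewrite nrmZ hl mul1r (basis_nrm (psi_basis P)) nrm0 => /eqP; rewrite oner_eq0.
Qed.

Lemma psi_inequivalent n m1 m2 (le_m1n : (m1 <= n)%N) (le_m2n : (m2 <= n)%N)
    lambda1 lambda2 (H1 H2 : hilbertSpace R)
    (e1 : {ffun 'I_m1 -> nat} -> H1) (e2 : {ffun 'I_m2 -> nat} -> H2)
    (pi1 : qsphere q%:C m1 -> H1 -> H1) (pi2 : qsphere q%:C m2 -> H2 -> H2) :
  `|lambda1| = 1 -> `|lambda2| = 1 ->
  is_psi lambda1 e1 pi1 -> is_psi lambda2 e2 pi2 ->
  unitarily_equivalent (fun a => pi1 (qsphere_quot le_m1n a))
                       (fun a => pi2 (qsphere_quot le_m2n a)) ->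
  m1 = m2 /\ lambda1 = lambda2.
Proof.
move=> hl1 hl2 P1 P2 [U [[V UK VK] Uinner Upi]].
have m12 : m1 = m2.
  apply/anti_leq/andP; split.
    exact: (psi_dim_le hl1 P1 P2 (can_inj UK) (raddf0 U) Upi).
  have V0 : V 0 = 0 by have := UK 0; rewrite raddf0.
  have Vpi a v : V (pi2 (qsphere_quot le_m2n a) v) =
      pi1 (qsphere_quot le_m1n a) (V v) by rewrite -{1}[v]VK -Upi UK.
  exact: (psi_dim_le hl2 P2 P1 (can_inj VK) V0 Vpi).
split=> //; subst m2; pose z : {ffun 'I_m1 -> nat} := [ffun=> 0%N].
have Ugen j v : U (pi1 (qsphere_gen q%:C j) v) = pi2 (qsphere_gen q%:C j) (U v).
  have [i iE] := qsphere_quot_gen_lift q%:C le_m1n j.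
  by have := Upi (qsphere_gen q%:C i) v; rewrite (bool_irrelevance le_m2n le_m1n) iE.
have Usgen j v : U (pi1 (star (qsphere_gen q%:C j)) v) =
    pi2 (star (qsphere_gen q%:C j)) (U v).
  apply: inner_sep => w; rewrite -(VK w) Uinner !(rep_star (psi_rep P1)) starK.
  by rewrite (rep_star (psi_rep P2)) starK -Ugen Uinner.
have z0 : (\sum_(l < m1) z l = 0)%N by rewrite big1// => l _; rewrite ffunE.
set u := U (e1 z).
have u0 : u != 0.
  apply/eqP => u0; have : inner u u = 0 by rewrite u0 dot0l.
  rewrite Uinner inner_nrm (basis_nrm (psi_basis P1)) expr1n => /eqP.
  by rewrite oner_eq0.
have x1 : pi2 (qsphere_gen q%:C ord0) u = lambda1 *: u.
  by rewrite -Ugen (psi_x1 P1) z0 expr0 invr1 mulr1 linearZ.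
have uv : vacuum (fun i => pi2 (qsphere_gen q%:C i))
    (fun i => pi2 (star (qsphere_gen q%:C i))) u.
  by rewrite /vacuum /rho1 -Ugen -Usgen; congr (U _); exact: (psi_vacuum0 hl1 P1).
(* Vacuum vectors of [pi2] are multiples of [e2 z], on which [x_1] acts by [lambda2]. *)
have x2 : pi2 (qsphere_gen q%:C ord0) u = lambda2 *: u.
  rewrite (psi_vacuum hq hl2 P2 uv) (lopZ (rep_op_linear (psi_rep P2) _)).
  by rewrite (psi_x1 P2) z0 expr0 invr1 mulr1 !scalerA mulrC.
apply/eqP; rewrite -subr_eq0; have /eqP := x2.
by rewrite x1 -subr_eq0 -scalerBl scaler_eq0 (negPf u0) orbF.
Qed.

End PsiUnique.

(** * The space l^2 *)

Section AbsSq.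
Variable R : realType.
Implicit Types a b : R[i].

Definition abs_sq a : R := complex.Re a ^+ 2 + complex.Im a ^+ 2.

Lemma abs_sqE a : (abs_sq a)%:C = a * conjC a.
Proof. by rewrite -normCK add_Re2_Im2. Qed.

Lemma abs_sq_ge0 a : 0 <= abs_sq a.
Proof. by rewrite addr_ge0 ?sqr_ge0. Qed.

Lemma abs_sq0 a : abs_sq a = 0 -> a = 0.
Proof.
move=> /(congr1 (fun x => x%:C : R[i])); rewrite abs_sqE => /eqP.
by rewrite mulf_eq0 conjC_eq0 orbb => /eqP.
Qed.

Lemma abs_sqM a b : abs_sq (a * b) = abs_sq a * abs_sq b.
Proof. by case: a b => [x y] [z t]; rewrite /abs_sq /=; ring. Qed.

Lemma abs_sqD a b : abs_sq (a + b) <= 2 * abs_sq a + 2 * abs_sq b.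
Proof.
case: a b => [x y] [z t]; rewrite /abs_sq /=.
have [h1 h2] := (sqr_ge0 (x - z), sqr_ge0 (y - t)); nra.
Qed.

Lemma Re_mul_conj_le a b : `|complex.Re (a * conjC b)| <= abs_sq a + abs_sq b.
Proof.
case: a b => [x y] [z t]; rewrite /abs_sq /= ler_norml.
have [h1 h2] := (sqr_ge0 (x - z), sqr_ge0 (y - t)).
have [h3 h4] := (sqr_ge0 (x + z), sqr_ge0 (y + t)).
by apply/andP; split; nra.
Qed.

Lemma Im_mul_conj_le a b : `|complex.Im (a * conjC b)| <= abs_sq a + abs_sq b.
Proof.
case: a b => [x y] [z t]; rewrite /abs_sq /= ler_norml.
have [h1 h2] := (sqr_ge0 (x - t), sqr_ge0 (y - z)).
have [h3 h4] := (sqr_ge0 (x + t), sqr_ge0 (y + z)).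
by apply/andP; split; nra.
Qed.

End AbsSq.

(** * Absolutely convergent sums over a countable type *)

Section CountableSums.
Variables (R : realType) (I : countType).
Implicit Types (a b : I -> R) (s : seq I).

(** The elements with [pickle] code below [N]; all sums over [I] are taken along this
    enumeration. *)
Definition enum_upto N : seq I := pmap (@pickle_inv I) (iota 0 N).

Definition psum a N : R := \sum_(i <- enum_upto N) a i.

Lemma enum_upto_uniq N : uniq (enum_upto N).
Proof. by exact: (pmap_uniq (@pickle_invK I) (iota_uniq _ _)). Qed.

Lemma mem_enum_upto i N : (pickle i < N)%N -> i \in enum_upto N.
Proof.
move=> iN; rewrite mem_pmap; apply/mapP; exists (pickle i).
  by rewrite mem_iota.
by rewrite pickleK_inv.
Qed.

Lemma psumS a N : psum a N.+1 =
  psum a N + oapp a 0 (@pickle_inv I N).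
Proof.
rewrite /psum /enum_upto -[N.+1]addn1 iotaD pmap_cat big_cat /= add0n.
by case: pickle_inv => [i|] /=; rewrite ?big_seq1 ?big_nil.
Qed.

Lemma psum_ge0_nd a : (forall i, 0 <= a i) -> nondecreasing_seq (psum a).
Proof.
move=> a0; apply/nondecreasing_seqP => N; rewrite psumS lerDl.
by case: pickle_inv => [i|] /=.
Qed.

Lemma ler_sum_psum a s : (forall i, 0 <= a i) -> uniq s ->
  exists N, \sum_(i <- s) a i <= psum a N.
Proof.
move=> a0 us; exists (\max_(i <- s) (pickle i).+1)%N.
set N := (\max_(i <- s) _)%N.
have sN : {subset s <= enum_upto N}.
  by move=> i si; apply: mem_enum_upto; rewrite /N (big_rem i)//= leq_maxl.
rewrite /psum [leRHS](bigID (mem s))/= -[X in _ <= X + _]big_filter.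
have E : perm_eq [seq i <- enum_upto N | i \in s] s.
  apply: uniq_perm => //; first by rewrite filter_uniq// enum_upto_uniq.
  by move=> i; rewrite mem_filter; case si : (i \in s) => //=; exact: sN.
by rewrite (perm_big _ E) /= lerDl sumr_ge0.
Qed.

(** Absolute summability through a majorant, so that pointwise estimates such as [Re_mul_conj_le]
    establish it directly. *)
Definition dominated a := exists2 b : I -> R, (forall i, `|a i| <= b i) &
  exists M, forall N, psum b N <= M.

Lemma psumD a b N : psum (fun i => a i + b i) N = psum a N + psum b N.
Proof. exact: big_split. Qed.

Lemma psumZ (c : R) a N : psum (fun i => c * a i) N = c * psum a N.
Proof. by rewrite /psum mulr_sumr. Qed.

Lemma ler_psum a b N : (forall i, a i <= b i) -> psum a N <= psum b N.
Proof. by move=> ab; apply: ler_sum. Qed.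

Lemma psum_bounded_cvg a : (forall i, 0 <= a i) ->
  (exists M, forall N, psum a N <= M) -> cvgn (psum a).
Proof.
move=> a0 [M aM]; apply: nondecreasing_is_cvgn; first exact: psum_ge0_nd.
by exists M => _ [N _ <-].
Qed.

(** Write [a] as [(a + b) - b], a difference of nonnegative families with bounded partial sums. *)
Lemma dominated_cvg a : dominated a -> cvgn (psum a).
Proof.
move=> [b ab [M bM]].
have b0 i : 0 <= b i by apply: le_trans (ab i).
have -> : psum a = psum (fun i => a i + b i) - psum b.
  apply/funext => N; rewrite -[RHS]/(psum (fun i => a i + b i) N - psum b N).
  by rewrite psumD addrK.
apply: is_cvgB; last by apply: psum_bounded_cvg => //; exists M.
apply: psum_bounded_cvg => [i|].
  by rewrite -lerBlDr sub0r; move: (ab i); rewrite ler_norml => /andP[].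
exists (M + M) => N; rewrite psumD lerD// (le_trans _ (bM N))//.
by apply: ler_psum => i; rewrite (le_trans (ler_norm _)).
Qed.

Definition rsum a : R := limn (psum a).

Lemma dominatedD a b : dominated a -> dominated b -> dominated (fun i => a i + b i).
Proof.
move=> [a' aa [M aM]] [b' bb [M' bM]]; exists (fun i => a' i + b' i).
  by move=> i; rewrite (le_trans (ler_normD _ _))// lerD.
by exists (M + M') => N; rewrite psumD lerD.
Qed.

Lemma dominatedZ c a : dominated a -> dominated (fun i => c * a i).
Proof.
move=> [a' aa [M aM]]; exists (fun i => `|c| * a' i).
  by move=> i; rewrite normrM ler_wpM2l.
by exists (`|c| * M) => N; rewrite psumZ ler_wpM2l.
Qed.

Lemma rsumD a b : dominated a -> dominated b ->
  rsum (fun i => a i + b i) = rsum a + rsum b.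
Proof.
move=> /dominated_cvg ac /dominated_cvg bc; rewrite /rsum.
have -> : psum (fun i => a i + b i) = psum a \+ psum b.
  by apply/funext => N; rewrite psumD.
exact: limD.
Qed.

Lemma rsumZ c a : dominated a -> rsum (fun i => c * a i) = c * rsum a.
Proof.
move=> /dominated_cvg ac.
rewrite /rsum; have -> : psum (fun i => c * a i) = (fun=> c) \* psum a.
  by apply/funext => N; rewrite psumZ.
rewrite limM//; last exact: (is_cvg_cst c).
by congr (_ * _); exact: (@lim_cst R).
Qed.

Lemma ler_sum_rsum a s : (forall i, 0 <= a i) -> dominated a -> uniq s ->
  \sum_(i <- s) a i <= rsum a.
Proof.
move=> a0 da us; have [N /le_trans] := ler_sum_psum a0 us; apply.
apply: nondecreasing_cvgn_le; [exact: psum_ge0_nd|exact: dominated_cvg].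
Qed.

Lemma rsum_le a M : dominated a -> (forall N, psum a N <= M) -> rsum a <= M.
Proof. by move=> /dominated_cvg ac aM; apply: limr_le => //; near=> N.
Unshelve. all: by end_near. Qed.

End CountableSums.

Section SquareSummable.
Variables (R : realType) (I : countType).
Implicit Types (f g h : I -> R[i]).

Definition square_summable f :=
  exists M : R, forall N, psum (fun i => abs_sq (f i)) N <= M.

Lemma square_summable_seq f (M : R) :
  (forall s : seq I, uniq s -> \sum_(i <- s) abs_sq (f i) <= M) -> square_summable f.
Proof. by move=> fM; exists M => N; apply: fM; exact: enum_upto_uniq. Qed.

(** The boolean form of the condition makes its proofs irrelevant, so equality is pointwise. *)
Record l2 := L2 { l2_fun :> I -> R[i]; l2P : `[< square_summable l2_fun >] }.

Lemma l2_ext (f g : l2) : (forall i, f i = g i) -> f = g.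
Proof.
case: f g => f fP [g gP] /= /funext fg; subst g.
by congr L2; exact: bool_irrelevance.
Qed.

Lemma l2_ssum (f : l2) : square_summable f.
Proof. exact/asboolP/l2P. Qed.

HB.instance Definition _ := gen_eqMixin l2.
HB.instance Definition _ := gen_choiceMixin l2.

Fact l2_zero_subproof : `[< square_summable (fun=> 0) >].
Proof.
apply/asboolP; exists 0 => N; rewrite /psum big1// => i _.
by rewrite /abs_sq /= expr0n addr0.
Qed.

Fact l2_add_subproof (f g : l2) : `[< square_summable (fun i => f i + g i) >].
Proof.
apply/asboolP; have [M fM] := l2_ssum f; have [M' gM] := l2_ssum g.
exists (2 * M + 2 * M') => N; apply: le_trans (ler_psum N (fun i => abs_sqD _ _)) _.
by rewrite psumD !psumZ lerD ?ler_wpM2l.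
Qed.

Fact l2_scale_subproof (c : R[i]) (f : l2) : `[< square_summable (fun i => c * f i) >].
Proof.
apply/asboolP; have [M fM] := l2_ssum f; exists (abs_sq c * M) => N.
rewrite [leLHS](_ : _ = abs_sq c * psum (fun i => abs_sq (f i)) N).
  by rewrite ler_wpM2l// abs_sq_ge0.
by rewrite -psumZ; apply: eq_bigr => i _; rewrite abs_sqM.
Qed.

Definition l2_zero := L2 l2_zero_subproof.
Definition l2_add (f g : l2) := L2 (l2_add_subproof f g).
Definition l2_scale c (f : l2) := L2 (l2_scale_subproof c f).

Fact l2_addA : associative l2_add.
Proof. by move=> f g h; apply: l2_ext => i /=; rewrite addrA. Qed.

Fact l2_addC : commutative l2_add.
Proof. by move=> f g; apply: l2_ext => i /=; rewrite addrC. Qed.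

Fact l2_add0 : left_id l2_zero l2_add.
Proof. by move=> f; apply: l2_ext => i /=; rewrite add0r. Qed.

Fact l2_addN : left_inverse l2_zero (l2_scale (-1)) l2_add.
Proof. by move=> f; apply: l2_ext => i /=; rewrite mulN1r addNr. Qed.

HB.instance Definition _ := GRing.isZmodule.Build l2 l2_addA l2_addC l2_add0 l2_addN.

Fact l2_scaleA c d (f : l2) : l2_scale c (l2_scale d f) = l2_scale (c * d) f.
Proof. by apply: l2_ext => i /=; rewrite mulrA. Qed.

Fact l2_scale1 : left_id 1 l2_scale.
Proof. by move=> f; apply: l2_ext => i /=; rewrite mul1r. Qed.

Fact l2_scaleDr : right_distributive l2_scale +%R.
Proof. by move=> c f g; apply: l2_ext => i /=; rewrite mulrDr. Qed.

Fact l2_scaleDl (f : l2) : {morph l2_scale^~ f : c d / c + d}.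
Proof. by move=> c d; apply: l2_ext => i /=; rewrite mulrDl. Qed.

HB.instance Definition _ := GRing.Zmodule_isLmodule.Build R[i] l2
  l2_scaleA l2_scale1 l2_scaleDr l2_scaleDl.

Lemma l2D (f g : l2) i : (f + g) i = f i + g i. Proof. by []. Qed.
Lemma l2N (f : l2) i : (- f) i = - f i. Proof. exact: mulN1r. Qed.
Lemma l2B (f g : l2) i : (f - g) i = f i - g i. Proof. by rewrite l2D l2N. Qed.
Lemma l2Z c (f : l2) i : (c *: f) i = c * f i. Proof. by []. Qed.

Lemma l2_dominated (f g : l2) : dominated (fun i => abs_sq (f i) + abs_sq (g i)).
Proof.
have [M fM] := l2_ssum f; have [M' gM] := l2_ssum g.
exists (fun i => abs_sq (f i) + abs_sq (g i)).
  by move=> i; rewrite ger0_norm// addr_ge0 ?abs_sq_ge0.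
by exists (M + M') => N; rewrite psumD lerD.
Qed.

Lemma dominated_le (a b : I -> R) : (forall i, `|a i| <= b i) ->
  dominated b -> dominated a.
Proof.
move=> ab [c bc cM]; exists c => // i; rewrite (le_trans (ab i))//.
by rewrite (le_trans (ler_norm _)).
Qed.

Lemma l2_Re_dominated (f g : l2) : dominated (fun i => complex.Re (f i * conjC (g i))).
Proof. by apply: dominated_le (l2_dominated f g) => i; exact: Re_mul_conj_le. Qed.

Lemma l2_Im_dominated (f g : l2) : dominated (fun i => complex.Im (f i * conjC (g i))).
Proof. by apply: dominated_le (l2_dominated f g) => i; exact: Im_mul_conj_le. Qed.

Lemma l2_sq_dominated (f : l2) : dominated (fun i => abs_sq (f i)).
Proof.
apply: dominated_le (l2_dominated f f) => i.
by rewrite ger0_norm ?abs_sq_ge0// lerDl abs_sq_ge0.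
Qed.

(** Real and imaginary parts are summed apart because [rsum] is real-valued. *)
Definition l2_inner (f g : l2) : R[i] :=
  Complex (rsum (fun i => complex.Re (f i * conjC (g i))))
          (rsum (fun i => complex.Im (f i * conjC (g i)))).

Lemma rsum_lin (x y : R) (a b d : I -> R) : dominated a -> dominated b ->
  dominated d ->
  rsum (fun i => x * a i + (y * b i + d i)) = x * rsum a + (y * rsum b + rsum d).
Proof.
move=> da db dd; have ya := dominatedZ x da; have yb := dominatedZ y db.
by rewrite rsumD ?rsumD ?rsumZ//; exact: dominatedD.
Qed.

Lemma l2_innerP c (f g h : l2) :
  l2_inner (c *: f + g) h = c * l2_inner f h + l2_inner g h.
Proof.
case: c => x y; rewrite /l2_inner.
set A := rsum (fun i => complex.Re (f i * _)).
set B := rsum (fun i => complex.Im (f i * _)).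
set A' := rsum (fun i => complex.Re (g i * _)).
set B' := rsum (fun i => complex.Im (g i * _)).
transitivity (Complex (x * A + (- y * B + A')) (x * B + (y * A + B'))).
  congr Complex; rewrite -rsum_lin;
    do ?[exact: l2_Re_dominated|exact: l2_Im_dominated];
    congr rsum; apply/funext => i; rewrite l2D l2Z;
    by case: (f i) (g i) (h i) => [a b] [a' b'] [a'' b''] /=; ring.
by apply/eqP; rewrite eq_complex /=; apply/andP; split; apply/eqP; ring.
Qed.

Lemma l2_inner_herm (f g : l2) : l2_inner f g = (-1) ^+ false * conjC (l2_inner g f).
Proof.
rewrite expr0 mul1r; apply/eqP; rewrite eq_complex /=; apply/andP; split; apply/eqP.
  congr rsum; apply/funext => i.
  by case: (f i) (g i) => [a b] [a' b'] /=; ring.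
rewrite -mulN1r -rsumZ; last exact: l2_Im_dominated.
congr rsum; apply/funext => i.
by case: (f i) (g i) => [a b] [a' b'] /=; ring.
Qed.

Definition l2_sq (f : l2) : R := rsum (fun i => abs_sq (f i)).

Lemma l2_inner_sq (f : l2) : l2_inner f f = (l2_sq f)%:C.
Proof.
rewrite /l2_inner /l2_sq; congr Complex.
  by congr rsum; apply/funext => i; rewrite -abs_sqE.
have -> : (fun i => complex.Im (f i * conjC (f i))) = fun i => 0 * abs_sq (f i).
  by apply/funext => i; rewrite -abs_sqE mul0r.
by rewrite rsumZ ?mul0r//; exact: l2_sq_dominated.
Qed.

Lemma l2_sq_seq (f : l2) s : uniq s -> \sum_(i <- s) abs_sq (f i) <= l2_sq f.
Proof.
move=> us; apply: ler_sum_rsum => // [i|]; first exact: abs_sq_ge0.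
exact: l2_sq_dominated.
Qed.

Lemma l2_sq_coord (f : l2) i : abs_sq (f i) <= l2_sq f.
Proof. by have := @l2_sq_seq f [:: i] isT; rewrite big_seq1. Qed.

Lemma l2_sq_le (f : l2) M :
  (forall s : seq I, uniq s -> \sum_(i <- s) abs_sq (f i) <= M) -> l2_sq f <= M.
Proof.
move=> fM; apply: rsum_le => [|N]; first exact: l2_sq_dominated.
exact/fM/enum_upto_uniq.
Qed.

Lemma l2_inner_gt0 (f : l2) : f != 0 -> 0 < l2_inner f f.
Proof.
move=> f0; rewrite l2_inner_sq gt0c lt_def; apply/andP; split; last first.
  by have := @l2_sq_seq f [::] isT; rewrite big_nil.
apply: contra_neq f0 => f0; apply: l2_ext => i; apply: abs_sq0.
by apply/le_anti; rewrite abs_sq_ge0 -f0 l2_sq_coord.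
Qed.

Fact l2_inner_bilinear : bilinear_for ( *%R : GRing.Scale.law _ _)
  (conjC \; *%R : GRing.Scale.law _ _) l2_inner.
Proof.
split=> [h c f g|f c g h] /=; first exact: l2_innerP.
rewrite l2_inner_herm expr0 mul1r l2_innerP rmorphD rmorphM.
by rewrite [in RHS]l2_inner_herm [X in _ = _ + X]l2_inner_herm !expr0 !mul1r.
Qed.

End SquareSummable.

(** * Norm and completeness of l^2 *)

Section L2Hilbert.
Variables (R : realType) (I : countType).
Local Notation l2 := (l2 R I).
Implicit Types (f g h : l2).

HB.instance Definition _ := bilinear_isBilinear.Build R[i] l2 l2 R[i]
  _ _ (@l2_inner R I) (@l2_inner_bilinear R I).

HB.instance Definition _ := isHermitianSesquilinear.Build R[i] l2 false conjC
  (@l2_inner R I) (@l2_inner_herm R I).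

HB.instance Definition _ := isDotProduct.Build R[i] l2 (@l2_inner R I)
  (@l2_inner_gt0 R I).

Definition l2_dot : {dot l2 for conjC} := @l2_inner R I.

Definition l2_nrm f : R := Num.sqrt (l2_sq f).

Lemma l2_sq_ge0 f : 0 <= l2_sq f.
Proof. by have := @l2_sq_seq R I f [::] isT; rewrite big_nil. Qed.

Lemma l2_nrm_sqr f : l2_nrm f ^+ 2 = l2_sq f.
Proof. by rewrite sqr_sqrtr// l2_sq_ge0. Qed.

Lemma l2_nrm_ge0 f : 0 <= l2_nrm f.
Proof. exact: sqrtr_ge0. Qed.

Lemma l2_inner_nrm f : l2_dot f f = (l2_nrm f ^+ 2)%:C.
Proof. by rewrite l2_nrm_sqr; exact: l2_inner_sq. Qed.

Lemma l2_nrmD f g : l2_nrm (f + g) <= l2_nrm f + l2_nrm g.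
Proof.
have E : l2_nrm (f + g) ^+ 2 =
    l2_nrm f ^+ 2 + l2_nrm g ^+ 2 + 2 * complex.Re (l2_dot f g).
  rewrite -[LHS]/(complex.Re ((l2_nrm (f + g) ^+ 2)%:C)) -l2_inner_nrm.
  rewrite dotDl !dotDr (dotC _ g f) !l2_inner_nrm !raddfD /=.
  by case: (l2_dot f g) => a b /=; ring.
have CS : complex.Re (l2_dot f g) <= l2_nrm f * l2_nrm g.
  apply: le_trans (ler_norm _) _; rewrite -lecR (le_trans (normc_ge_Re _))//.
  rewrite -ler_sqr ?nnegrE ?normr_ge0 ?ler0c ?mulr_ge0 ?l2_nrm_ge0//.
  apply: le_trans (dot_CauchySchwarz _ _ _) _.
  by rewrite !l2_inner_nrm -rmorphM -rmorphXn lecR exprMn.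
rewrite -ler_sqr ?nnegrE ?addr_ge0 ?l2_nrm_ge0// E sqrrD.
by move: CS; lra.
Qed.

Definition l2_norm f : R[i] := (l2_nrm f)%:C.

Fact l2_normD f g : l2_norm (f + g) <= l2_norm f + l2_norm g.
Proof. by rewrite -rmorphD lecR l2_nrmD. Qed.

Fact l2_normZ c f : l2_norm (c *: f) = `|c| * l2_norm f.
Proof.
have nE g : l2_norm g ^+ 2 = l2_dot g g by rewrite l2_inner_nrm rmorphXn.
apply/eqP; rewrite -(eqrXn2 (n := 2)) ?mulr_ge0 ?normr_ge0 ?ler0c ?l2_nrm_ge0//.
by rewrite exprMn !nE; apply/eqP; exact: dnormZ.
Qed.

Fact l2_norm_eq0 f : l2_norm f = 0 -> f = 0.
Proof.
move=> /(congr1 (@complex.Re R)) /= f0; apply/eqP; rewrite -(dnorm_eq0 l2_dot).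
by rewrite l2_inner_nrm f0 expr0n.
Qed.

HB.instance Definition _ := Lmodule_isNormed.Build R[i] l2
  l2_normD l2_normZ l2_norm_eq0.

Lemma l2_normE f : `|f| = (l2_nrm f)%:C.
Proof. by []. Qed.

Lemma real_cauchy_cvg (u : nat -> R) :
  (forall e : R, 0 < e -> exists N, forall m n, (N <= m)%N -> (N <= n)%N ->
     `|u m - u n| < e) -> cvgn u.
Proof.
move=> uC; apply: cauchy_cvg; apply/cauchy_exP => e /uC [N uN].
exists (u N); exists N => // n /= Nn; rewrite -ball_normE /=.
exact: uN.
Qed.

Lemma l2_coord_le f i :
  `|complex.Re (f i)| <= l2_nrm f /\ `|complex.Im (f i)| <= l2_nrm f.
Proof.
have := l2_sq_coord f i; rewrite -l2_nrm_sqr /abs_sq.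
by split; rewrite -ler_sqr ?nnegrE ?l2_nrm_ge0// real_normK ?num_real//;
  apply: le_trans H; rewrite ?lerDl ?lerDr sqr_ge0.
Qed.

Lemma abs_sq_sum_cvg (u : nat -> I -> R[i]) (l : I -> R[i]) (s : seq I) :
  (forall i, (fun n => complex.Re (u n i)) @ \oo --> complex.Re (l i)) ->
  (forall i, (fun n => complex.Im (u n i)) @ \oo --> complex.Im (l i)) ->
  (fun n => \sum_(i <- s) abs_sq (u n i)) @ \oo --> \sum_(i <- s) abs_sq (l i).
Proof.
move=> uR uI; elim: s => [|i s IH].
  rewrite big_nil; have -> : (fun n => \sum_(i <- [::]) abs_sq (u n i)) = fun=> 0.
    by apply/funext => n; rewrite big_nil.
  exact: cvg_cst.
rewrite big_cons.
have -> : (fun n => \sum_(j <- i :: s) abs_sq (u n j)) =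
    (fun n => abs_sq (u n i)) \+ (fun n => \sum_(j <- s) abs_sq (u n j)).
  by apply/funext => n; rewrite big_cons.
by apply: cvgD => //; apply: cvgD; apply: cvgM.
Qed.

(** The limit is taken coordinatewise. The Cauchy bound holds on each finite set of indices, passes
    to the limit there, and does not depend on the set. *)
Lemma l2_seq_complete (x : nat -> l2) :
  (forall e : R, 0 < e -> exists N, forall m n, (N <= m)%N -> (N <= n)%N ->
     l2_nrm (x m - x n) < e) ->
  exists l : l2, forall e : R, 0 < e -> exists N, forall n, (N <= n)%N ->
    l2_nrm (l - x n) <= e.
Proof.
move=> xC.
have cR i : cvgn (fun n => complex.Re (x n i)).
  apply: real_cauchy_cvg => e /xC [N xN]; exists N => m n Nm Nn.
  have [+ _] := l2_coord_le (x m - x n) i; rewrite l2B raddfB.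
  by move=> /le_lt_trans; apply; exact: xN.
have cI i : cvgn (fun n => complex.Im (x n i)).
  apply: real_cauchy_cvg => e /xC [N xN]; exists N => m n Nm Nn.
  have [_ +] := l2_coord_le (x m - x n) i; rewrite l2B raddfB.
  by move=> /le_lt_trans; apply; exact: xN.
pose l i : R[i] := Complex (limn (fun n => complex.Re (x n i)))
  (limn (fun n => complex.Im (x n i))).
have tail e : 0 < e -> exists N, forall n, (N <= n)%N -> forall s : seq I, uniq s ->
    \sum_(i <- s) abs_sq (l i - x n i) <= e ^+ 2.
  move=> e0; have [N xN] := xC _ e0; exists N => n Nn s us.
  have cv : (fun m => \sum_(i <- s) abs_sq (x m i - x n i)) @ \oo -->
      \sum_(i <- s) abs_sq (l i - x n i).
    apply: (@abs_sq_sum_cvg (fun m i => x m i - x n i)) => i.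
      under eq_fun do rewrite raddfB; rewrite raddfB.
      by apply: cvgB; [exact: cR|exact: cvg_cst].
    under eq_fun do rewrite raddfB; rewrite raddfB.
    by apply: cvgB; [exact: cI|exact: cvg_cst].
  rewrite -(cvg_lim _ cv)//; apply: limr_le; first by apply/cvg_ex; eexists; exact: cv.
  exists N => // m /= Nm.
  rewrite -(eq_bigr _ (fun i _ => congr1 (@abs_sq R) (l2B (x m) (x n) i))).
  apply: le_trans (l2_sq_seq _ us) _.
  by rewrite -l2_nrm_sqr ler_sqr ?nnegrE ?l2_nrm_ge0 ?(ltW e0)// ltW// xN.
have [N0 tN0] := tail 1 ltr01.
(* Only differences from [x n] are controlled, so the limit is formed as [x N0] plus the
   square-summable [l - x N0]. *)
have dP : `[< square_summable (fun i => l i - x N0 i) >].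
  by apply/asboolP/square_summable_seq => s us; exact: tN0.
exists (x N0 + L2 dP) => e e0; have [N tN] := tail e e0; exists N => n Nn.
rewrite -ler_sqr ?nnegrE ?l2_nrm_ge0 ?(ltW e0)// l2_nrm_sqr.
apply: l2_sq_le => s us.
rewrite (eq_bigr (fun i => abs_sq (l i - x n i))); first exact: tN.
by move=> i _; rewrite l2B l2D /=; congr (abs_sq (_ - _)); rewrite addrC subrK.
Qed.

(** The filter is reduced to a sequence by choosing centres of balls of radius [1/(n+1)] that belong
    to [F]; such balls meet pairwise. *)
Lemma l2_complete (F : set_system l2) : ProperFilter F -> cauchy F -> cvg F.
Proof.
move=> FF /cauchy_ballP FC.
have /choice [x xP] : forall n : nat, exists x : l2, F (ball x (n.+1%:R^-1 : R)%:C).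
  move=> n; have /cauchy_ballP /cauchyP := FC; apply.
  by rewrite gt0c invr_gt0.
have ballE (f g : l2) (e : R) : ball f e%:C g <-> l2_nrm (f - g) < e.
  by rewrite -ball_normE /= l2_normE ltcR.
have nrmC (f g : l2) : l2_nrm (f - g) = l2_nrm (g - f).
  by apply: complexI; rewrite -!l2_normE distrC.
have tri (f g h : l2) : l2_nrm (f - h) <= l2_nrm (f - g) + l2_nrm (g - h).
  by rewrite -[f - h](subrKA g) l2_nrmD.
have small (e : R) : 0 < e -> exists N, forall n, (N <= n)%N -> (n.+1%:R)^-1 < e.
  by move=> e0; have [N _ Ne] := near_infty_natSinv_lt (PosNum e0); exists N.
have [e e0|l lP] := l2_seq_complete (x := x).
  have [N Ne] := small _ (divr_gt0 e0 (ltr0Sn R 1)); exists N => m n Nm Nn.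
  have [y [/ballE ym /ballE yn]] := filter_ex (filterI (xP m) (xP n)).
  rewrite (le_lt_trans (tri _ y _))// (splitr e) ltrD//.
    exact: lt_trans ym (Ne _ Nm).
  by rewrite nrmC; exact: lt_trans yn (Ne _ Nn).
apply/cvg_ex; exists l => B /nbhs_ballP [_ /= /ltC0P [e e0 ->] lB].
have e2 := divr_gt0 e0 (ltr0Sn R 1).
have [N Ne] := small _ e2; have [M lM] := lP _ e2.
set n := maxn N M; apply: filterS (xP n) => y /ballE yn; apply: lB; apply/ballE.
rewrite (le_lt_trans (tri _ (x n) _))// (splitr e) ler_ltD//.
  by apply: lM; exact: leq_maxr.
by apply: lt_trans yn _; apply: Ne; exact: leq_maxl.
Qed.

HB.instance Definition _ := Uniform_isComplete.Build l2 l2_complete.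

Definition l2_hilbert : hilbertSpace R.
Proof.
refine (@HilbertSpace R (l2 : completeNormedModType R[i]) l2_dot _).
by move=> f; rewrite l2_inner_nrm l2_normE rmorphXn.
Defined.

End L2Hilbert.

(** * Weighted shifts on l^2 *)

Section L2Basis.
Variables (R : realType) (I : countType).
Local Notation H := (l2_hilbert R I).

Lemma rsum_single (a : I -> R) k : (forall i, i != k -> a i = 0) -> rsum a = a k.
Proof.
move=> a0; apply: cvg_lim => //; apply: cvg_near_cst.
exists (pickle k).+1 => // N /= kN.
by rewrite /psum (bigD1_seq k) ?mem_enum_upto ?enum_upto_uniq//= big1 ?addr0.
Qed.

Fact l2_delta_subproof k : `[< square_summable (fun i : I => (i == k)%:R : R[i]) >].
Proof.
apply/asboolP/square_summable_seq => s us; apply: (@le_trans _ _ 1); last exact: lexx.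
have [ks|ks] := boolP (k \in s); last first.
  rewrite big_seq big1 ?ler01// => i si.
  by rewrite (negPf (memPn ks _ si)) /abs_sq /= expr0n addr0.
rewrite (bigD1_seq k)//= eqxx big1 => [|i /negPf ->]; last first.
  by rewrite /abs_sq /= expr0n addr0.
by rewrite /abs_sq /= expr1n expr0n !addr0.
Qed.

Definition l2_delta k : H := L2 (l2_delta_subproof k).

Definition coord (f : H) i : R[i] := (f : l2 R I) i.
Arguments coord : simpl never.

Lemma coordD (f g : H) i : coord (f + g) i = coord f i + coord g i.
Proof. by []. Qed.

Lemma coordZ c (f : H) i : coord (c *: f) i = c * coord f i.
Proof. by []. Qed.

Lemma coordB (f g : H) i : coord (f - g) i = coord f i - coord g i.
Proof. exact: l2B. Qed.

Lemma coord_sum (J : Type) (s : seq J) (P : pred J) (F : J -> H) i :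
  coord (\sum_(j <- s | P j) F j) i = \sum_(j <- s | P j) coord (F j) i.
Proof. exact: (big_morph (fun f : H => coord f i) (id1 := 0) (op1 := +%R)). Qed.

Lemma coord_ext (f g : H) : (forall i, coord f i = coord g i) -> f = g.
Proof. exact: l2_ext. Qed.

Lemma coord_delta k (i : I) : coord (l2_delta k) i = (i == k)%:R.
Proof. by []. Qed.

Lemma inner_delta (f : H) k : inner f (l2_delta k) = coord f k.
Proof.
apply/eqP; rewrite eq_complex; apply/andP; split; apply/eqP.
  rewrite [LHS](@rsum_single _ k) => [|i ik].
    by rewrite -/(coord (l2_delta k) k) coord_delta eqxx conjC1 mulr1.
  by rewrite -/(coord (l2_delta k) i) coord_delta (negPf ik) conjC0 mulr0.
rewrite [LHS](@rsum_single _ k) => [|i ik].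
  by rewrite -/(coord (l2_delta k) k) coord_delta eqxx conjC1 mulr1.
by rewrite -/(coord (l2_delta k) i) coord_delta (negPf ik) conjC0 mulr0.
Qed.

Lemma nrm_l2 (f : H) : nrm f = l2_nrm f.
Proof. by []. Qed.

Lemma l2_delta_basis : orthonormal_basis l2_delta.
Proof.
split=> [i j|].
  by rewrite inner_delta coord_delta eq_sym.
apply/denseP => v e e0.
have := dominated_cvg (l2_sq_dominated v).
have e2 : 0 < e ^+ 2 by rewrite exprn_gt0.
move=> /cvgrPdist_lt /(_ _ e2) [N _ /(_ N (leqnn N))] /=.
rewrite -/(rsum _) -/(l2_sq v) => Ne.
exists (\sum_(i <- enum_upto I N) coord v i *: l2_delta i).
  by exists (enum_upto I N), (coord v).
set w := \sum_(i <- _) _.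
have wE i : coord w i = if i \in enum_upto I N then coord v i else 0.
  rewrite /w coord_sum; case: ifPn => iN.
    rewrite (bigD1_seq i) ?enum_upto_uniq//= coordZ coord_delta eqxx mulr1 big1 ?addr0//.
    by move=> j ji; rewrite coordZ coord_delta eq_sym (negPf ji) mulr0.
  rewrite big_seq big1// => j jN; rewrite coordZ coord_delta.
  by case: eqP => [ij|_]; rewrite ?mulr0//; rewrite ij jN in iN.
rewrite nrm_l2 -ltr_sqr ?nnegrE ?l2_nrm_ge0 ?(ltW e0)// l2_nrm_sqr.
apply: le_lt_trans Ne; apply: le_trans (ler_norm _); apply: l2_sq_le => s us.
rewrite lerBrDr.
(* The error [v - w] lives on indices disjoint from the enumeration, so its squares over [s] and the
   partial sum together stay below [l2_sq v]. *)
have us' : uniq ([seq i <- s | i \notin enum_upto I N] ++ enum_upto I N).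
  rewrite cat_uniq filter_uniq// enum_upto_uniq andbT /=.
  by apply/hasPn => i iN; rewrite mem_filter iN.
apply: le_trans (l2_sq_seq v us'); rewrite big_cat lerD2r big_filter.
rewrite (bigID (fun i => i \notin enum_upto I N))/= [X in _ + X]big1 ?addr0.
  rewrite le_eqVlt; apply/orP; left; apply/eqP; apply: eq_bigr => i iN.
  transitivity (abs_sq (coord v i - coord w i)); first by rewrite -coordB.
  by rewrite wE (negPf iN) subr0.
move=> i; rewrite negbK => iN.
transitivity (abs_sq (coord v i - coord w i)); first by rewrite -coordB.
by rewrite wE iN subrr /abs_sq /= expr0n addr0.
Qed.

End L2Basis.

Section WeightedShift.
Variables (R : realType) (I : countType).
Local Notation H := (l2_hilbert R I).

Section Def.
Variables (c : I -> R[i]) (s : I -> I).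
Hypothesis c1 : forall i, abs_sq (c i) <= 1.
Hypothesis sI : forall i j, c i != 0 -> c j != 0 -> s i = s j -> i = j.

(** As [s] is injective where [c] is nonzero, reindexing by [s] bounds the sum by a finite part of
    [l2_sq f]. *)
Lemma wshift_sum (f : l2 R I) (u : seq I) : uniq u ->
  \sum_(i <- u) abs_sq (c i * f (s i)) <= l2_sq f.
Proof.
move=> us.
have vs : uniq (map s [seq i <- u | c i != 0]).
  rewrite map_inj_in_uniq ?filter_uniq// => i j; rewrite !mem_filter.
  by move=> /andP[ci _] /andP[cj _]; exact: sI.
apply: le_trans (l2_sq_seq f vs); rewrite big_map big_filter.
rewrite [leRHS]big_mkcond; apply: ler_sum => i _; case: eqP => [->|_] /=.
  by rewrite mul0r /abs_sq /= expr0n addr0.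
by rewrite abs_sqM ler_piMl ?abs_sq_ge0.
Qed.

Fact wshift_subproof (f : l2 R I) : `[< square_summable (fun i => c i * f (s i)) >].
Proof. by apply/asboolP/square_summable_seq; exact: wshift_sum. Qed.

Definition wshift (f : H) : H := L2 (wshift_subproof f).

Lemma wshiftE (f : H) i : coord (wshift f) i = c i * coord f (s i).
Proof. by []. Qed.

Lemma wshift_lin : linear wshift.
Proof.
move=> a f g; apply: coord_ext => i.
by rewrite coordD coordZ !wshiftE coordD coordZ mulrDr mulrCA.
Qed.

Lemma wshift_contr : bounded_by 1 wshift.
Proof.
move=> f; rewrite mul1r !nrm_l2 -ler_sqr ?nnegrE ?l2_nrm_ge0// !l2_nrm_sqr.
by apply: l2_sq_le => u; exact: wshift_sum.
Qed.

End Def.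

Lemma wshift_delta c s c1 sI (c' : R[i]) k k' :
  (forall i, c i * (s i == k)%:R = c' * (i == k')%:R) ->
  @wshift c s c1 sI (l2_delta R k) = c' *: l2_delta R k'.
Proof. by move=> E; apply: coord_ext => i; exact: E. Qed.

(** The hypothesis equates matrix entries. It gives the claim when [f] is a basis vector, where
    pairing with [g] reads off a coordinate; linearity and continuity in [f] do the rest. *)
Lemma wshift_adj c s c1 sI c' s' c1' sI' :
  (forall k i, c i * (s i == k)%:R = conjC (c' k) * (i == s' k)%:R) ->
  forall f g, inner (@wshift c s c1 sI f) g = inner f (@wshift c' s' c1' sI' g).
Proof.
move=> E f g; set T := wshift c1 sI; set T' := wshift c1' sI'.
have Tl : linear T := wshift_lin c1 sI.
have [x xs xf] := approx_tends (basis_approx (@l2_delta_basis R I) f).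
have Tb : bounded_op T by exists 1; exact: wshift_contr.
suff TT u : span_of (range (@l2_delta R I)) u -> inner (T u) g = inner u (T' g).
  by apply: tends_inner_eq (bounded_tends Tl Tb xf) xf _ => n; exact: TT.
elim=> {u} [|a u v [k _ <-] _ IH]; first by rewrite (lop0 Tl) !dot0l.
rewrite Tl !dotDl !dotZl IH; congr (_ * _ + _).
have -> : T (l2_delta R k) = conjC (c' k) *: l2_delta R (s' k).
  exact: wshift_delta (E k).
rewrite dotZl dotC [RHS]dotC !inner_delta /T' wshiftE.
by rewrite [RHS]rmorphM.
Qed.

End WeightedShift.

(** * Existence of [psi] *)

Section PsiExists.
Variables (R : realType) (q : R) (m : nat) (lambda : R[i]).
Hypotheses (hq : 1 < `|q|) (hl : `|lambda| = 1).
Local Notation I := {ffun 'I_m -> nat}.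
Local Notation H := (l2_hilbert R I).
Implicit Types (l k : I) (j : 'I_m) (f : H).

(** The exponent of [q^-1] in the weights: [tail 0] for [x_1], [tail j.+1] for the generator
    [lift ord0 j]. *)
Definition tail (p : nat) l : nat := \sum_(i < m | (p <= i)%N) l i.

Lemma tail0 l : tail 0 l = \sum_(i < m) l i.
Proof. by apply: eq_bigl. Qed.

Lemma tail_end l : tail m l = 0%N.
Proof. by rewrite /tail big_pred0// => i; rewrite leqNgt ltn_ord. Qed.

Lemma tailE j l : tail j l = (l j + tail j.+1 l)%N.
Proof.
rewrite /tail (bigD1 j)//=; congr (_ + _)%N; apply: eq_bigl => i.
by rewrite ltn_neqAle andbC eq_sym.
Qed.

Lemma tail_upd_gt p j a l : (j < p)%N -> tail p (upd l j a) = tail p l.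
Proof.
move=> jp; apply: eq_bigr => i pi; rewrite ffunE -val_eqE gtn_eqF//.
exact: leq_trans pi.
Qed.

Lemma tail_raise p j l : (p <= j)%N -> tail p (upd l j (l j).+1) = (tail p l).+1.
Proof.
move=> pj; rewrite /tail (bigD1 j)//= [in RHS](bigD1 j)//= upd_at addSn.
by congr (_ + _).+1; apply: eq_bigr => i /andP[_ ij]; rewrite ffunE (negPf ij).
Qed.

Lemma upd_neq l j a i : i != j -> upd l j a i = l i.
Proof. by move=> ij; rewrite ffunE (negPf ij). Qed.

Lemma upd_comm l i j a b : i != j -> upd (upd l i a) j b = upd (upd l j b) i a.
Proof.
move=> ij; apply/ffunP => x; rewrite !ffunE; case: eqP => [->|//].
by rewrite eq_sym (negPf ij).
Qed.

Definition qpow (s : nat) : R[i] := (q ^- s)%:C.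
Definition qcoef (p : nat) : R[i] := (coef q p)%:C.
Definition rpow (s : nat) : R[i] := ((q ^- 2) ^+ s)%:C.

Lemma qpowS s : q%:C * qpow s.+1 = qpow s.
Proof.
by rewrite -rmorphM exprS invfM mulrA mulfV ?mul1r// (q_neq0 hq).
Qed.

Lemma qpow_sqr s : qpow s * qpow s = rpow s.
Proof.
by rewrite -rmorphM -invfM -expr2 -exprM mulnC exprM -exprVn.
Qed.

Lemma qcoef_sqr p : qcoef p * qcoef p = 1 - rpow p.
Proof. by rewrite -rmorphM -expr2 (coef_sqr hq) rmorphB rmorph1. Qed.

Lemma qcoef0 : qcoef 0 = 0.
Proof. by rewrite /qcoef (coef0 hq). Qed.

Lemma rpowD s t : rpow (s + t) = rpow s * rpow t.
Proof. by rewrite /rpow exprD rmorphM. Qed.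

Lemma rpow0 : rpow 0 = 1.
Proof. by rewrite /rpow expr0. Qed.

Lemma lambda_conj : conjC lambda * lambda = 1.
Proof. by rewrite mulrC -normCK hl expr1n. Qed.

(* [x_i] maps [f] to [wX i * (f \o sX i)], and [x_i^*] maps it to
   [wXs i * (f \o sXs i)]. Where the predecessor in [sXs] is not the inverse of
   the successor, the weight [wXs] is 0. *)
Definition wX (i : 'I_m.+1) l : R[i] :=
  if unlift ord0 i is Some j then qcoef (l j).+1 * qpow (tail j.+1 l)
  else lambda * qpow (tail 0 l).

Definition sX (i : 'I_m.+1) l : I :=
  if unlift ord0 i is Some j then upd l j (l j).+1 else l.

Definition wXs (i : 'I_m.+1) l : R[i] :=
  if unlift ord0 i is Some j then qcoef (l j) * qpow (tail j.+1 l)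
  else conjC lambda * qpow (tail 0 l).

Definition sXs (i : 'I_m.+1) l : I :=
  if unlift ord0 i is Some j then upd l j (l j).-1 else l.

Lemma abs_sq_real (x : R) : abs_sq (x%:C : R[i]) = x ^+ 2.
Proof. by rewrite /abs_sq /= expr0n addr0. Qed.

Lemma abs_sq_qpow s : abs_sq (qpow s) <= 1.
Proof.
rewrite abs_sq_real -exprVn -exprM mulnC exprM exprVn.
by rewrite exprn_ile1 ?(ltW (r_gt0 hq)) ?(ltW (r_lt1 hq)).
Qed.

Lemma abs_sq_qcoef p : abs_sq (qcoef p) <= 1.
Proof.
by rewrite abs_sq_real (coef_sqr hq) gerBl exprn_ge0 ?(ltW (r_gt0 hq)).
Qed.

Lemma abs_sq_norm1 (z : R[i]) : `|z| = 1 -> abs_sq z = 1.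
Proof. by move=> z1; apply: complexI; rewrite abs_sqE -normCK z1 expr1n. Qed.

Lemma wX_le1 i l : abs_sq (wX i l) <= 1.
Proof.
rewrite /wX; case: unliftP => [j _|_]; rewrite abs_sqM mulr_ile1 ?abs_sq_ge0
  ?abs_sq_qpow ?abs_sq_qcoef//.
by rewrite abs_sq_norm1.
Qed.

Lemma wXs_le1 i l : abs_sq (wXs i l) <= 1.
Proof.
rewrite /wXs; case: unliftP => [j _|_]; rewrite abs_sqM mulr_ile1 ?abs_sq_ge0
  ?abs_sq_qpow ?abs_sq_qcoef//.
by rewrite abs_sq_norm1// norm_conjC.
Qed.

Lemma sX_inj i l l' : wX i l != 0 -> wX i l' != 0 -> sX i l = sX i l' -> l = l'.
Proof.
move=> _ _; rewrite /sX; case: unliftP => [j _|_] // /ffunP E.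
apply/ffunP => x; have := E x; rewrite !ffunE.
by case: eqP => [-> []|_].
Qed.

Lemma qcoef_pos l j (z : R[i]) : qcoef (l j) * z != 0 -> (0 < l j)%N.
Proof. by case: (l j) => //; rewrite qcoef0 mul0r eqxx. Qed.

Lemma sXs_inj i l l' : wXs i l != 0 -> wXs i l' != 0 -> sXs i l = sXs i l' -> l = l'.
Proof.
rewrite /sXs /wXs; case: unliftP => [j _|_] // /qcoef_pos lj /qcoef_pos l'j /ffunP E.
apply/ffunP => x; have := E x; rewrite !ffunE.
by case: eqP => [->|_] //; move: lj l'j; case: (l j) (l' j) => [|a] [|b] //= _ _ ->.
Qed.

Definition psiX i : H -> H := wshift (wX_le1 i) (@sX_inj i).
Definition psiXs i : H -> H := wshift (wXs_le1 i) (@sXs_inj i).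

(** Both indicators say that [k] is [l] raised at [j], except when [k j = 0]: then the lowered index
    is [k] itself, and [qcoef 0 = 0] removes it. *)
Lemma raise_lowerE j l k : qcoef (l j).+1 * (upd l j (l j).+1 == k)%:R =
  qcoef (k j) * (l == upd k j (k j).-1)%:R.
Proof.
have [<-|lk] := eqVneq (upd l j (l j).+1) k.
  by rewrite upd_at upd_upd upd_id eqxx.
have [lk'|_] := eqVneq l (upd k j (k j).-1); last by rewrite !mulr0n !mulr0.
case kj : (k j) => [|p]; first by rewrite qcoef0 mul0r mulr0n mulr0.
by case/eqP: lk; rewrite lk' upd_at upd_upd kj /= -kj upd_id.
Qed.

Lemma tail_lower j l k : l = upd k j (k j).-1 -> tail j.+1 l = tail j.+1 k.
Proof. by move=> ->; rewrite tail_upd_gt. Qed.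

Lemma wX_adj i k l :
  wX i l * (sX i l == k)%:R = conjC (wXs i k) * (l == sXs i k)%:R.
Proof.
rewrite /wX /sX /wXs /sXs; case: unliftP => [j _|_]; rewrite conjCM_real.
  rewrite conjC_real mulrAC raise_lowerE.
  case: eqP => [/tail_lower ->|_]; first by rewrite !mulr1.
  by rewrite !mulr0 mul0r.
by rewrite conjCK; case: eqP => [->|_] //; rewrite !mulr0.
Qed.

Lemma wXs_adj i k l :
  wXs i l * (sXs i l == k)%:R = conjC (wX i k) * (l == sX i k)%:R.
Proof.
have := wX_adj i l k; rewrite (eq_sym l) (eq_sym _ k).
case: (sX i k == l); case: (k == sXs i l); rewrite ?mulr1 ?mulr0 // => E.
- by rewrite E conjCK.
- by rewrite E conjC0.
- by apply/eqP; rewrite -conjC_eq0 -E.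
Qed.

Lemma psiX_adj i (f g : H) : inner (psiX i f) g = inner f (psiXs i g).
Proof. by apply: wshift_adj => k l; exact: wX_adj. Qed.

Lemma psiXs_delta i k : psiXs i (l2_delta R k) = conjC (wX i k) *: l2_delta R (sX i k).
Proof. by apply: wshift_delta => l; exact: wXs_adj. Qed.

Lemma psiX_delta i k : psiX i (l2_delta R k) = conjC (wXs i k) *: l2_delta R (sXs i k).
Proof. by apply: wshift_delta => l; exact: wX_adj. Qed.

Lemma psiX_coord0 f l : coord (psiX ord0 f) l = lambda * qpow (tail 0 l) * coord f l.
Proof. by rewrite wshiftE /wX /sX unlift_none. Qed.

Lemma psiXs_coord0 f l :
  coord (psiXs ord0 f) l = conjC lambda * qpow (tail 0 l) * coord f l.
Proof. by rewrite wshiftE /wXs /sXs unlift_none. Qed.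

Lemma psiX_coord j f l : coord (psiX (lift ord0 j) f) l =
  qcoef (l j).+1 * qpow (tail j.+1 l) * coord f (upd l j (l j).+1).
Proof. by rewrite wshiftE /wX /sX liftK. Qed.

Lemma psiXs_coord j f l : coord (psiXs (lift ord0 j) f) l =
  qcoef (l j) * qpow (tail j.+1 l) * coord f (upd l j (l j).-1).
Proof. by rewrite wshiftE /wXs /sXs liftK. Qed.

(** The coordinate shifted by [x_j] is counted in the tail weight of [x_i], but not conversely; the
    extra unit there is the factor [q], by [qpowS]. *)
Lemma psiX_comm (i j : 'I_m.+1) f : (i < j)%N ->
  psiX i (psiX j f) = q%:C *: psiX j (psiX i f).
Proof.
case: (unliftP ord0 j) => [j' ->|-> //].
case: (unliftP ord0 i) => [i' ->|->] ij; apply: coord_ext => l; rewrite coordZ.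
  have ij' : (i' < j')%N by [].
  have ne : i' != j' by rewrite -val_eqE ltn_eqF.
  rewrite !psiX_coord !upd_neq// 1?eq_sym// tail_upd_gt ?(leqW ij')//.
  rewrite (tail_raise _ ij') (upd_comm _ _ _ ne) -(qpowS (tail i'.+1 l)).
  by ring.
rewrite psiX_coord0 !psiX_coord psiX_coord0 tail_raise// -(qpowS (tail 0 l)).
by ring.
Qed.

Lemma psiX_scomm_lt (i j : 'I_m.+1) f : (i < j)%N ->
  psiXs i (psiX j f) = q%:C *: psiX j (psiXs i f).
Proof.
case: (unliftP ord0 j) => [j' ->|-> //].
case: (unliftP ord0 i) => [i' ->|->] ij; apply: coord_ext => l; rewrite coordZ.
  have ij' : (i' < j')%N by [].
  have ne : i' != j' by rewrite -val_eqE ltn_eqF.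
  rewrite psiXs_coord !psiX_coord psiXs_coord !upd_neq// 1?eq_sym//.
  rewrite tail_upd_gt ?(leqW ij')//.
  rewrite (tail_raise _ ij') (upd_comm _ _ _ ne) -(qpowS (tail i'.+1 l)).
  by ring.
rewrite psiXs_coord0 !psiX_coord psiXs_coord0 tail_raise// -(qpowS (tail 0 l)).
by ring.
Qed.

Lemma psiXs_adj i (f g : H) : inner (psiXs i f) g = inner f (psiX i g).
Proof. by rewrite dotC -psiX_adj -dotC. Qed.

(* The case [j < i] is the adjoint of the case [i < j]. *)
Lemma psiX_scomm (i j : 'I_m.+1) f : i != j ->
  psiXs i (psiX j f) = q%:C *: psiX j (psiXs i f).
Proof.
rewrite neq_ltn => /orP[|ji]; first exact: psiX_scomm_lt.
apply: inner_sep => g; rewrite psiXs_adj psiX_adj psiX_scomm_lt//.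
by rewrite dotZr conjC_real dotZl psiX_adj psiXs_adj.
Qed.

(* The operator [x_i^* x_i] is diagonal with these weights, which telescope to
   those of [s_i]. *)
Definition diag_weight (p : nat) l : R[i] :=
  if p is p'.+1 then rpow (tail p l) - rpow (tail p' l) else rpow (tail 0 l).

Lemma psiXsX_coord (i : 'I_m.+1) f l :
  coord (psiXs i (psiX i f)) l = diag_weight i l * coord f l.
Proof.
case: (unliftP ord0 i) => [j ->|->]; last first.
  rewrite psiXs_coord0 psiX_coord0 /diag_weight /= -qpow_sqr.
  transitivity (conjC lambda * lambda * (qpow (tail 0 l) * qpow (tail 0 l)) *
    coord f l).
    by ring.
  by rewrite lambda_conj mul1r.
rewrite psiXs_coord psiX_coord /diag_weight lift0 /= tailE rpowD.
case lj : (l j) => [|p]; first by rewrite qcoef0 rpow0; ring.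
rewrite upd_at upd_upd -lj upd_id tail_upd_gt// lj /=.
transitivity (qcoef p.+1 * qcoef p.+1 * (qpow (tail j.+1 l) * qpow (tail j.+1 l)) *
  coord f l).
  by ring.
by rewrite qcoef_sqr qpow_sqr; ring.
Qed.

Lemma psiXXs_coord j f l : coord (psiX (lift ord0 j) (psiXs (lift ord0 j) f)) l =
  (1 - rpow (l j).+1) * rpow (tail j.+1 l) * coord f l.
Proof.
rewrite psiX_coord psiXs_coord upd_at upd_upd upd_id tail_upd_gt//.
by rewrite -qcoef_sqr -qpow_sqr; ring.
Qed.

Lemma diag_weight_sum p l : (\sum_(0 <= i < p.+1) diag_weight i l) = rpow (tail p l).
Proof.
elim: p => [|p IH]; first by rewrite big_nat1.
by rewrite big_nat_recr//= IH addrC subrK.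
Qed.

Lemma psi_partial_sum (p : nat) f l : (p <= m)%N ->
  coord (\sum_(i < m.+1 | (i < p.+1)%N) psiXs i (psiX i f)) l =
  rpow (tail p l) * coord f l.
Proof.
move=> pm; rewrite coord_sum.
rewrite (eq_bigr (fun i : 'I_m.+1 => diag_weight i l * coord f l)); last first.
  by move=> i _; exact: psiXsX_coord.
rewrite -mulr_suml -(big_ord_widen _ (diag_weight^~ l))//.
by rewrite -(big_mkord xpredT (diag_weight^~ l)) diag_weight_sum.
Qed.

Lemma psi_sphere_ops : sphere_ops q psiX psiXs.
Proof.
split.
- by move=> i; exact: wshift_lin.
- by move=> i; exact: wshift_lin.
- exact: psiX_adj.
- exact: psiX_comm.
- exact: psiX_scomm.
- move=> i f; case: (unliftP ord0 i) => [j ->|->]; apply: coord_ext => l;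
    rewrite coordB coordZ.
    rewrite (psi_partial_sum _ _ (ltnW (ltn_ord j))) psiXXs_coord psiXsX_coord.
    rewrite /diag_weight lift0 tailE !rpowD -[(l j).+1]addn1 rpowD.
    have -> : rpow 1 = (q ^- 2)%:C by [].
    by rewrite rmorphB rmorph1; ring.
  rewrite coord_sum big_pred0 ?mulr0// psiX_coord0 psiXs_coord0 psiXs_coord0 psiX_coord0.
  by ring.
(* The telescoped weight of the full sum is [rpow (tail m l)], and that tail is empty. *)
- move=> f; apply: coord_ext => l.
  have := psi_partial_sum f l (leqnn m); rewrite tail_end rpow0 mul1r => <-.
  by congr (coord _ l); apply: eq_bigl => i; rewrite ltn_ord.
Qed.

Lemma psi_exists : exists (H : hilbertSpace R) (e : {ffun 'I_m -> nat} -> H)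
  (psi : qsphere q%:C m -> H -> H), is_psi lambda e psi.
Proof.
have P := psi_sphere_ops.
exists H, (@l2_delta R I), (ops_rep psiX psiXs); split.
- exact: ops_star_rep P.
- exact: l2_delta_basis.
- move=> k; rewrite (ops_rep_gen P) psiX_delta /wXs /sXs unlift_none.
  by rewrite conjCM_real conjCK tail0.
- move=> j k; rewrite (ops_rep_gen P) psiX_delta /wXs /sXs liftK.
  by rewrite conjCM_real conjC_real -rmorphM.
- move=> j k; rewrite (ops_rep_sgen P) psiXs_delta /wX /sX liftK.
  by rewrite conjCM_real conjC_real -rmorphM.
Qed.

End PsiExists.

Theorem mainTheorem2 (R : realType) (q : R) (n : nat) (hq : 1 < `|q|) :
  (* for m <= n and lambda in S^1, psi_lambda^(2m+1) exists *)
  (forall (m : nat) (lambda : R[i]), (m <= n)%N -> `|lambda| = 1 ->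
     exists (H : hilbertSpace R) (e : {ffun 'I_m -> nat} -> H)
            (psi : qsphere q%:C m -> H -> H), is_psi lambda e psi) /\
  (* composed with the quotient map, it is an irreducible *-representation *)
  (forall (m : nat) (le_mn : (m <= n)%N) (lambda : R[i]) (H : hilbertSpace R)
          (e : {ffun 'I_m -> nat} -> H) (psi : qsphere q%:C m -> H -> H),
     `|lambda| = 1 -> is_psi lambda e psi ->
     irreducible_star_rep (fun a => psi (qsphere_quot le_mn a))) /\
  (* different pairs (m, lambda) give inequivalent representations *)
  (forall (m1 m2 : nat) (le_m1n : (m1 <= n)%N) (le_m2n : (m2 <= n)%N)
          (lambda1 lambda2 : R[i]) (H1 H2 : hilbertSpace R)
          (e1 : {ffun 'I_m1 -> nat} -> H1) (e2 : {ffun 'I_m2 -> nat} -> H2)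
          (psi1 : qsphere q%:C m1 -> H1 -> H1)
          (psi2 : qsphere q%:C m2 -> H2 -> H2),
     `|lambda1| = 1 -> `|lambda2| = 1 ->
     is_psi lambda1 e1 psi1 -> is_psi lambda2 e2 psi2 ->
     (unitarily_equivalent (fun a => psi1 (qsphere_quot le_m1n a))
                           (fun a => psi2 (qsphere_quot le_m2n a))
      <-> m1 = m2 /\ lambda1 = lambda2)) /\
  (* every irreducible *-representation is equivalent to one of them *)
  (forall (H : hilbertSpace R) (rho : qsphere q%:C n -> H -> H),
     irreducible_star_rep rho ->
     exists (m : nat) (le_mn : (m <= n)%N) (lambda : R[i])
            (H' : hilbertSpace R) (e : {ffun 'I_m -> nat} -> H')
            (psi : qsphere q%:C m -> H' -> H'),
       [/\ `|lambda| = 1, is_psi lambda e psi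
         & unitarily_equivalent rho (fun a => psi (qsphere_quot le_mn a))]).
Proof.
split; first by move=> m lambda _ l1; exact: (psi_exists m hq l1).
split; first by move=> m le_mn lambda H e psi l1 P; exact: (psi_quot_irreducible hq l1 P).
split=> [m1 m2 le1 le2 lambda1 lambda2 H1 H2 e1 e2 psi1 psi2 l1 l2 P1 P2|H rho].
  split; first exact: (psi_inequivalent hq l1 l2 P1 P2).
  move=> [m12 l12]; subst m2 lambda2.
  have [U [Ubij Uinner Upsi]] := psi_equivalent l1 P1 P2.
  exists U; split=> // a v; rewrite (bool_irrelevance le2 le1); exact: Upsi.
move=> /(irreducible_classification hq) [m [le_mn [lambda [e [psi [l1 P E]]]]]].
exists m, le_mn, lambda, H, e, psi; split=> //.
(* The classification produces [psi] on the space of [rho] itself, so the unitary is the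
   identity. *)
by exists idfun; split=> //; exists idfun.
Qed.
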